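(* For every $N\ge2$ and $\bar s\in(0,1)$ there exists a constant $C(N,\bar s)>0$ with the following property. For $s\in(0,\bar s)$, suppose that $E\subset\mathbb{R}^N$ is $s$-minimal and stable under rearrangements (for the $s$-perimeter) in $B_{8R}(x_0)$. Then $$\mathrm{Per}(E;B_R(x_0))\le C(N,\bar s)\,R^{N-1},$$ where $\mathrm{Per}(E;U)$ denotes the classical perimeter of the Caccioppoli set $E$ in $U\subseteq\mathbb{R}^N$.
   Context: For measurable $E\subseteq\mathbb{R}^N$ and open $U$, $$\mathrm{Per}_s(E;U)=\iint_{(E\cap U)\times E^c}\frac{dx\,dy}{|x-y|^{N+s}}+\iint_{(E\setminus U)\times(E^c\cap U)}\frac{dx\,dy}{|x-y|^{N+s}}.$$ $E$ is $s$-minimal in an open set $U$ if $H_s[E](x)=\frac12\,\mathrm{PV}\int_{\mathbb{R}^N}\frac{\mathbf 1_{E^c}(y)-\mathbf 1_E(y)}{|x-y|^{N+s}}\,dy=0$ at every point $x$ of the regular part of $\partial E$ in $U$ (the points near which $\partial E$ is a smooth hypersurface). A set $E$ with $\mathrm{Per}_s(E;U)<\infty$ is stable under rearrangements in $U$ if for any vector field $X=X(x,t)\in C_c^2(U\times(-1,1);\mathbb{R}^N)$ and any $\varepsilon>0$ there is $t_\varepsilon>0$ such that, with $\Phi_t$ the integral flow of $X$, $$\min\{\mathrm{Per}_s(\Phi_t(E)\cup E;U),\ \mathrm{Per}_s(\Phi_t(E)\cap E;U)\}\ge\mathrm{Per}_s(E;U)-\varepsilon t^2\quad\text{for all }t\in(-t_\varepsilon,t_\varepsilon).$$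 *)

(* Defs.v *)
From HB Require Import structures.
From mathcomp Require Import all_boot all_order all_algebra.
From mathcomp Require Import all_classical all_reals all_analysis.
From mathcomp Require Import ring lra.
Set Implicit Arguments.
Unset Strict Implicit.
Unset Printing Implicit Defensive.
Import Order.TTheory GRing.Theory Num.Theory.
Import numFieldNormedType.Exports.
Local Open Scope classical_set_scope.
Local Open Scope ring_scope.

(* 'rV[R]_N carries the sup norm in the library; its topology is the usual
   one, but lengths and balls have to be taken with respect to [enorm]. *)
Definition enorm (R : realType) (N : nat) (x : 'rV[R]_N) : R :=
  Num.sqrt (\sum_(i < N) x ord0 i ^+ 2).

Definition eball (R : realType) (N : nat) (x : 'rV[R]_N) (r : R) :
  set 'rV[R]_N := [set y | enorm (y - x) < r].

Definition box (R : realType) (N : nat) (a b : 'rV[R]_N) : set 'rV[R]_N :=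
  [set x | forall i, a ord0 i <= x ord0 i < b ord0 i].

Definition box_vol (R : realType) (N : nat) (a b : 'rV[R]_N) : R :=
  \prod_(i < N) Num.max 0 (b ord0 i - a ord0 i).

(* The index set D is arbitrary, so that finite (even empty) covers are
   allowed. *)
Definition lebesgue_outer (R : realType) (N : nat) (A : set 'rV[R]_N) :
    \bar R :=
  ereal_inf [set v | exists (D : set nat) (a b : nat -> 'rV[R]_N),
    A `<=` \bigcup_(k in D) box (a k) (b k) /\
    v = (\esum_(k in D) (box_vol (a k) (b k))%:E)%E].

Lemma box_vol_ge0 (R : realType) (N : nat) (a b : 'rV[R]_N) :
  0 <= box_vol a b.
Proof. by apply: prodr_ge0 => i _; rewrite le_max lexx. Qed.

Lemma lebesgue_outer_ge0 (R : realType) (N : nat) (A : set 'rV[R]_N) :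
  (0 <= lebesgue_outer A)%E.
Proof.
apply: le_ereal_inf_tmp => v [D [a [b [_ ->]]]].
by apply: esum_ge0 => k _; rewrite lee_fin box_vol_ge0.
Qed.

Lemma lebesgue_outer0 (R : realType) (N : nat) :
  lebesgue_outer (set0 : set 'rV[R]_N) = 0%E.
Proof.
apply/eqP; rewrite eq_le lebesgue_outer_ge0 andbT.
apply: ereal_inf_lbound; exists set0, (fun=> 0), (fun=> 0); split => //.
by rewrite esum_set0.
Qed.

Lemma le_lebesgue_outer (R : realType) (N : nat) :
  {homo @lebesgue_outer R N : A B / A `<=` B >-> (A <= B)%E}.
Proof.
move=> A B AB; apply/ereal_inf_le_tmp => v [D [a [b [BD ->]]]].
by exists D, a, b; split => //; apply: subset_trans AB BD.
Qed.

Lemma lebesgue_outer_sigma_subadditive (R : realType) (N : nat) :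
  sigma_subadditive (@lebesgue_outer R N).
Proof.
move=> A; have [[i ioo]|] := pselect (exists i, lebesgue_outer (A i) = +oo%E).
  rewrite (eseries_pinfty _ _ ioo) ?leey// => n _.
  by rewrite -ltNye (lt_le_trans _ (lebesgue_outer_ge0 _)).
rewrite -forallNE => Aoo; apply/lee_addgt0Pr => e e0.
rewrite (le_trans _ (epsilon_trick _ _ (ltW e0)))//; last first.
  by move=> n; exact: lebesgue_outer_ge0.
pose P n (c : set nat * (nat -> 'rV[R]_N) * (nat -> 'rV[R]_N)) :=
  A n `<=` \bigcup_(k in c.1.1) box (c.1.2 k) (c.2 k) /\
  (\esum_(k in c.1.1) (box_vol (c.1.2 k) (c.2 k))%:E <=
   lebesgue_outer (A n) + (e / (2 ^ n.+1)%:R)%:E)%E.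
have /choice[c Pc] : forall n, exists c, P n c.
  move=> n; have fin : lebesgue_outer (A n) \is a fin_num.
    by rewrite ge0_fin_numE ?lebesgue_outer_ge0// ltey; apply/eqP/Aoo.
  have en : 0 < e / (2 ^ n.+1)%:R.
    by rewrite divr_gt0// ltr0n expn_gt0.
  have [v [D [a [b [AD ->]]]] lev] := lb_ereal_inf_adherent en fin.
  by exists (D, a, b); split => //; apply/ltW/lev.
have /card_esym/ppcard_eqP[f] := card_nat2.
pose D := [set m | (c (f m).1).1.1 (f m).2].
pose a m := (c (f m).1).1.2 (f m).2.
pose b m := (c (f m).1).2 (f m).2.
apply: (@le_trans _ _ (\esum_(m in D) (box_vol (a m) (b m))%:E)%E).
  apply: ereal_inf_lbound; exists D, a, b; split => //.
  move=> x [n _ /(Pc n).1 [k Dk xk]].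
  by exists (f^-1%FUN (n, k)); rewrite /D /a /b/= invK ?inE.
have <- : (\esum_(k in setT `*`` (fun n => (c n).1.1))
    (box_vol ((c k.1).1.2 k.2) ((c k.1).2 k.2))%:E =
  \esum_(m in D) (box_vol (a m) (b m))%:E)%E.
  apply: (@reindex_esum _ _ _ D _ f).
    split.
    - by move=> m /= Dm; split.
    - by move=> m m' _ _; apply: inj; rewrite inE.
    - move=> [n k] [_ /= nk]; exists (f^-1%FUN (n, k)).
        by rewrite /D/= invK ?inE.
      by rewrite invK ?inE.
rewrite -(@esum_esum _ _ _ _ _
  (fun n k => (box_vol ((c n).1.2 k) ((c n).2 k))%:E)); last first.
  by move=> n k; rewrite lee_fin box_vol_ge0.
rewrite -nneseries_esumT; last first.
  by move=> n; apply: esum_ge0 => *; rewrite lee_fin box_vol_ge0.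
apply: lee_nneseries => [n _ _|n _]; last exact: (Pc n).2.
by apply: esum_ge0 => *; rewrite lee_fin box_vol_ge0.
Qed.

HB.instance Definition _ (R : realType) (N : nat) :=
  isOuterMeasure.Build R 'rV[R]_N (@lebesgue_outer R N)
    (@lebesgue_outer0 R N) (@lebesgue_outer_ge0 R N) (@le_lebesgue_outer R N)
    (@lebesgue_outer_sigma_subadditive R N).

Lemma max_split (R : realType) (p q c : R) :
  Num.max 0 (q - p) = Num.max 0 (Num.min q c - p) + Num.max 0 (q - Num.max p c).
Proof.
rewrite (maxElt 0 (q - p)) (maxElt p) (minElt q) (maxElt 0 (_ - p)).
rewrite (maxElt 0 (q - _)).
case: (ltP p c) => pc; case: (ltP q c) => qc; case: (ltP 0 (q - p)) => ?;
  repeat case: ltP => ?; lra.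
Qed.

Lemma caratheodory_halfspace (R : realType) (N : nat) (i : 'I_N) (c : R) :
  (@lebesgue_outer R N).-caratheodory [set x | x ord0 i < c].
Proof.
move=> X; apply/eqP; rewrite eq_le; apply/andP; split.
  have := outer_measureU2 (@lebesgue_outer R N) (X `&` [set x | x ord0 i < c])
    (X `&` ~` [set x | x ord0 i < c]).
  by rewrite -setIUr setUv setIT.
apply: le_ereal_inf_tmp => v [D [a [b [XD ->]]]].
pose b' k : 'rV[R]_N :=
  \row_j (if j == i then Num.min (b k ord0 j) c else b k ord0 j).
pose a' k : 'rV[R]_N :=
  \row_j (if j == i then Num.max (a k ord0 j) c else a k ord0 j).
have volE k : box_vol (a k) (b k) = box_vol (a k) (b' k) + box_vol (a' k) (b k).
  pose P := \prod_(j < N | j != i) Num.max 0 (b k ord0 j - a k ord0 j).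
  have Pb' : \prod_(j < N | j != i) Num.max 0 (b' k ord0 j - a k ord0 j) = P.
    by apply: eq_bigr => j /negbTE ji; rewrite mxE ji.
  have Pa' : \prod_(j < N | j != i) Num.max 0 (b k ord0 j - a' k ord0 j) = P.
    by apply: eq_bigr => j /negbTE ji; rewrite mxE ji.
  have vol1 (p q : 'rV[R]_N) : box_vol p q = Num.max 0 (q ord0 i - p ord0 i) *
      \prod_(j < N | j != i) Num.max 0 (q ord0 j - p ord0 j).
    by rewrite /box_vol (bigD1 i).
  rewrite !vol1 Pb' Pa' -/P !mxE eqxx.
  rewrite -mulrDl; congr (_ * _).
  exact: max_split.
have -> : (\esum_(k in D) (box_vol (a k) (b k))%:E =
    \esum_(k in D) (box_vol (a k) (b' k))%:E +
    \esum_(k in D) (box_vol (a' k) (b k))%:E)%E.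
  rewrite -esumD; try by move=> *; rewrite lee_fin box_vol_ge0.
  by apply: eq_esum => k _; rewrite volE EFinD.
apply: leeD; apply: ereal_inf_lbound.
- exists D, a, b'; split => // x [/XD [k Dk kx] /= xc]; exists k => // j.
  have /andP[-> /=] := kx j; rewrite mxE; case: eqP => [->|//].
  by rewrite lt_min xc => ->.
- exists D, a', b; split => // x [/XD [k Dk kx] /= /negP]; rewrite -leNgt => xc.
  exists k => // j.
  have /andP[+ ->] := kx j; rewrite mxE andbT; case: eqP => [->|//].
  by rewrite ge_max xc => ->.
Qed.

(* 'rV[R]_N with the sigma-algebra of its Lebesgue measurable sets. *)
Definition lebesgue_space (R : realType) (N : nat) :=
  caratheodory_type (@lebesgue_outer R N).

HB.instance Definition _ (R : realType) (N : nat) :=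
  Measurable.on (lebesgue_space R N).

Definition lebesgueN (R : realType) (N : nat) :
  set (lebesgue_space R N) -> \bar R := @lebesgue_outer R N.

HB.instance Definition _ (R : realType) (N : nat) :=
  isMeasure.Build _ _ _ (@lebesgueN R N)
    (@caratheodory_measure0 _ _ (@lebesgue_outer R N))
    (@caratheodory_measure_ge0 _ _ (@lebesgue_outer R N))
    (@caratheodory_measure_sigma_additive _ _ (@lebesgue_outer R N)).

Lemma lebesgueN_sigma_finite (R : realType) (N : nat) :
  sigma_finite setT (@lebesgueN R N).
Proof.
exists (fun n => box (const_mx (- n%:R)) (const_mx n%:R)).
  apply/seteqP; split => // x _.
  pose m := \big[Num.max/0]_(i < N) `|x ord0 i|.
  exists (Num.truncn m).+1 => // i; rewrite !mxE.
  have xm : `|x ord0 i| <= m by exact: le_bigmax.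
  have mt : m < (Num.truncn m).+1%:R by exact: truncnS_gt.
  have := le_lt_trans xm mt; rewrite ltr_norml => /andP[/ltW -> ->] //.
move=> n; split.
  pose H (c : R) (i : 'I_N) : set (lebesgue_space R N) := [set x | x ord0 i < c].
  have -> : box (const_mx (- n%:R)) (const_mx n%:R) =
      \bigcap_(i in [set: 'I_N]) (H n%:R i `&` ~` H (- n%:R) i).
    apply/seteqP; split => x bx i.
      move=> _; have := bx i; rewrite /H !mxE => /andP[h1 h2]; split => //=.
      by apply/negP; rewrite -leNgt.
    have [//|/= h1 /negP] := bx i; rewrite -leNgt => h2.
    by rewrite !mxE h2.
  apply: fin_bigcap_measurable => // i _; apply: measurableI.
    exact: caratheodory_halfspace.
  by apply: measurableC; exact: caratheodory_halfspace.
apply: (@le_lt_trans _ _ (box_vol (const_mx (- n%:R)) (const_mx n%:R) : R)%:E);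
  last by rewrite ltry.
apply: ereal_inf_lbound.
exists [set 0%N], (fun=> const_mx (- n%:R)), (fun=> const_mx n%:R); split.
  by move=> x bx; exists 0%N.
by rewrite esum_set1// lee_fin box_vol_ge0.
Qed.

HB.instance Definition _ (R : realType) (N : nat) :=
  @isSigmaFinite.Build _ _ _ (@lebesgueN R N) (@lebesgueN_sigma_finite R N).

Definition frac_kernel (R : realType) (N : nat) (s : R) (x y : 'rV[R]_N) : R :=
  (enorm (x - y) `^ (N%:R + s))^-1.

Definition Per_s (R : realType) (N : nat) (s : R) (E U : set 'rV[R]_N) :
    \bar R :=
  (\int[@lebesgueN R N \x @lebesgueN R N]_(z in (E `&` U) `*` ~` E)
     (frac_kernel s z.1 z.2)%:E +
   \int[@lebesgueN R N \x @lebesgueN R N]_(z in (E `\` U) `*` (~` E `&` U))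
     (frac_kernel s z.1 z.2)%:E)%E.

(* H_s[E](x) with the ball of radius e around x removed. *)
Definition frac_mean_curv_trunc (R : realType) (N : nat) (s : R)
    (E : set 'rV[R]_N) (x : 'rV[R]_N) (e : R) : \bar R :=
  ((2^-1)%:E * \int[@lebesgueN R N]_(y in ~` eball x e)
     ((\1_(~` E) y - \1_E y) * frac_kernel s x y)%:E)%E.

(* H_s[E](x) exists as a principal value and equals h. *)
Definition is_frac_mean_curv (R : realType) (N : nat) (s : R)
    (E : set 'rV[R]_N) (x : 'rV[R]_N) (h : R) : Prop :=
  frac_mean_curv_trunc s E x e @[e --> 0^'+] --> h%:E.

(* C^k on the open set O. On finite-dimensional spaces, continuity of the
   iterated directional derivatives is the usual notion. *)
Fixpoint Ck_on (R : realType) (V W : normedModType R) (k : nat) (O : set V)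
    (f : V -> W) : Prop :=
  match k with
  | 0 => forall x, O x -> {for x, continuous f}
  | k'.+1 => (forall x, O x -> differentiable f x) /\
             (forall v, Ck_on k' O (fun x => 'D_v f x))
  end.

Definition smooth_on (R : realType) (V W : normedModType R) (O : set V)
    (f : V -> W) : Prop := forall k, Ck_on k O f.

Definition boundary (T : topologicalType) (E : set T) : set T :=
  closure E `\` interior E.

(* Near x, the boundary of E is the zero set of a smooth function with
   nonvanishing gradient. *)
Definition regular_boundary (R : realType) (N : nat) (E : set 'rV[R]_N) :
  set 'rV[R]_N :=
  [set x | boundary E x /\
    exists (V : set 'rV[R]_N) (f : 'rV[R]_N -> R),
      [/\ open_nbhs x V, smooth_on V f,
          (forall y, V y -> exists v, 'D_v f y != 0) &
          boundary E `&` V = [set y | V y /\ f y = 0]]].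

Definition s_minimal (R : realType) (N : nat) (s : R)
    (E U : set 'rV[R]_N) : Prop :=
  forall x, U x -> regular_boundary E x -> is_frac_mean_curv s E x 0.

Definition fsupport (V : topologicalType) (W : zmodType) (f : V -> W) :
  set V := closure [set x | f x != 0].

(* The fields X in C_c^2(U x (-1,1); R^N), extended by zero. *)
Definition admissible_field (R : realType) (N : nat) (U : set 'rV[R]_N)
    (X : 'rV[R]_N * R -> 'rV[R]_N) : Prop :=
  [/\ Ck_on 2 setT X, compact (fsupport X) &
      fsupport X `<=` U `*` `]-1, 1[%classic].

Definition is_flow (R : realType) (N : nat) (X : 'rV[R]_N * R -> 'rV[R]_N)
    (Phi : R -> 'rV[R]_N -> 'rV[R]_N) : Prop :=
  forall x, Phi 0 x = x /\
    forall t : R, is_derive t (1 : R) (fun u : R => Phi u x) (X (Phi t x, t)).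

Definition stable_rearrangement (R : realType) (N : nat) (s : R)
    (E U : set 'rV[R]_N) : Prop :=
  (Per_s s E U < +oo)%E /\
  forall X Phi, admissible_field U X -> is_flow X Phi ->
  forall eps : R, 0 < eps ->
  exists t_eps : R, 0 < t_eps /\
    forall t : R, - t_eps < t < t_eps ->
      (Per_s s E U - (eps * t ^+ 2)%:E <=
       Order.min (Per_s s ((Phi t @` E) `|` E) U)
                 (Per_s s ((Phi t @` E) `&` E) U))%E.

Definition divergence (R : realType) (N : nat) (T : 'rV[R]_N -> 'rV[R]_N)
    (x : 'rV[R]_N) : R :=
  \sum_(i < N) ('D_(delta_mx ord0 i) T x) ord0 i.

(* Classical perimeter: the total variation of the indicator of E in U. *)
Definition Per (R : realType) (N : nat) (E U : set 'rV[R]_N) : \bar R :=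
  ereal_sup [set v | exists T : 'rV[R]_N -> 'rV[R]_N,
    [/\ Ck_on 1 setT T, compact (fsupport T), fsupport T `<=` U,
        (forall x, enorm (T x) <= 1) &
        v = (\int[@lebesgueN R N]_(x in E) (divergence T x)%:E)%E]].

(* Main.v *)
(* Let E_t be the image of E under a flow that rotates a ball rigidly by the angle t and
   cuts the rotation off outside.  Submodularity and stability at times t and -t give
   Per_s(E_t) + Per_s(E_-t) - 2 Per_s(E) >= I_t - 4 eps t^2, where I_t is the kernel
   integrated over (E \ E_t) x (E_t \ E); the left side is O(t^2 J) with J the kernel
   integrated over the pairs of E x E^c meeting the ball.  Since I_t dominates a multiple
   of |E \ E_t| |E_t \ E| and the flow preserves volume, |E \Delta E_t| = O(t sqrt J) in
   the ball.  A translation by 2 c sin t is a product of three rotations about two points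
   at distance c, so the total variation K of the indicator of E in a cube of side c is
   controlled by sqrt J.  Splitting J into dyadic shells (s < sbar < 1) bounds it by
   c^(N-s) + c^(1-s) K', with K' the variation in a larger cube; hence
   K <= d K' + C_d c^(N-1) for every d > 0.  Covering cubes by many smaller ones and taking
   d small, this improves any bound P on the variation in all interior cubes of size at
   most r to P / 2 + C r^(N-1); iterate from the bound in terms of Per_s. *)
From HB Require Import structures.
Require Import Defs.
From mathcomp Require Import all_boot all_order all_algebra.
From mathcomp Require Import all_classical all_reals all_analysis.
From mathcomp Require Import measurable_realfun ring lra.
Set Implicit Arguments.
Unset Strict Implicit.
Unset Printing Implicit Defensive.
Import Order.TTheory GRing.Theory Num.Theory.
Import numFieldNormedType.Exports.
Local Open Scope classical_set_scope.
Local Open Scope ring_scope.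

(** * Volume-preserving maps *)

(** Rotations are used because cutting off the angle by a function of [|x|] alone keeps the flow
    explicit and exactly volume preserving; a cut-off translation offers neither. Equal volumes make
    the two halves of the symmetric difference equally large in the ball, so that a bound on the
    product of their measures bounds each of them. The constant must survive s -> 0, although the
    tail of the kernel has mass of order 1/s. The second variation is therefore kept with its weight
    min(1, rho/|x-y|): beyond distance rho the rotation changes |x-y| by a relative amount of order
    t rho/|x-y| only, and this extra decay sums the far shells without help from s. The powers of
    rho with exponent s cancel up to 2^s, which leaves K of order sqrt(a (a + K')) with a = c^(N-1);
    the inequality of the means then makes the coefficient of K' as small as desired. It has to beat
    the number n^N of small cubes, where n depends on N only. The starting bound depends on E and s,
    but only its finiteness matters, since it is halved away. *)

Lemma lebesgue_outer_box (R : realType) (N : nat) (a b : 'rV[R]_N) :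
  (lebesgue_outer (box a b) <= (box_vol a b)%:E)%E.
Proof.
apply: ereal_inf_lbound; exists [set 0%N], (fun=> a), (fun=> b); split.
  by move=> x bx; exists 0%N.
by rewrite esum_set1// lee_fin box_vol_ge0.
Qed.

Lemma lebesgue_outer_esum (R : realType) (N : nat) (D : set nat)
    (F : nat -> set 'rV[R]_N) :
  (lebesgue_outer (\bigcup_(k in D) F k) <=
   \esum_(k in D) lebesgue_outer (F k))%E.
Proof.
pose G k := if k \in D then F k else set0.
have -> : \bigcup_(k in D) F k = \bigcup_k G k.
  apply/seteqP; split => x [k]; first by move=> Dk Fx; exists k; rewrite // /G mem_set.
  by rewrite /G; case: ifPn => // /set_mem Dk _ Fx; exists k.
apply: le_trans (lebesgue_outer_sigma_subadditive G) _.
rewrite nneseries_esumT; last by move=> *; exact: lebesgue_outer_ge0.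
rewrite [leRHS]esum_mkcond; apply: le_esum => k _; rewrite /G.
by case: ifP => // _; rewrite lebesgue_outer0.
Qed.

Lemma lebesgue_outer_preimage_le (R : realType) (N : nat)
    (f : 'rV[R]_N -> 'rV[R]_N) :
  (forall a b, lebesgue_outer (f @^-1` box a b) <= (box_vol a b)%:E)%E ->
  forall A, (lebesgue_outer (f @^-1` A) <= lebesgue_outer A)%E.
Proof.
move=> fbox A; apply: le_ereal_inf_tmp => v [D [a [b [AD ->]]]].
apply: (@le_trans _ _ (lebesgue_outer
    (\bigcup_(k in D) f @^-1` box (a k) (b k)))).
  by apply: le_lebesgue_outer => x /AD[k Dk xk]; exists k.
by apply: le_trans (lebesgue_outer_esum _ _) _; apply: le_esum.
Qed.

(** Asked of all sets, measurable or not: for a bijection the Caratheodory condition is then carried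
    over too, so this single property gives both measurability and conservation of measure. *)
Definition outer_invariant (R : realType) (N : nat)
    (f : 'rV[R]_N -> 'rV[R]_N) :=
  forall A, lebesgue_outer (f @^-1` A) = lebesgue_outer A.

Section outer_invariant.
Context {R : realType} {N : nat}.
Local Notation V := 'rV[R]_N.
Implicit Types f g : V -> V.

Lemma outer_invariant_cancel f g : cancel f g -> cancel g f ->
  (forall A, lebesgue_outer (f @^-1` A) <= lebesgue_outer A)%E ->
  (forall A, lebesgue_outer (g @^-1` A) <= lebesgue_outer A)%E ->
  outer_invariant f.
Proof.
move=> fK gK lf lg A; apply/eqP; rewrite eq_le lf/=.
have e : g @^-1` (f @^-1` A) = A by apply/seteqP; split => x /=; rewrite gK.
by rewrite -[X in (lebesgue_outer X <= _)%E]e; exact: lg.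
Qed.


Lemma outer_invariant_comp f g :
  outer_invariant f -> outer_invariant g -> outer_invariant (f \o g).
Proof. by move=> hf hg A; rewrite comp_preimage hg hf. Qed.

Lemma outer_invariant_translation (v : V) : outer_invariant (fun x => x + v).
Proof.
have h (w : V) (A : set V) :
    (lebesgue_outer ((fun x => x + w)%R @^-1` A) <= lebesgue_outer A)%E.
  apply: lebesgue_outer_preimage_le => a b.
  have -> : (fun x => x + w) @^-1` box a b = box (a - w) (b - w).
    apply/seteqP; split => x /= h i; have := h i;
    by rewrite !mxE lerBlDr ltrBrDr.
  apply: le_trans (lebesgue_outer_box _ _) _; rewrite lee_fin /box_vol.
  rewrite le_eqVlt; apply/orP; left; apply/eqP; apply: eq_bigr => i _; rewrite !mxE; congr Num.max; ring.
apply: (@outer_invariant_cancel _ (fun x => x - v)) => //.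
- by move=> x; rewrite addrK.
- by move=> x; rewrite subrK.
Qed.

Local Notation mu := (@lebesgue_outer R N).

Lemma cara_preimage f g A : cancel f g -> cancel g f -> outer_invariant f ->
  mu.-cara.-measurable A -> mu.-cara.-measurable (f @^-1` A).
Proof.
move=> fK gK hf mA; change (mu.-caratheodory (f @^-1` A)) => X.
have {}mA : mu.-caratheodory A := mA.
have -> : X = f @^-1` (g @^-1` X) by apply/seteqP; split => x /=; rewrite fK.
by rewrite hf (mA (g @^-1` X)) -[in LHS]hf -[X in (_ + X)%E = _]hf.
Qed.

Lemma measurable_outer_invariant f g : cancel f g -> cancel g f ->
  outer_invariant f ->
  @measurable_fun _ _ (lebesgue_space R N) (lebesgue_space R N) setT f.
Proof.
by move=> fK gK hf _ A mA; rewrite setTI; exact: (cara_preimage fK gK hf mA).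
Qed.

End outer_invariant.

Lemma lebesgue_outer_fin_cover (R : realType) (N : nat) (I : finType)
    (A : set 'rV[R]_N) (F : I -> set 'rV[R]_N) :
  (forall x, A x -> exists i, F i x) ->
  (lebesgue_outer A <= \sum_i lebesgue_outer (F i))%E.
Proof.
move=> AF; apply: (@le_trans _ _ (lebesgue_outer (\big[setU/set0]_i F i))).
  apply: le_lebesgue_outer => x /AF[i Fix].
  by rewrite (bigD1 i)//=; left.
apply: (@big_rec2 _ _ (fun X y => lebesgue_outer X <= y)%E).
  by rewrite lebesgue_outer0.
move=> i y X _ h; apply: le_trans (outer_measureU2 (@lebesgue_outer R N) _ _) _.
exact: leeD2l.
Qed.

Lemma box_vol2 (R : realType) (N : nat) (i j : 'I_N) (a b : 'rV[R]_N) :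
  j != i ->
  box_vol a b = Num.max 0 (b ord0 i - a ord0 i) *
    (Num.max 0 (b ord0 j - a ord0 j) *
     \prod_(k < N | (k != i) && (k != j)) Num.max 0 (b ord0 k - a ord0 k)).
Proof. by move=> ji; rewrite /box_vol (bigD1 i)//= (bigD1 j). Qed.

Definition shear (R : realType) (N : nat) (i j : 'I_N) (c : R) (x : 'rV[R]_N) :
  'rV[R]_N := \row_k (if k == i then x ord0 i + c * x ord0 j else x ord0 k).

Lemma shearK (R : realType) (N : nat) (i j : 'I_N) (c : R) :
  j != i -> cancel (shear i j c) (shear i j (- c)).
Proof.
move=> ji x; apply/rowP => k; rewrite !mxE eqxx (negbTE ji).
by case: eqP => [->|//]; ring.
Qed.

Lemma slab_index (R : realType) (n : nat) (a b y : R) : a <= y < b ->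
  exists k : 'I_n.+1, a + (b - a) / n.+1%:R * k%:R <= y
    < a + (b - a) / n.+1%:R * k%:R + (b - a) / n.+1%:R.
Proof.
move=> /andP[ay yb]; have n0 : (0 : R) < n.+1%:R by rewrite ltr0n.
have h0 : 0 < (b - a) / n.+1%:R by rewrite divr_gt0// subr_gt0 (le_lt_trans ay).
set h := (b - a) / _ in h0 *.
have bE : b - a = h * n.+1%:R by rewrite /h divfK// gt_eqF.
have z0 : 0 <= (y - a) / h by rewrite divr_ge0 ?subr_ge0// ltW.
have zE : y = a + h * ((y - a) / h) by rewrite mulrC divfK ?gt_eqF//; ring.
have /andP[k1 k2] := truncn_itv z0.
have kn : (Num.truncn ((y - a) / h) < n.+1)%N.
  rewrite -(ltr_nat R); apply: le_lt_trans k1 _.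
  by rewrite ltr_pdivrMr// mulrC -bE ltrD2r.
exists (Ordinal kn) => /=; set z := (y - a) / h in k1 k2 zE *; rewrite zE.
rewrite lerD2l ler_pM2l// k1/= -addrA ltrD2l.
rewrite -[X in _ + X]mulr1 -mulrDr ltr_pM2l//.
by rewrite natr1.
Qed.

(* On a slab that is thin in direction [j] the shear is close to a translation. *)
Lemma lebesgue_outer_shear_box (R : realType) (N : nat) (i j : 'I_N) (c : R)
    (a b : 'rV[R]_N) : j != i ->
  (lebesgue_outer (shear i j c @^-1` box a b) <= (box_vol a b)%:E)%E.
Proof.
move=> ji; set A := shear i j c @^-1` box a b.
have [[k ak]|] := pselect (exists k, b ord0 k <= a ord0 k).
  suff -> : A = set0 by rewrite lebesgue_outer0 lee_fin box_vol_ge0.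
  rewrite -subset0 => x /(_ k) /andP[h1 h2].
  by have := lt_le_trans (le_lt_trans h1 h2) ak; rewrite ltxx.
rewrite -forallNE => abN.
have ab k : a ord0 k < b ord0 k by rewrite ltNge; apply/negP/abN.
have mx k : Num.max 0 (b ord0 k - a ord0 k) = b ord0 k - a ord0 k.
  by apply/max_idPr; rewrite subr_ge0 ltW.
pose P := \prod_(k < N | (k != i) && (k != j)) Num.max 0 (b ord0 k - a ord0 k).
have P0 : 0 <= P by apply: prodr_ge0 => k _; rewrite le_max lexx.
pose Li := b ord0 i - a ord0 i; pose Lj := b ord0 j - a ord0 j.
have Li0 : 0 < Li by rewrite subr_gt0.
have Lj0 : 0 < Lj by rewrite subr_gt0.
(* On each of the [n.+1] slabs of thickness [h] the preimage lies in a box shifted by [- c * y k] in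
   direction [i] and widened there by [|c| * h] on both sides; the total excess is of order
   1/(n+1). *)
have main n : (lebesgue_outer A <=
    ((Li + 2 * (`|c| * Lj / n.+1%:R)) * (Lj * P))%:E)%E.
  pose h := Lj / n.+1%:R.
  have h0 : 0 < h by rewrite divr_gt0// ltr0n.
  pose y (k : 'I_n.+1) := a ord0 j + h * k%:R.
  pose a' k : 'rV[R]_N := \row_l (if l == i then a ord0 i - c * y k - `|c| * h
    else if l == j then y k else a ord0 l).
  pose b' k : 'rV[R]_N := \row_l (if l == i then b ord0 i - c * y k + `|c| * h
    else if l == j then y k + h else b ord0 l).
  have vol k : box_vol (a' k) (b' k) = (Li + 2 * (`|c| * h)) * (h * P).
    rewrite (box_vol2 _ _ ji) !mxE !eqxx (negbTE ji); congr (_ * (_ * _)).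
    - rewrite /Li; set d := `|c| * h.
      have d0 : 0 <= d by rewrite mulr_ge0// ltW.
      have -> : b ord0 i - c * y k + d - (a ord0 i - c * y k - d) =
        b ord0 i - a ord0 i + 2 * d by ring.
      by apply/max_idPr; have := ab i; lra.
    - have -> : y k + h - y k = h by ring.
      by apply/max_idPr/ltW.
    - by apply: eq_bigr => l /andP[/negbTE li /negbTE lj]; rewrite !mxE li lj.
  apply: (@le_trans _ _ (\sum_(k < n.+1) lebesgue_outer (box (a' k) (b' k)))%E).
    apply: lebesgue_outer_fin_cover => x Ax.
    have := Ax j; rewrite mxE (negbTE ji) => /(slab_index n)[k].
    rewrite -/Lj -/h -/(y k) => /andP[yk1 yk2]; exists k => l; rewrite !mxE.
    case: eqP => [->|/eqP li].
      have := Ax i; rewrite mxE eqxx.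
      move=> xi; have : `|c * (x ord0 j - y k)| <= `|c| * h.
        rewrite normrM ler_wpM2l// ger0_norm ?subr_ge0//; lra.
      by rewrite ler_norml mulrBr => ?; lra.
    case: eqP => [->|_]; first by rewrite yk1.
    by have := Ax l; rewrite mxE (negbTE li).
  apply: (@le_trans _ _ (\sum_(k < n.+1) (box_vol (a' k) (b' k))%:E)%E).
    by apply: lee_sum => k _; exact: lebesgue_outer_box.
  rewrite sumEFin lee_fin (eq_bigr _ (fun k _ => vol k)) sumr_const card_ord.
  rewrite le_eqVlt; apply/orP; left; apply/eqP.
  rewrite -mulr_natl /h.
  field.
  by rewrite nat1r pnatr_eq0.
apply/lee_addgt0Pr => e e0; rewrite (box_vol2 _ _ ji) -EFinD !mx -/P -/Li -/Lj.
pose M := 2 * (`|c| * Lj) * (Lj * P) / e.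
have M0 : 0 <= M by rewrite divr_ge0 ?mulr_ge0// ltW.
have /andP[_ nM] := truncn_itv M0.
apply: le_trans (main (Num.truncn M)) _; rewrite lee_fin mulrDl lerD2l.
have n0 : (0 : R) < (Num.truncn M).+1%:R by rewrite ltr0n.
rewrite [leLHS](_ : _ = M * e / (Num.truncn M).+1%:R); last first.
  have -> : M * e = 2 * (`|c| * Lj) * (Lj * P) by rewrite /M divfK ?gt_eqF.
  by field; rewrite nat1r pnatr_eq0.
by rewrite ler_pdivrMr// mulrC ler_pM2l// ltW.
Qed.

Lemma outer_invariant_shear (R : realType) (N : nat) (i j : 'I_N) (c : R) :
  j != i -> outer_invariant (@shear R N i j c).
Proof.
move=> ji; apply: (outer_invariant_cancel (shearK c ji)).
- by have := @shearK R N i j (- c) ji; rewrite opprK.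
- by apply: lebesgue_outer_preimage_le => a b; exact: lebesgue_outer_shear_box.
- by apply: lebesgue_outer_preimage_le => a b; exact: lebesgue_outer_shear_box.
Qed.

(** * Measurable sets described by coordinates *)

Section measurability.
Context {R : realType} {N : nat}.
Local Notation V := 'rV[R]_N.
Local Notation L := (lebesgue_space R N).

Lemma measurable_coord (i : 'I_N) :
  measurable_fun setT (fun x : L => (x : V) ord0 i).
Proof.
apply: (measurability _ (RGenInftyO.measurableE R)) => _ [_ [c ->] <-].
rewrite setTI; have -> : (fun x : L => (x : V) ord0 i) @^-1` `]-oo, c[%classic =
  [set x | (x : V) ord0 i < c] by apply/seteqP; split => x /=; rewrite in_itv.
exact: caratheodory_halfspace.
Qed.

Lemma lebesgue_outer_bigcup (F : nat -> set V) :
  (forall k, measurable (F k : set L)) -> trivIset setT F ->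
  lebesgue_outer (\bigcup_k F k) = (\sum_(k <oo) lebesgue_outer (F k))%E.
Proof.
move=> mF tF; have := @measure_bigcup _ _ _ (@lebesgueN R N) setT F (fun k _ => mF k) tF.
move=> h; apply: (eq_trans h); apply: eq_eseriesl => k; rewrite in_setT.
by [].
Qed.

(** Open, so that a sequence converging to one of its points is eventually inside; the limit of
    quantized twists relies on this. *)
Definition obox (a b : V) : set V :=
  [set x | forall i, a ord0 i < x ord0 i < b ord0 i].

Lemma measurable_coord_sets (P : 'I_N -> set R) :
  (forall i, measurable (P i)) ->
  measurable ([set x : V | forall i, P i (x ord0 i)] : set L).
Proof.
move=> mP.
have -> : [set x : V | forall i, P i (x ord0 i)] =
  \bigcap_(i in [set: 'I_N]) ((fun x : L => (x : V) ord0 i) @^-1` P i).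
  by apply/seteqP; split => [x h i _|x h i]; exact: h.
apply: fin_bigcap_measurable => // i _; rewrite -[X in measurable X]setTI.
by apply: measurable_coord.
Qed.

Lemma measurable_obox (a b : V) : measurable (obox a b : set L).
Proof.
have -> : obox a b = [set x : V | forall i, `]a ord0 i, b ord0 i[%classic (x ord0 i)].
  by apply/seteqP; split => x /= h i; have := h i; rewrite in_itv.
by apply: (@measurable_coord_sets (fun i => `]a ord0 i, b ord0 i[%classic)) => i; exact: measurable_itv.
Qed.

Lemma measurable_box (a b : V) : measurable (box a b : set L).
Proof.
have -> : box a b = [set x : V | forall i, `[a ord0 i, b ord0 i[%classic (x ord0 i)].
  by apply/seteqP; split => x /= h i; have := h i; rewrite in_itv.
by apply: (@measurable_coord_sets (fun i => `[a ord0 i, b ord0 i[%classic)) => i; exact: measurable_itv.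
Qed.

(** Lowering the lower corner slightly puts a half-open box inside an open one at little cost, by
    continuity of the volume in the corner. *)
Lemma box_vol_widen (a b : V) (e : R) : 0 < e ->
  exists2 d : R, 0 < d & box_vol (\row_i (a ord0 i - d)) b <= box_vol a b + e.
Proof.
move=> e0.
pose F (i : 'I_N) (d : R) := Num.max 0 (b ord0 i - (a ord0 i - d)).
have cF i : F i d @[d --> (0 : R)] --> F i 0.
  apply: (@continuous_max R R (cst 0) (fun d => b ord0 i - (a ord0 i - d))).
    exact: cvg_cst.
  by apply: cvgB; [exact: cvg_cst|apply: cvgB; [exact: cvg_cst|exact: cvg_id]].
have : \prod_(i < N) F i d @[d --> (0 : R)] --> \prod_(i < N) F i 0.
  apply: cvg_big => [|i _]; last exact: cF.
  exact: mul_continuous.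
move=> /cvgrPdist_lt/(_ e e0)/nbhs_ballP[d /= d0 hd].
exists (d / 2); first by rewrite divr_gt0.
have : ball (0 : R) d (d / 2).
  by rewrite /ball/= sub0r normrN gtr0_norm ?divr_gt0// ltr_pdivrMr// ltr_pMr// ltr1n.
move=> /hd; rewrite ltr_norml => /andP[+ _].
have -> : \prod_(i < N) F i 0 = box_vol a b.
  by apply: eq_bigr => i _; rewrite /F subr0.
have -> : \prod_(i < N) F i (d / 2) = box_vol (\row_i (a ord0 i - d / 2)) b.
  by apply: eq_bigr => i _; rewrite /F mxE.
lra.
Qed.

End measurability.

(** * Rotations of a coordinate plane *)

Section plane_rot.
Context {R : realType} {N : nat}.
Local Notation V := 'rV[R]_N.
Local Notation mu := (@lebesgue_outer R N).

Definition plane_rot (i j : 'I_N) (t : R) (x : V) : V := \row_k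
  (if k == i then cos t * x ord0 i - sin t * x ord0 j
   else if k == j then sin t * x ord0 i + cos t * x ord0 j
   else x ord0 k).

Context (i j : 'I_N).
Hypothesis ji : j != i.

Lemma plane_rot_add s t (x : V) : plane_rot i j s (plane_rot i j t x) = plane_rot i j (s + t) x.
Proof.
apply/rowP => k; rewrite !mxE !eqxx (negbTE ji) cosD sinD.
case: eqP => [_|_]; first by ring.
by case: eqP => [_|_] //; ring.
Qed.

Lemma plane_rot0 (x : V) : plane_rot i j 0 x = x.
Proof.
apply/rowP => k; rewrite !mxE sin0 cos0.
case: eqP => [->|_]; first by ring.
by case: eqP => [->|_] //; ring.
Qed.

Lemma plane_rotK t : cancel (plane_rot i j t) (plane_rot i j (- t)).
Proof. by move=> x; rewrite plane_rot_add addNr plane_rot0. Qed.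

Lemma plane_rotVK t : cancel (plane_rot i j (- t)) (plane_rot i j t).
Proof. by move=> x; rewrite plane_rot_add subrr plane_rot0. Qed.

(** The classical factorization of a rotation into three shears, with the tangent of half the angle;
    it reduces rotations to maps whose effect on boxes is elementary. *)
Lemma plane_rot_shear u : cos u != 0 ->
  plane_rot i j (u + u) = shear i j (- (sin u / cos u)) \o
    (shear j i (sin (u + u)) \o shear i j (- (sin u / cos u))).
Proof.
move=> c0; apply/funext => x; apply/rowP => k; rewrite !mxE !eqxx cosD sinD.
have ij : (i == j) = false by rewrite eq_sym (negbTE ji).
have := cos2Dsin2 u; set c := cos u in c0 *; set s := sin u => cs.
have s2 : s * s = 1 - c * c by rewrite -!expr2 -cs; ring.
rewrite ij (negbTE ji).
case: eqP => [_|_]; last first.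
  case: eqP => [_|_] //.
  rewrite (_ : c * c = 1 - s * s); last by rewrite s2; ring.
  by field.
rewrite s2; field: s2.
by [].
Qed.

Lemma outer_invariant_plane_rot t : outer_invariant (plane_rot i j t).
Proof.
have ij : i != j by rewrite eq_sym.
have half u : cos u != 0 -> outer_invariant (plane_rot i j (u + u)).
  move=> cu; rewrite (plane_rot_shear cu); apply: outer_invariant_comp.
    exact: outer_invariant_shear.
  by apply: outer_invariant_comp; exact: outer_invariant_shear.
rewrite (splitr t); have [c0|] := eqVneq (cos (t / 2)) 0; last exact: half.
set u := t / 2 in c0 *.
have e : plane_rot i j (u + u) = plane_rot i j u \o plane_rot i j u.
  by apply/funext => x /=; rewrite plane_rot_add.
rewrite e; suff h : outer_invariant (plane_rot i j u) by exact: outer_invariant_comp.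
rewrite (splitr u); apply: half; apply/eqP => h0.
have := cosD (u / 2) (u / 2); rewrite -splitr c0 h0 mul0r sub0r => /esym/eqP.
rewrite oppr_eq0 mulf_eq0 orbb => /eqP s0.
have := cos2Dsin2 (u / 2); rewrite h0 s0 expr0n/= addr0 => /eqP.
by rewrite eq_sym oner_eq0.
Qed.
End plane_rot.

(** * Rotations by a point-dependent angle *)

Section twist.
Context {R : realType} {N : nat} (i j : 'I_N).
Hypothesis ji : j != i.
Local Notation V := 'rV[R]_N.
Local Notation L := (lebesgue_space R N).
Local Notation mu := (@lebesgue_outer R N).

Definition twist (a : V -> R) (x : V) : V := plane_rot i j (a x) x.

Lemma twistK (a : V -> R) : (forall t x, a (plane_rot i j t x) = a x) ->
  cancel (twist a) (twist (fun x => - a x)).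
Proof. by move=> ai x; rewrite /twist ai plane_rot_add// addNr plane_rot0. Qed.

(* A quantized angle cuts the space into countably many rotation-invariant sets, on each
   of which the twist is a rotation. *)
Lemma twist_rational_preimage (a : V -> R) (c h : R) (O : set V) : 0 < h ->
  (forall t x, a (plane_rot i j t x) = a x) -> (forall x, 0 <= a x) ->
  measurable_fun setT (a : L -> R) -> measurable (O : set L) ->
  let P := (fun x => c * ((Num.truncn (a x / h))%:R * h)) in
  measurable (twist P @^-1` O : set L) /\ mu (twist P @^-1` O) = mu O.
Proof.
move=> h0 ai a0 ma mO P.
pose S k : set V := [set x | Num.truncn (a x / h) = k].
have mS k : measurable (S k : set L).
  have -> : S k = a @^-1` `[k%:R * h, k.+1%:R * h[%classic.
    apply/seteqP; split => x /=; rewrite in_itv/= -ler_pdivlMr// -ltr_pdivrMr//.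
      by move=> <-; apply: truncn_itv; rewrite divr_ge0// ltW.
    by move=> kx; apply/truncn_def.
  by rewrite -[X in measurable X]setTI; apply: ma.
have mr k (B : set V) : measurable (B : set L) -> measurable (plane_rot i j k @^-1` B : set L).
  by apply: cara_preimage (plane_rotK ji k) (plane_rotVK ji k) (outer_invariant_plane_rot ji k).
have tS (B : nat -> set V) : trivIset setT (fun k => S k `&` B k).
  by apply/trivIsetP => k l _ _ /eqP kl; rewrite -subset0 => x [[Sk _] [Sl _]]; apply: kl; rewrite -Sk -Sl.
have E : twist P @^-1` O = \bigcup_k (S k `&` (plane_rot i j (c * (k%:R * h)) @^-1` O)).
  apply/seteqP; split => [x Ox|x [k _ [<-]]] //.
  by exists (Num.truncn (a x / h)).
have EO : O = \bigcup_k (S k `&` O).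
  apply/seteqP; split => [x Ox|x [k _ [_]]] //.
  by exists (Num.truncn (a x / h)).
have m1 k : measurable (S k `&` (plane_rot i j (c * (k%:R * h)) @^-1` O) : set L).
  by apply: measurableI => //; exact: mr.
split; first by rewrite E; exact: bigcupT_measurable.
have m2 k : measurable (S k `&` O : set L) by exact: measurableI.
rewrite E [in RHS]EO (lebesgue_outer_bigcup m1 (tS _)).
rewrite (lebesgue_outer_bigcup m2 (tS (fun=> O))).
apply: eq_eseriesr => k _.
rewrite -(outer_invariant_plane_rot ji (c * (k%:R * h)) (S k `&` O)).
congr mu; apply/seteqP; split => x [Sx Ox]; split => //=.
  by rewrite /S/= ai.
by move: Sx; rewrite /S/= ai.
Qed.

(** The twist is the pointwise limit of its quantized versions, which preserve measure; as in
    Fatou's lemma, the limit can only lose measure. Equality is recovered later from the same bound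
    for the inverse twist. *)
Lemma twist_box_le (a : V -> R) (c : R) (p q : V) :
  (forall t x, a (plane_rot i j t x) = a x) -> (forall x, 0 <= a x) ->
  measurable_fun setT (a : L -> R) ->
  (mu (twist (fun x => c * a x)%R @^-1` box p q) <= (box_vol p q)%:E)%E.
Proof.
move=> ai a0 ma; set f := twist _.
(* Open boxes are enough: [box p q] lies in one whose lower corner is pushed down by [d], at a cost
   [e] in volume. *)
suff H p' : (mu (f @^-1` obox p' q) <= (box_vol p' q)%:E)%E.
  apply/lee_addgt0Pr => e /(box_vol_widen p q)[d d0 hd].
  apply: le_trans (_ : (box_vol (\row_k (p ord0 k - d)%R) q)%:E <= _)%E; last first.
    by rewrite -EFinD lee_fin.
  apply: le_trans (H _); apply: le_lebesgue_outer => x /= + k => /(_ k).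
  by rewrite mxE => /andP[h ->]; rewrite andbT (lt_le_trans _ h)// ltrBlDr ltrDl.
pose h n : R := n.+1%:R^-1.
have h0 n : 0 < h n by rewrite invr_gt0 ltr0n.
pose P n (x : V) := c * ((Num.truncn (a x / h n))%:R * h n).
have mO := measurable_obox p' q.
have [mP eP] : (forall n, measurable (twist (P n) @^-1` obox p' q : set L)) /\
    (forall n, mu (twist (P n) @^-1` obox p' q) = mu (obox p' q)).
  by split => n; have [] := twist_rational_preimage c (h0 n) ai a0 ma mO.
(* [A m] collects the points sent into the open box by every quantized twist from rank [m] on. These
   sets increase, and their union contains the preimage under the limit twist. *)
pose A m : set V := \bigcap_n (twist (P (m + n)%N) @^-1` obox p' q).
have mA m : measurable (A m : set L) by exact: bigcapT_measurable.
have nA : nondecreasing_seq (A : nat -> set L).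
  apply/nondecreasing_seqP => m; apply/subsetPset => x Ax n _.
  by rewrite addSnnS; exact: Ax.
have lA m : (mu (A m) <= (box_vol p' q)%:E)%E.
  apply: le_trans (lebesgue_outer_box p' q).
  apply: (@le_trans _ _ (mu (obox p' q))).
    rewrite -(eP m); apply: le_lebesgue_outer => x /(_ 0%N I).
    by rewrite addn0.
  by apply: le_lebesgue_outer => x hx k; have /andP[/ltW -> ->] := hx k.
have : (mu (\bigcup_m A m) <= (box_vol p' q)%:E)%E.
  have mU : measurable (\bigcup_m A m : set L) by exact: bigcupT_measurable.
  have cv := nondecreasing_cvg_mu (mu := @lebesgueN R N) mA mU nA.
  by apply: (cvge_to_le cv); apply: nearW => m; exact: lA.
apply: le_trans; apply: le_lebesgue_outer => x fx.
have Pa : P n x @[n --> \oo] --> c * a x.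
  apply: cvgM; first exact: cvg_cst.
  apply/cvgrPdist_le => /= e e0.
  have : h n @[n --> \oo] --> (0 : R) by exact: cvg_harmonic.
  move=> /cvgrPdist_le/(_ e e0); apply: filterS => n.
  rewrite sub0r normrN gtr0_norm// => hn.
  have /andP[t1 t2] : (Num.truncn (a x / h n))%:R <= a x / h n <
      (Num.truncn (a x / h n)).+1%:R.
    by apply: truncn_itv; rewrite divr_ge0// ltW.
  rewrite ler_pdivlMr// in t1; rewrite ltr_pdivrMr// -natr1 mulrDl mul1r in t2.
  by rewrite ger0_norm ?subr_ge0//; lra.
have rc : \forall n \near \oo, obox p' q (twist (P n) x).
  apply: filter_forall => k.
  have : (twist (P n) x) ord0 k @[n --> \oo] --> (f x) ord0 k.
    rewrite /f /twist !mxE.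
    have cc : cos (P n x) @[n --> \oo] --> cos (c * a x).
      by apply: continuous_cvg => //; exact: continuous_cos.
    have cs : sin (P n x) @[n --> \oo] --> sin (c * a x).
      by apply: continuous_cvg => //; exact: continuous_sin.
    under eq_cvg do rewrite mxE.
    case: eqP => _; first by apply: cvgB; apply: cvgM => //; exact: cvg_cst.
    case: eqP => _; first by apply: cvgD; apply: cvgM => //; exact: cvg_cst.
    exact: cvg_cst.
  have /andP[fx1 fx2] := fx k.
  move=> hc; near=> n; apply/andP; split; near: n.
    exact: (cvgr_gt _ hc).
  exact: (cvgr_lt _ hc).
have [m _ hm] := rc.
by exists m => // n _; apply: hm; rewrite /= leq_addr.
Unshelve. all: by end_near. Qed.

Lemma outer_invariant_twist (a : V -> R) (c : R) :
  (forall t x, a (plane_rot i j t x) = a x) -> (forall x, 0 <= a x) ->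
  measurable_fun setT (a : L -> R) ->
  outer_invariant (twist (fun x => c * a x)).
Proof.
move=> ai a0 ma.
have cai d t x : d * a (plane_rot i j t x) = d * a x by rewrite ai.
have e : twist (fun x => - (c * a x)) = twist (fun x => - c * a x).
  by apply/funext => x; rewrite /twist mulNr.
apply: (@outer_invariant_cancel _ _ _ (twist (fun x => - c * a x))).
- by move=> x; rewrite -e twistK.
- by move=> x; rewrite /twist cai plane_rot_add// mulNr subrr plane_rot0.
- by apply: lebesgue_outer_preimage_le => p q; exact: twist_box_le.
- by apply: lebesgue_outer_preimage_le => p q; exact: twist_box_le.
Qed.
End twist.

(** * Second variation of the kernel *)

Lemma expR_le_quad (R : realType) (z : R) : `|z| <= 2^-1 ->
  expR z <= 1 + z + 2 * z ^+ 2.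
Proof.
rewrite ler_norml => /andP[z1 z2].
have h1 : 0 < 1 - z by lra.
have h2 : 1 - z <= expR (- z) by have := expR_ge1Dx (- z); lra.
rewrite -[z in expR z]opprK expRN.
apply: (@le_trans _ _ (1 - z)^-1); first by rewrite lef_pV2 ?posrE// expR_gt0.
rewrite -[leLHS]mul1r ler_pdivrMr//.
rewrite [leRHS](_ : _ = 1 + z ^+ 2 * (1 - 2 * z)); last by ring.
by rewrite lerDl mulr_ge0 ?sqr_ge0//; lra.
Qed.

Lemma ln1D_ge (R : realType) (u : R) : - 2^-1 <= u ->
  u - 2 * u ^+ 2 <= ln (1 + u).
Proof.
move=> u1; have h1 : 0 < 1 + u by lra.
apply: (@le_trans _ _ (1 - (1 + u)^-1)).
  rewrite (_ : 1 - _ = u / (1 + u)); last by field; rewrite gt_eqF.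
  rewrite ler_pdivlMr//.
  rewrite [leLHS](_ : _ = u - u ^+ 2 * (1 + 2 * u)); last by ring.
  by rewrite gerBl mulr_ge0 ?sqr_ge0//; lra.
have h2 : 0 < (1 + u)^-1 by rewrite invr_gt0.
have := expR_ge1Dx (- ln (1 + u)); rewrite expRN lnK ?posrE// => ?.
lra.
Qed.

(* The second difference of [r |-> r ^ (- M)] along a perturbation [r ^ 2 = 1 + a +/- b]:
   the first order terms in [b] cancel. *)
Lemma powR_inv_second_difference (R : realType) (m M d d1 d2 a b : R) :
  1 <= m -> 0 <= M <= m -> 0 < d -> 0 <= d1 -> 0 <= d2 ->
  `|a| <= (8 * m)^-1 -> `|b| <= (8 * m)^-1 ->
  d1 ^+ 2 = d ^+ 2 * (1 + a + b) -> d2 ^+ 2 = d ^+ 2 * (1 + a - b) ->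
  (d1 `^ M)^-1 + (d2 `^ M)^-1 <=
    (d `^ M)^-1 * (2 + 7 * m ^+ 2 * (`|a| + b ^+ 2)).
Proof.
move=> m1 /andP[M0 Mm] d0 d10 d20 ha hb e1 e2.
have m0 : 0 < m by lra.
have mM : (8 * m)^-1 * m = 8^-1 by field; rewrite gt_eqF.
have ms : (8 * m)^-1 <= 8^-1.
  by rewrite lef_pV2 ?posrE ?mulr_gt0//; lra.
(* A quadratic upper bound for (1 + u)^(-M/2), seen as the exponential of -M/2 ln(1 + u); [z] below
   is the exponent once the logarithm is replaced by its lower bound. *)
have one (e u : R) : 0 <= e -> `|u| <= 2 * (8 * m)^-1 ->
    e ^+ 2 = d ^+ 2 * (1 + u) ->
    (e `^ M)^-1 <= (d `^ M)^-1 * (1 - M / 2 * u + (M + 2 * M ^+ 2) * u ^+ 2).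
  move=> e0 hu eE.
  have hu4 : `|u| <= 4^-1 by lra.
  have /andP[u1 u2] : - 4^-1 <= u <= 4^-1 by rewrite -ler_norml.
  have Mu : M * `|u| <= 4^-1.
    apply: (@le_trans _ _ (m * (2 * (8 * m)^-1))); first exact: ler_pM.
    by rewrite mulrCA [m * _]mulrC mM; lra.
  have pos : 0 < 1 + u by lra.
  have ep : 0 < e.
    rewrite lt_neqAle e0 andbT eq_sym -sqrf_eq0 eE gt_eqF// mulr_gt0 ?exprn_gt0//.
  pose r := e / d; have r0 : 0 < r by rewrite divr_gt0.
  have rE : r ^+ 2 = 1 + u by rewrite /r expr_div_n eE mulrAC divff ?mul1r// sqrf_eq0 gt_eqF.
  have -> : e = d * r by rewrite /r mulrC divfK ?gt_eqF.
  rewrite powRM ?(ltW d0) ?(ltW r0)// invfM ler_pM2l ?invr_gt0 ?powR_gt0//.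
  rewrite /powR gt_eqF// -expRN.
  have lr : ln (1 + u) = 2 * ln r by rewrite -rE lnXn// mulr_natl.
  have lu := ln1D_ge (_ : - 2^-1 <= u); have {}lu := lu ltac:(lra).
  pose z := - (M / 2) * u + M * u ^+ 2.
  have u20 := sqr_ge0 u.
  have uu : u ^+ 2 <= `|u| * 4^-1.
    by rewrite -[u ^+ 2]real_normK ?num_real// expr2 ler_wpM2l.
  have zM : `|z| <= M * `|u|.
    have zz : `|z| <= M / 2 * `|u| + M * u ^+ 2.
      apply: le_trans (ler_normD _ _) _.
      rewrite [`|- _ * u|]normrM normrN [`|M / 2|]ger0_norm; last by lra.
      by rewrite [`|M * _|]ger0_norm// mulr_ge0.
    apply: le_trans zz _; have := ler_wpM2l M0 uu; have := mulr_ge0 M0 (normr_ge0 u); lra.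
  have -> : - (M * ln r) = - (M / 2) * ln (1 + u) by rewrite lr; field.
  apply: (@le_trans _ _ (expR z)).
    rewrite ler_expR /z.
    have M2p : 0 <= M / 2 by lra.
    by have := ler_wpM2l M2p lu; lra.
  apply: le_trans (expR_le_quad _) _; first by lra.
  have : z ^+ 2 <= M ^+ 2 * u ^+ 2.
    rewrite -exprMn -[z ^+ 2]real_normK ?num_real//.
    by rewrite -[(M * u) ^+ 2]real_normK ?num_real// lerXn2r ?nnegrE// normrM (ger0_norm M0).
  have zE : z = - (M / 2) * u + M * u ^+ 2 by [].
  by move: zE; clearbody z => zE z2; lra.
have hu1 : `|a + b| <= 2 * (8 * m)^-1 by apply: le_trans (ler_normD _ _) _; lra.
have hu2 : `|a - b| <= 2 * (8 * m)^-1 by apply: le_trans (ler_normB _ _) _; lra.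
rewrite -addrA in e1; rewrite -addrA in e2.
apply: le_trans (lerD (one _ _ d10 hu1 e1) (one _ _ d20 hu2 e2)) _.
rewrite -mulrDr ler_pM2l ?invr_gt0 ?powR_gt0//.
set c := M + 2 * M ^+ 2.
have c0 : 0 <= c by rewrite addr_ge0// mulr_ge0// sqr_ge0.
have M2 : M ^+ 2 <= m ^+ 2 by rewrite lerXn2r ?nnegrE ?(ltW m0).
have mm : m <= m ^+ 2 by rewrite expr2 ler_peMr// ltW.
have cm : c <= 3 * m ^+ 2 by rewrite /c; lra.
have a2 : a ^+ 2 <= `|a| * 8^-1.
  by rewrite -[a ^+ 2]real_normK ?num_real// expr2 ler_wpM2l//; lra.
have -> : 1 - M / 2 * (a + b) + c * (a + b) ^+ 2 + (1 - M / 2 * (a - b) + c * (a - b) ^+ 2) =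
  2 - M * a + 2 * (c * (a ^+ 2 + b ^+ 2)) by field.
have h1 : - (M * a) <= m ^+ 2 * `|a|.
  apply: le_trans (ler_norm _) _; rewrite normrN normrM (ger0_norm M0).
  by apply: ler_wpM2r => //; lra.
have h2 : c * (a ^+ 2 + b ^+ 2) <= 3 * m ^+ 2 * (`|a| + b ^+ 2).
  apply: ler_pM => //; first by rewrite addr_ge0 ?sqr_ge0.
  by rewrite lerD2r; have := normr_ge0 a; lra.
have := mulr_ge0 (sqr_ge0 m) (sqr_ge0 b); lra.
Qed.

(** * The Euclidean norm under plane rotations *)

Section enorm.
Context {R : realType} {N : nat}.
Implicit Types x y : 'rV[R]_N.

Definition esq x : R := \sum_(k < N) x ord0 k ^+ 2.

Lemma esq_ge0 x : 0 <= esq x.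
Proof. by apply: sumr_ge0 => k _; exact: sqr_ge0. Qed.

Lemma enorm_ge0 x : 0 <= enorm x.
Proof. exact: sqrtr_ge0. Qed.

Lemma enorm_sqr x : enorm x ^+ 2 = esq x.
Proof. by rewrite sqr_sqrtr// esq_ge0. Qed.

Lemma enorm_esq x y : esq x = esq y -> enorm x = enorm y.
Proof. by rewrite /enorm /esq => ->. Qed.

Lemma enorm_sub x y : enorm (x - y) = enorm (y - x).
Proof.
by apply: enorm_esq; apply: eq_bigr => k _; rewrite !mxE -sqrrN opprB.
Qed.

Lemma enorm0_eq x : enorm x = 0 -> x = 0.
Proof.
move=> x0; have : esq x = 0 by rewrite -enorm_sqr x0 expr0n.
move/eqP; rewrite psumr_eq0; last by move=> k _; exact: sqr_ge0.
move=> /allP h; apply/rowP => k; rewrite mxE; apply/eqP.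
by rewrite -sqrf_eq0; apply: h; rewrite mem_index_enum.
Qed.

Lemma enorm0 : enorm (0 : 'rV[R]_N) = 0.
Proof.
by apply/eqP; rewrite sqrtr_eq0 big1// => k _; rewrite mxE expr0n.
Qed.

Lemma cauchy_schwarz x y :
  \sum_(k < N) x ord0 k * y ord0 k <= enorm x * enorm y.
Proof.
set S := \sum_(k < N) _; set a := enorm x; set b := enorm y.
have ab0 : 0 <= a * b by rewrite mulr_ge0 ?enorm_ge0.
have [ab|ab] := eqVneq (a * b) 0.
  rewrite ab /S big1// => k _; move/eqP: ab; rewrite mulf_eq0.
  by case/orP => /eqP/enorm0_eq ->; rewrite mxE ?mul0r ?mulr0.
have : 0 <= \sum_(k < N) (b * x ord0 k - a * y ord0 k) ^+ 2.
  by apply: sumr_ge0 => k _; exact: sqr_ge0.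
have -> : \sum_(k < N) (b * x ord0 k - a * y ord0 k) ^+ 2 =
    b ^+ 2 * esq x - 2 * (a * b) * S + a ^+ 2 * esq y.
  rewrite /esq /S !mulr_sumr -sumrB -big_split/=.
  by apply: eq_bigr => k _; ring.
rewrite -!enorm_sqr -/a -/b => h.
have {}ab0 : 0 < a * b by rewrite lt_neqAle eq_sym ab.
rewrite -(ler_pM2l ab0).
have -> : a * b * (a * b) = (b ^+ 2 * a ^+ 2 + a ^+ 2 * b ^+ 2) / 2 by field.
lra.
Qed.

Lemma enorm_triangle x y : enorm (x + y) <= enorm x + enorm y.
Proof.
rewrite -(@ler_pXn2r _ 2) ?nnegrE ?addr_ge0 ?enorm_ge0//.
rewrite enorm_sqr sqrrD !enorm_sqr.
have -> : esq (x + y) = esq x + 2 * \sum_(k < N) x ord0 k * y ord0 k + esq y.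
  rewrite /esq mulr_sumr -!big_split/=; apply: eq_bigr => k _; rewrite !mxE; ring.
by have := cauchy_schwarz x y; rewrite mulr2n; lra.
Qed.

Lemma coord_enorm x k : `|x ord0 k| <= enorm x.
Proof.
rewrite -(@ler_pXn2r _ 2) ?nnegrE ?enorm_ge0// enorm_sqr real_normK ?num_real//.
by rewrite /esq (bigD1 k)//= lerDl sumr_ge0// => l _; exact: sqr_ge0.
Qed.

Lemma enorm_le_coord x (c : R) : (forall k, `|x ord0 k| <= c) -> 0 <= c ->
  enorm x <= N%:R * c.
Proof.
move=> xc c0; rewrite -(@ler_pXn2r _ 2) ?nnegrE ?enorm_ge0 ?mulr_ge0// enorm_sqr.
apply: (@le_trans _ _ (\sum_(k < N) c ^+ 2)).
  apply: ler_sum => k _; rewrite -[x _ _ ^+ 2]real_normK ?num_real//.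
  by rewrite lerXn2r ?nnegrE.
rewrite sumr_const card_ord -[leLHS]mulr_natl exprMn ler_wpM2r ?sqr_ge0//.
by case: (N) => [|n]; rewrite ?expr0n// expr2 ler_peMr// ler1n.
Qed.

Lemma enorm_lt_coord x (c : R) : (0 < N)%N -> (forall k, `|x ord0 k| < c) ->
  enorm x < N%:R * c.
Proof.
move=> N0 xc; pose m := \big[Num.max/0]_(k < N) `|x ord0 k|.
have m0 : 0 <= m by exact: bigmax_ge_id.
have c0 : 0 < c by apply: le_lt_trans (xc (Ordinal N0)).
have mc : m < c by apply: bigmax_lt.
apply: (@le_lt_trans _ _ (N%:R * m)).
  by apply: enorm_le_coord => // k; exact: le_bigmax.
by rewrite ltr_pM2l// ltr0n.
Qed.

Context (i j : 'I_N) (ji : j != i).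

Lemma esq2 x : esq x = x ord0 i ^+ 2 + (x ord0 j ^+ 2 +
  \sum_(k < N | (k != i) && (k != j)) x ord0 k ^+ 2).
Proof. by rewrite /esq (bigD1 i)//= (bigD1 j). Qed.

(** Only the relative angle enters. The cosine term is even in it and of second order; the sine term
    is odd and of first order, so it cancels between opposite times. *)
Lemma esq_rot_sub s t x y :
  esq (plane_rot i j s x - plane_rot i j t y) = esq (x - y) -
    2 * ((cos (t - s) - 1) * (x ord0 i * y ord0 i + x ord0 j * y ord0 j) +
         sin (t - s) * (x ord0 j * y ord0 i - x ord0 i * y ord0 j)).
Proof.
rewrite !esq2 !mxE !eqxx (negbTE ji).
have -> : \sum_(k < N | (k != i) && (k != j)) (plane_rot i j s x - plane_rot i j t y) ord0 k ^+ 2 =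
  \sum_(k < N | (k != i) && (k != j)) (x - y) ord0 k ^+ 2.
  by apply: eq_bigr => k /andP[/negbTE ki /negbTE kj]; rewrite !mxE ki kj.
rewrite cosB sinB; have := cos2Dsin2 s; have := cos2Dsin2 t.
set c := cos t; set c' := cos s; set d := sin t; set d' := sin s.
move=> h1 h2; set S := \sum_(k < N | _) _.
have e1 : c ^+ 2 = 1 - d ^+ 2 by rewrite -h1; ring.
have e2 : c' ^+ 2 = 1 - d' ^+ 2 by rewrite -h2; ring.
rewrite [LHS](_ : _ = c' ^+ 2 * (x ord0 i ^+ 2 + x ord0 j ^+ 2) +
  d' ^+ 2 * (x ord0 i ^+ 2 + x ord0 j ^+ 2) +
  c ^+ 2 * (y ord0 i ^+ 2 + y ord0 j ^+ 2) +
  d ^+ 2 * (y ord0 i ^+ 2 + y ord0 j ^+ 2) -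
  2 * ((c * c' + d * d') * (x ord0 i * y ord0 i + x ord0 j * y ord0 j) +
   (d * c' - c * d') * (x ord0 j * y ord0 i - x ord0 i * y ord0 j)) + S); last by ring.
rewrite e1 e2; ring.
Qed.

Lemma esq_rot t x : esq (plane_rot i j t x) = esq x.
Proof.
have r0 : plane_rot i j t 0 = 0 :> 'rV[R]_N.
  by apply/rowP => k; rewrite !mxE !mulr0 subrr addr0 !if_same.
have := esq_rot_sub t t x 0.
by rewrite r0 subrr cos0 sin0 subrr !mul0r addr0 mulr0 !subr0.
Qed.

Lemma plane_dot_le x y :
  `|x ord0 i * y ord0 i + x ord0 j * y ord0 j| <= enorm x * enorm y.
Proof.
rewrite -(@ler_pXn2r _ 2) ?nnegrE ?mulr_ge0 ?enorm_ge0// exprMn !enorm_sqr.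
rewrite real_normK ?num_real// !esq2.
set a := x ord0 i; set b := x ord0 j; set c := y ord0 i; set d := y ord0 j.
set S := \sum_(k < N | _) x _ _ ^+ 2; set T := \sum_(k < N | _) y _ _ ^+ 2.
have S0 : 0 <= S by apply: sumr_ge0 => k _; exact: sqr_ge0.
have T0 : 0 <= T by apply: sumr_ge0 => k _; exact: sqr_ge0.
rewrite -subr_ge0 (_ : _ - _ = (a * d - b * c) ^+ 2 + S * (c ^+ 2 + d ^+ 2) +
  (a ^+ 2 + b ^+ 2) * T + S * T); last by ring.
by rewrite !addr_ge0 ?sqr_ge0// !mulr_ge0 ?addr_ge0 ?sqr_ge0.
Qed.

Lemma plane_wedge_le x y :
  `|x ord0 j * y ord0 i - x ord0 i * y ord0 j| <= enorm x * enorm y.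
Proof.
rewrite -(@ler_pXn2r _ 2) ?nnegrE ?mulr_ge0 ?enorm_ge0// exprMn !enorm_sqr.
rewrite real_normK ?num_real// !esq2.
set a := x ord0 i; set b := x ord0 j; set c := y ord0 i; set d := y ord0 j.
set S := \sum_(k < N | _) x _ _ ^+ 2; set T := \sum_(k < N | _) y _ _ ^+ 2.
have S0 : 0 <= S by apply: sumr_ge0 => k _; exact: sqr_ge0.
have T0 : 0 <= T by apply: sumr_ge0 => k _; exact: sqr_ge0.
rewrite -subr_ge0 (_ : _ - _ = (a * c + b * d) ^+ 2 + S * (c ^+ 2 + d ^+ 2) +
  (a ^+ 2 + b ^+ 2) * T + S * T); last by ring.
by rewrite !addr_ge0 ?sqr_ge0// !mulr_ge0 ?addr_ge0 ?sqr_ge0.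
Qed.

(** The wedge of [x] and [y] is, up to sign, that of [x] (or of [y]) with [x - y]. This gains the
    factor [enorm (x - y)] and leaves a choice of which point has to be close to the centre. *)
Lemma plane_wedge_le_sub x y :
  `|x ord0 j * y ord0 i - x ord0 i * y ord0 j| <= enorm x * enorm (x - y) /\
  `|x ord0 j * y ord0 i - x ord0 i * y ord0 j| <= enorm y * enorm (x - y).
Proof.
split.
  apply: le_trans (plane_wedge_le x (x - y)); rewrite !mxE -normrN.
  by rewrite le_eqVlt; apply/orP; left; apply/eqP; congr `|_|; ring.
apply: le_trans (plane_wedge_le y (x - y)); rewrite !mxE -normrN.
by rewrite le_eqVlt; apply/orP; left; apply/eqP; congr `|_|; ring.
Qed.

End enorm.

Lemma sin_norm_le (R : realType) (x : R) : `|sin x| <= `|x|.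
Proof.
wlog x0 : x / 0 <= x.
  move=> h; have [x0|x0] := leP 0 x; first exact: h.
  by rewrite -[x]opprK sinN normrN [leRHS]normrN; apply: h; lra.
have [c _] := @MVT_segment _ sin cos 0 x x0 (fun y _ => is_derive_sin y)
  (continuous_subspaceT (@continuous_sin R)).
rewrite sin0 !subr0 => ->; rewrite normrM ler_piMl//.
exact: cos_max.
Qed.

Lemma one_sub_cos_le (R : realType) (x : R) : `|cos x - 1| <= x ^+ 2 / 2.
Proof.
have -> : cos x - 1 = - (2 * sin (x / 2) ^+ 2).
  rewrite [x in LHS]splitr cosD -!expr2 cos2sin2; ring.
rewrite normrN ger0_norm; last by have := sqr_ge0 (sin (x / 2)); lra.
have : sin (x / 2) ^+ 2 <= (x / 2) ^+ 2.
  rewrite -[leLHS]real_normK ?num_real// -[leRHS]real_normK ?num_real//.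
  by rewrite lerXn2r ?nnegrE// sin_norm_le.
rewrite [(x / 2) ^+ 2]exprMn [2^-1 ^+ 2](_ : _ = 4^-1); first lra.
by rewrite exprVn -natrX.
Qed.

(** * A cut-off function of class C^2 *)

Definition pos_cube (R : realType) (u : R) : R := Num.max 0 u ^+ 3.

(** Equal to 1 for [u <= 1] and to 0 for [2 <= u]. The cube of the positive part is of class C^2,
    exactly the regularity asked of admissible fields. *)
Definition cutoff (R : realType) (u : R) : R :=
  1 - pos_cube (1 - pos_cube (2 - u)).

Section cutoff.
Context {R : realType}.
Implicit Types u v : R.

Lemma cutoff1 u : u <= 1 -> cutoff u = 1.
Proof.
move=> u1; rewrite /cutoff /pos_cube [Num.max 0 (2 - u)](_ : _ = 2 - u); last first.
  by apply/max_idPr; lra.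
suff -> : Num.max 0 (1 - (2 - u) ^+ 3) = 0 by rewrite expr0n subr0.
apply/max_idPl; rewrite subr_le0 exprn_ege1//; lra.
Qed.

Lemma cutoff0 u : 2 <= u -> cutoff u = 0.
Proof.
move=> u1; rewrite /cutoff /pos_cube [Num.max 0 (2 - u)](_ : _ = 0); last first.
  by apply/max_idPl; lra.
by rewrite expr0n subr0 (_ : Num.max 0 1 = 1) ?expr1n ?subrr//; apply/max_idPr.
Qed.

Definition clamp u : R := Num.max 0 (Num.min 1 u).

(** Once the variable is clamped to [0, 1] the cut-off is a polynomial in it; this gives its range
    and the Lipschitz constant 9 = 3 * 3. *)
Lemma cutoff_clamp u : let c := clamp (2 - u) in cutoff u = 1 - (1 - c ^+ 3) ^+ 3.
Proof.
rewrite /= /clamp; have [u1|u1] := leP u 1.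
  rewrite cutoff1// minEle ifT; last by lra.
  by rewrite (_ : Num.max 0 1 = 1) ?expr1n ?subrr ?expr0n ?subr0//; apply/max_idPr.
have [u2|u2] := leP 2 u.
  rewrite cutoff0// minEle ifF; last by apply/negbTE; rewrite -ltNge; lra.
  rewrite (_ : Num.max 0 (2 - u) = 0) ?expr0n ?subr0 ?expr1n ?subrr//.
  by apply/max_idPl; lra.
rewrite minEle ifF; last by apply/negbTE; rewrite -ltNge; lra.
rewrite /cutoff /pos_cube (_ : Num.max 0 (2 - u) = 2 - u); last by apply/max_idPr; lra.
rewrite (_ : Num.max 0 _ = 1 - (2 - u) ^+ 3)//; apply/max_idPr.
by rewrite subr_ge0 exprn_ile1//; lra.
Qed.

Lemma clamp01 u : 0 <= clamp u <= 1.
Proof. by rewrite /clamp le_max lexx ge_max ler01 ge_min lexx. Qed.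

Lemma clampP u :
  [\/ u <= 0 /\ clamp u = 0, 0 <= u <= 1 /\ clamp u = u | 1 <= u /\ clamp u = 1].
Proof.
rewrite /clamp; have [u0|u0] := leP u 0.
  by apply: Or31; split => //; apply/max_idPl; rewrite ge_min u0 orbT.
have [u1|u1] := leP u 1.
  apply: Or32; split; first by rewrite ltW.
  exact/max_idPr/ltW.
apply: Or33; split; first exact: ltW.
exact/max_idPr.
Qed.

Lemma clamp_lip u v : `|clamp u - clamp v| <= `|u - v|.
Proof.
wlog uv : u v / v <= u.
  move=> h; have [/h//|/ltW/h] := leP v u.
  by rewrite distrC [leRHS]distrC.
rewrite [leRHS]ger0_norm ?subr_ge0// ler_norml.
have [[? ->]|[? ->]|[? ->]] := clampP u;
have [[? ->]|[? ->]|[? ->]] := clampP v; lra.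
Qed.

Lemma cube_lip (a b : R) : 0 <= a <= 1 -> 0 <= b <= 1 ->
  `|a ^+ 3 - b ^+ 3| <= 3 * `|a - b|.
Proof.
move=> /andP[a0 a1] /andP[b0 b1].
have -> : a ^+ 3 - b ^+ 3 = (a ^+ 2 + a * b + b ^+ 2) * (a - b) by ring.
rewrite normrM ler_wpM2r// ger0_norm; last first.
  by rewrite !addr_ge0 ?sqr_ge0 ?mulr_ge0.
have : a ^+ 2 <= 1 by rewrite exprn_ile1.
have : b ^+ 2 <= 1 by rewrite exprn_ile1.
have : a * b <= 1 by rewrite mulr_ile1.
lra.
Qed.

Lemma cutoff01 u : 0 <= cutoff u <= 1.
Proof.
rewrite cutoff_clamp; have /andP[c0 c1] := clamp01 (2 - u).
set c := clamp _ in c0 c1 *.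
have c31 : c ^+ 3 <= 1 by rewrite exprn_ile1.
have c30 : 0 <= c ^+ 3 by rewrite exprn_ge0.
have h0 : 0 <= (1 - c ^+ 3) ^+ 3 by rewrite exprn_ge0; lra.
have h1 : (1 - c ^+ 3) ^+ 3 <= 1 by rewrite exprn_ile1; lra.
lra.
Qed.

Lemma cutoff_lip u v : `|cutoff u - cutoff v| <= 9 * `|u - v|.
Proof.
rewrite !cutoff_clamp; have c01 := clamp01 (2 - u); have d01 := clamp01 (2 - v).
have cd := clamp_lip (2 - u) (2 - v).
set c := clamp (2 - u) in c01 cd *; set d := clamp (2 - v) in d01 cd *.
have e01 (e : R) : 0 <= e <= 1 -> 0 <= 1 - e ^+ 3 <= 1.
  move=> /andP[e0 e1]; have : e ^+ 3 <= 1 by rewrite exprn_ile1.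
  have : 0 <= e ^+ 3 by rewrite exprn_ge0.
  by lra.
have h1 := cube_lip (e01 _ c01) (e01 _ d01); have h2 := cube_lip c01 d01.
rewrite [`|_ - _|](_ : _ = `|(1 - c ^+ 3) ^+ 3 - (1 - d ^+ 3) ^+ 3|); last first.
  by rewrite -normrN; congr `|_|; ring.
apply: le_trans h1 _.
rewrite [`|_ - _|](_ : _ = `|c ^+ 3 - d ^+ 3|); last first.
  by rewrite -normrN; congr `|_|; ring.
have : `|2 - u - (2 - v)| = `|u - v| by rewrite -normrN; congr `|_|; ring.
lra.
Qed.
End cutoff.

(** Here [d] is the distance of two points, [g] the difference of their angles and [w] the far
    weight. For [d <= rho] the Lipschitz bound on the angle provides the powers of [d]; beyond,
    [|g| <= 1] suffices and [w * d ^+ 2] is [rho * d]. *)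
Lemma whirl_coeff_le (R : realType) (k rho d g w : R) :
  1 <= k -> 0 < rho -> 0 < d -> `|g| <= 1 -> (d <= rho -> `|g| <= k * d / rho) ->
  w = Num.min 1 (rho / d) ->
  g ^+ 2 * (2 * rho * (2 * rho + d)) <= 6 * k ^+ 2 * (w * d ^+ 2) /\
  `|g| * (2 * rho * d) <= 2 * k * (w * d ^+ 2).
Proof.
move=> k1 r0 d0 g1 gk wE.
have k0 : 0 < k by lra.
have gg : g ^+ 2 <= `|g| ^+ 2 by rewrite real_normK ?num_real.
have rd : 0 < rho * d by rewrite mulr_gt0.
have p1 : 0 <= 2 * rho * (2 * rho + d).
  by rewrite mulr_ge0 ?addr_ge0 ?mulr_ge0 ?ltW.
have p2 : 0 <= 2 * rho * d by rewrite -mulrA mulr_ge0 ?ltW.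
have [dr|dr] := leP d rho.
  have {}wE : w = 1 by rewrite wE; apply/min_idPl; rewrite ler_pdivlMr// mul1r.
  have {}gk := gk dr.
  have q0 : 0 <= k * d / rho by rewrite divr_ge0 ?mulr_ge0 ?ltW.
  rewrite wE mul1r; split.
    apply: (@le_trans _ _ ((k * d / rho) ^+ 2 * (2 * rho * (3 * rho)))).
      apply: ler_pM; rewrite ?sqr_ge0//.
        by apply: le_trans gg _; rewrite lerXn2r ?nnegrE.
      by apply: ler_wpM2l; lra.
    rewrite le_eqVlt; apply/orP; left; apply/eqP; field.
    by rewrite gt_eqF.
  apply: (@le_trans _ _ (k * d / rho * (2 * rho * d))); first exact: ler_wpM2r.
  rewrite le_eqVlt; apply/orP; left; apply/eqP; field.
  by rewrite gt_eqF.
have {}wE : w * d ^+ 2 = rho * d.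
  have -> : w = rho / d by rewrite wE; apply/min_idPr; rewrite ler_pdivrMr// mul1r ltW.
  by field; rewrite gt_eqF.
rewrite wE; split.
  apply: (@le_trans _ _ (1 * (2 * rho * (3 * d)))).
    apply: ler_pM; rewrite ?sqr_ge0//.
      by apply: le_trans gg _; rewrite exprn_ile1.
    by apply: ler_wpM2l; lra.
  have k2 : 1 <= k ^+ 2 by rewrite exprn_ege1.
  by have := ler_wpM2r (ltW rd) k2; lra.
apply: (@le_trans _ _ (1 * (2 * rho * d))); first exact: ler_wpM2r.
by have := ler_wpM2r (ltW rd) k1; lra.
Qed.

Section twist_kernel.
Context {R : realType} {N : nat} (i j : 'I_N) (ji : j != i).
Implicit Types (x y : 'rV[R]_N) (t rho : R).

(** A function of the norm alone, hence constant along the orbits of the rotation: the cut-off flow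
    is an explicit twist. *)
Definition angle rho x : R := cutoff (esq x / rho ^+ 2).

Definition whirl rho t x := plane_rot i j (t * angle rho x) x.

(** Relative size of the second variation of the kernel at the pair. Its decay at infinity is what
    keeps the constants bounded as s tends to 0. *)
Definition far_weight rho x y : R := Num.min 1 (rho / enorm (x - y)).

Lemma angle_supp rho x : 0 < rho -> 2 * rho < enorm x -> angle rho x = 0.
Proof.
move=> r0 rx; apply: cutoff0; rewrite ler_pdivlMr ?exprn_gt0//.
have : (2 * rho) ^+ 2 <= enorm x ^+ 2.
  by rewrite ler_pXn2r ?nnegrE ?enorm_ge0 ?mulr_ge0 ?ltW.
rewrite enorm_sqr exprMn; have := exprn_gt0 2 r0; rewrite [2 ^+ 2](_ : _ = 4); first lra.
by rewrite -natrX.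
Qed.

Lemma angle_rot rho t x : angle rho (plane_rot i j t x) = angle rho x.
Proof. by rewrite /angle esq_rot. Qed.

(* [54] bounds the Lipschitz constant of the rotation angle, in units of [rho^-1],
   at distances at most [rho]. *)
Definition whirl_const : R := 154 * N.+1%:R ^+ 2 * 54 ^+ 2.

(** Small enough that [4 * 54 * |t|] and [6 * 54 ^+ 2 * t ^+ 2] stay below [(8 * N.+1%:R)^-1], the
    range in which the second difference of the power is controlled. *)
Definition whirl_time : R := (8 * N.+1%:R)^-1 / (5 * 54).

(** The squared distances of the moved points at times [t] and [- t] are [d ^+ 2] times [1 + a + b]
    and [1 + a - b], with [a] from the cosine and [b] from the sine of the relative angle; [|a|] and
    [b ^+ 2] are both of order [t ^+ 2] times the weight. *)
Lemma whirl_second_difference s rho t x y :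
  0 < s < 1 -> 0 < rho -> `|t| <= whirl_time ->
  frac_kernel s (whirl rho t x) (whirl rho t y) +
  frac_kernel s (whirl rho (- t) x) (whirl rho (- t) y) <=
  frac_kernel s x y * (2 + whirl_const * t ^+ 2 * far_weight rho x y *
    ((enorm x <= 2 * rho) || (enorm y <= 2 * rho))%:R).
Proof.
move=> /andP[s0 s1] r0; rewrite /whirl_const /whirl_time => ht.
set m : R := N.+1%:R in ht *.
have m1 : 1 <= m by rewrite ler1n.
have m0 : 0 < m by lra.
set M := N%:R + s.
have Mm : 0 <= M <= m.
  by rewrite /M /m -natr1; apply/andP; split; [rewrite addr_ge0// ltW|lra].
(* On the diagonal the kernel takes the value 0, being the inverse of 0, so both sides vanish. *)
have [->|xy] := eqVneq x y.
  rewrite /frac_kernel !subrr enorm0 powR0 ?invr0 ?mul0r ?addr0//.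
  by rewrite gt_eqF// ltr_wpDl.
pose d := enorm (x - y).
have d0 : 0 < d.
  rewrite lt_neqAle enorm_ge0 andbT eq_sym; apply/eqP => /enorm0_eq/eqP.
  by rewrite subr_eq0 (negbTE xy).
pose P := x ord0 i * y ord0 i + x ord0 j * y ord0 j.
pose Q := x ord0 j * y ord0 i - x ord0 i * y ord0 j.
pose g := angle rho y - angle rho x.
pose a := - 2 * ((cos (t * g) - 1) * P) / d ^+ 2.
pose b := - 2 * (sin (t * g) * Q) / d ^+ 2.
have d20 : 0 < d ^+ 2 by rewrite exprn_gt0.
have E1 : enorm (whirl rho t x - whirl rho t y) ^+ 2 = d ^+ 2 * (1 + a + b).
  rewrite enorm_sqr /whirl (esq_rot_sub ji) -mulrBr -/g -/P -/Q /d enorm_sqr.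
  by rewrite /a /b /d enorm_sqr; field; rewrite -enorm_sqr gt_eqF.
have E2 : enorm (whirl rho (- t) x - whirl rho (- t) y) ^+ 2 = d ^+ 2 * (1 + a - b).
  rewrite enorm_sqr /whirl (esq_rot_sub ji) -mulrBr -/g -/P -/Q mulNr cosN sinN.
  by rewrite /a /b /d enorm_sqr; field; rewrite -enorm_sqr gt_eqF.
set W := _ || _.
have [W0|] := boolP W; last first.
  rewrite /W negb_or -!ltNge => /andP[rx ry].
  have g0 : g = 0 by rewrite /g !angle_supp// subrr.
  rewrite mulr0 addr0 /frac_kernel.
  have a0 : a = 0 by rewrite /a g0 mulr0 cos0 subrr !mul0r mulr0 mul0r.
  have b0 : b = 0 by rewrite /b g0 mulr0 sin0 mul0r mulr0 mul0r.
  rewrite a0 b0 !addr0 ?subr0 mulr1 in E1 E2.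
  have sqr_inj (e f : R) : 0 <= e -> 0 <= f -> e ^+ 2 = f ^+ 2 -> e = f.
    by move=> e0 f0 ef; apply/eqP; rewrite -(@eqrXn2 _ 2)//; apply/eqP.
  rewrite (sqr_inj _ _ (enorm_ge0 _) (enorm_ge0 _) E1).
  by rewrite (sqr_inj _ _ (enorm_ge0 _) (enorm_ge0 _) E2) -/d mulr2n mulrDr mulr1.
rewrite mulr1.
pose w := far_weight rho x y.
have w1 : w <= 1 by rewrite /w /far_weight ge_min lexx.
have w0 : 0 <= w by rewrite /w /far_weight le_min ler01 divr_ge0 ?ltW// enorm_ge0.
have tri : enorm x <= d + enorm y by have := enorm_triangle (x - y) y; rewrite subrK.
have tri' : enorm y <= d + enorm x.
  by have := enorm_triangle (y - x) x; rewrite subrK enorm_sub.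
have [W1 W2] : enorm x <= 2 * rho + d /\ enorm y <= 2 * rho + d.
  by case/orP: W0 => ?; split; lra.
have Pb : `|P| <= 2 * rho * (2 * rho + d).
  apply: le_trans (plane_dot_le ji x y) _.
  case/orP: W0 => h; last rewrite mulrC;
  by apply: ler_pM => //; rewrite ?enorm_ge0.
have Qb : `|Q| <= 2 * rho * d.
  have [q1 q2] := plane_wedge_le_sub ji x y.
  case/orP: W0 => h; [apply: le_trans q1 _|apply: le_trans q2 _];
  by apply: ler_wpM2r => //; rewrite enorm_ge0.
have g1 : `|g| <= 1.
  have := cutoff01 (esq x / rho ^+ 2); have := cutoff01 (esq y / rho ^+ 2).
  by rewrite ler_norml /g /angle => *; lra.
pose k : R := 54; rewrite -/k in ht *.
(* The Lipschitz constant 9 of the cut-off meets a difference of squared norms, factored as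
   difference times sum. For [d <= rho] this gives 9 * (4 + 2) = 54. *)
have g2 : `|g| <= 9 * (d * (4 * rho + 2 * d)) / rho ^+ 2.
  apply: le_trans (cutoff_lip _ _) _; rewrite -mulrBl normrM.
  rewrite [`|_^-1|]ger0_norm ?invr_ge0 ?sqr_ge0// [leLHS]mulrA ler_wpM2r ?invr_ge0 ?sqr_ge0//.
  rewrite ler_wpM2l// -!enorm_sqr subr_sqr normrM; apply: ler_pM => //.
    by rewrite ler_norml; lra.
  rewrite ger0_norm ?addr_ge0 ?enorm_ge0//; lra.
have gk : d <= rho -> `|g| <= k * d / rho.
  move=> dr; apply: le_trans g2 _; rewrite ler_pdivrMr ?exprn_gt0//.
  rewrite [leRHS](_ : _ = k * d * rho); last by field; rewrite gt_eqF.
  have : 0 <= d * (rho - d) by rewrite mulr_ge0 ?subr_ge0// ltW.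
  by rewrite /k; lra.
have k1 : 1 <= k by rewrite /k; lra.
have k0 : 0 < k by lra.
have k00 : 0 <= k by exact: ltW.
clearbody k; clear g2.
have [hg1 hg2] := whirl_coeff_le k1 r0 d0 g1 gk (erefl w).
have d2n : `|(d ^+ 2)^-1| = (d ^+ 2)^-1 by rewrite ger0_norm// invr_ge0 ltW.
have Ab : `|a| <= (6 * k ^+ 2) * t ^+ 2 * w.
  rewrite /a normrM d2n ler_pdivrMr// !normrM normrN [`|2|]ger0_norm//.
  have c1 := one_sub_cos_le (t * g).
  have t20 := sqr_ge0 t.
  apply: (@le_trans _ _ (2 * ((t * g) ^+ 2 / 2 * (2 * rho * (2 * rho + d))))).
    by rewrite ler_wpM2l//; apply: ler_pM.
  rewrite [leLHS](_ : _ = t ^+ 2 * (g ^+ 2 * (2 * rho * (2 * rho + d)))); last by field.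
  rewrite [leRHS](_ : _ = t ^+ 2 * ((6 * k ^+ 2) * (w * d ^+ 2))); last by ring.
  exact: ler_wpM2l.
have Bb : `|b| <= (4 * k) * `|t| * w.
  rewrite /b normrM d2n ler_pdivrMr// !normrM normrN [`|2|]ger0_norm//.
  have c1 : `|sin (t * g)| <= `|t| * `|g| by rewrite -normrM sin_norm_le.
  apply: (@le_trans _ _ (2 * (`|t| * `|g| * (2 * rho * d)))).
    by rewrite ler_wpM2l//; apply: ler_pM.
  rewrite [leLHS](_ : _ = 2 * `|t| * (`|g| * (2 * rho * d))); last by ring.
  rewrite [leRHS](_ : _ = 2 * `|t| * (2 * k * (w * d ^+ 2))); last by ring.
  by apply: ler_wpM2l; rewrite // mulr_ge0.
set e := (8 * m)^-1.
have e0 : 0 < e by rewrite invr_gt0 mulr_gt0.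
have e1 : e <= 8^-1 by rewrite /e lef_pV2 ?posrE ?mulr_gt0//; lra.
have t2 : t ^+ 2 = `|t| ^+ 2 by rewrite real_normK ?num_real.
rewrite -/e in ht.
have tk : k * `|t| <= e / 5.
  apply: (@le_trans _ _ (k * (e / (5 * k)))); first by rewrite ler_pM2l.
  by rewrite le_eqVlt; apply/orP; left; apply/eqP; field; rewrite gt_eqF.
have tk0 : 0 <= k * `|t| by rewrite mulr_ge0// ltW.
have tt : k ^+ 2 * `|t| ^+ 2 <= e / 25.
  apply: (@le_trans _ _ (e / 5 * (e / 5))).
    by rewrite -exprMn expr2; apply: ler_pM.
  rewrite [leLHS](_ : _ = e / 25 * e); last by field.
  by rewrite ger_pMr ?divr_gt0//; lra.
have hA : `|a| <= e.
  apply: le_trans Ab _; rewrite t2.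
  apply: (@le_trans _ _ ((6 * k ^+ 2) * `|t| ^+ 2)); last by lra.
  by rewrite ler_piMr// mulr_ge0 ?sqr_ge0// mulr_ge0 ?sqr_ge0.
have hB : `|b| <= e.
  apply: le_trans Bb _.
  apply: (@le_trans _ _ ((4 * k) * `|t|)); last by lra.
  by rewrite ler_piMr// mulr_ge0 ?mulr_ge0.
have B2 : b ^+ 2 <= (16 * k ^+ 2) * t ^+ 2 * w.
  rewrite -[b ^+ 2]real_normK ?num_real//.
  apply: (@le_trans _ _ (((4 * k) * `|t| * w) ^+ 2)).
    by rewrite lerXn2r ?nnegrE// mulr_ge0 ?mulr_ge0 ?mulr_ge0.
  rewrite t2 [leLHS](_ : _ = (16 * k ^+ 2) * `|t| ^+ 2 * w * w); last by ring.
  by rewrite ler_piMr// mulr_ge0// mulr_ge0 ?sqr_ge0// mulr_ge0 ?sqr_ge0.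
apply: le_trans (powR_inv_second_difference m1 Mm d0 _ _ hA hB E1 E2) _;
  rewrite ?enorm_ge0//.
rewrite /frac_kernel -/d -/M -/w ler_wpM2l ?invr_ge0 ?powR_ge0// lerD2l.
(* 22 = 6 + 16 adds the bounds on [|a|] and [b ^+ 2]; 7 * 22 = 154 is the factor in
   [whirl_const]. *)
rewrite [leRHS](_ : _ = 7 * m ^+ 2 * (22 * k ^+ 2 * t ^+ 2 * w)); last by ring.
rewrite ler_wpM2l ?mulr_ge0 ?sqr_ge0//.
lra.
Qed.
End twist_kernel.

(** * The cut-off rotation as an admissible flow *)

Section Ck.
Context {R : realType} {V : normedModType R}.

Lemma Ck_on_continuous (W : normedModType R) k (f : V -> W) :
  Ck_on k setT f -> continuous f.
Proof.
case: k => [h x|k [h _] x]; first exact: h.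
exact/differentiable_continuous/h.
Qed.

Lemma Ck_onS (W : normedModType R) k (f : V -> W) :
  Ck_on k.+1 setT f -> Ck_on k setT f.
Proof.
elim: k f => [f h x _|k IH f [df hf]]; first exact: (Ck_on_continuous h).
by split => // v; apply: IH; exact: hf.
Qed.

Lemma Ck_on_cst (W : normedModType R) k (w : W) :
  Ck_on k setT (cst w : V -> W).
Proof.
elim: k w => [w x _|k IH w]; first exact: cst_continuous.
split=> [x _|v]; first exact: differentiable_cst.
have -> : (fun x => 'D_v (cst w) x) = cst 0; last exact: IH.
by apply/funext => x; rewrite derive_cst.
Qed.

Lemma Ck_on_linear (W : normedModType R) k (f : {linear V -> W}) :
  continuous f -> Ck_on k setT f.
Proof.
case: k => [h x _|k h]; first exact: h.
split=> [x _|v]; first exact: linear_differentiable.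
have -> : (fun x => 'D_v f x) = cst (f v); last exact: Ck_on_cst.
by apply/funext => x; rewrite deriveE ?diff_lin//; exact: linear_differentiable.
Qed.

Lemma Ck_onD (W : normedModType R) k (f g : V -> W) :
  Ck_on k setT f -> Ck_on k setT g -> Ck_on k setT (fun x => f x + g x).
Proof.
elim: k f g => [f g hf hg x _|k IH f g [df hf] [dg hg]].
  by apply: continuousD; [exact: hf|exact: hg].
split=> [x _|v]; first by apply: differentiableD; [exact: df|exact: dg].
have -> : (fun x => 'D_v (fun x => f x + g x) x) = fun x => 'D_v f x + 'D_v g x.
  apply/funext => x; rewrite -deriveD//; apply: diff_derivable;
  [exact: df|exact: dg].
exact: (IH _ _ (hf v) (hg v)).
Qed.

Lemma Ck_onM k (f g : V -> R) :
  Ck_on k setT f -> Ck_on k setT g -> Ck_on k setT (fun x => f x * g x).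
Proof.
elim: k f g => [f g hf hg x _|k IH f g /[dup] fS [df hf] /[dup] gS [dg hg]].
  by apply: continuousM; [exact: hf|exact: hg].
split=> [x _|v]; first by apply: differentiableM; [exact: df|exact: dg].
have -> : (fun x => 'D_v (fun x => f x * g x) x) =
    fun x => f x * 'D_v g x + g x * 'D_v f x.
  apply/funext => x; rewrite (deriveM (f := f))//; apply: diff_derivable;
  [exact: df|exact: dg].
by apply: Ck_onD; apply: IH; [exact: Ck_onS|exact: hg|exact: Ck_onS|exact: hf].
Qed.

Lemma Ck_onZl (W : normedModType R) k (f : V -> R) (w : W) :
  Ck_on k setT f -> Ck_on k setT (fun x => f x *: w).
Proof.
elim: k f => [f hf x _|k IH f [df hf]].
  by apply: continuousZl; exact: hf.
split=> [x _|v]; first by apply: differentiableZl; exact: df.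
have -> : (fun x => 'D_v (fun x => f x *: w) x) = fun x => 'D_v f x *: w.
  apply/funext => x; rewrite !deriveE ?diffZl//; try exact: df.
  by apply: differentiableZl; exact: df.
exact: (IH _ (hf v)).
Qed.

Lemma Ck_on_sum (W : normedModType R) k n (f : 'I_n -> V -> W) :
  (forall i, Ck_on k setT (f i)) -> Ck_on k setT (fun x => \sum_i f i x).
Proof.
move=> hf; elim: n f hf => [f _|n IH f hf].
  rewrite (_ : (fun _ => _) = cst 0); first exact: Ck_on_cst.
  by apply/funext => x; rewrite big_ord0.
rewrite (_ : (fun _ => _) = fun x => f ord0 x + \sum_i f (lift ord0 i) x).
  by apply: Ck_onD => //; exact: IH.
by apply/funext => x; rewrite big_ord_recl.
Qed.

Lemma Ck_on_comp k (h : R -> R) (f : V -> R) :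
  Ck_on k setT h -> Ck_on k setT f -> Ck_on k setT (h \o f).
Proof.
elim: k h f => [h f hh hf x _|k IH h f [dh hh] /[dup] fS [df hf]].
  by apply: continuous_comp; [exact: hf|exact: hh].
split=> [x _|v]; first by apply: differentiable_comp; [exact: df|exact: dh].
have -> : (fun x => 'D_v (h \o f) x) = fun x => ((fun y => 'D_1 h y) \o f) x * 'D_v f x.
  apply/funext => x; have dfx := df x I; have dhx := dh (f x) I.
  rewrite (deriveE _ (differentiable_comp dfx dhx)) (diff_comp dfx dhx)/=.
  rewrite (deriveE _ dfx) (deriveE _ dhx); set a := 'd f x v.
  have /= := linearZ_LR ('d h (f x)) a (1 : R).
  by rewrite [a *: 1]mulr1 [_ *: _]mulrC.
by apply: Ck_onM; [apply: IH; [exact: hh|exact: Ck_onS]|exact: hf].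
Qed.

End Ck.

Section pos_pow.
Context {R : realType}.

Definition pos_pow n (x : R) : R := Num.max 0 x ^+ n.

Lemma pos_pow_ge n (x : R) : 0 <= x -> pos_pow n x = x ^+ n.
Proof. by move=> x0; rewrite /pos_pow; congr (_ ^+ _); apply/max_idPr. Qed.

Lemma pos_pow_le n (x : R) : x <= 0 -> pos_pow n.+1 x = 0.
Proof. by move=> x0; rewrite /pos_pow (_ : Num.max 0 x = 0) ?expr0n//; apply/max_idPl. Qed.

Lemma continuous_pos_pow n : continuous (pos_pow n).
Proof.
move=> x; have -> : pos_pow n = (fun y => y ^+ n) \o (cst 0 \max id) by [].
apply: continuous_comp; last exact: exprn_continuous.
by apply: continuous_max; [exact: cvg_cst|exact: cvg_id].
Qed.

Lemma is_derive_pos_pow n (x : R) :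
  is_derive x 1 (pos_pow n.+2) (n.+2%:R * pos_pow n.+1 x).
Proof.
have [x0|x0|->] := ltgtP x 0.
- rewrite pos_pow_le ?ltW// mulr0; apply: (@near_eq_is_derive _ _ _ (cst 0)).
  by near=> y; rewrite /cst pos_pow_le// ltW//; near: y; exact: lt_nbhsl.
- rewrite pos_pow_ge ?ltW//.
  have dX : is_derive x (1 : R) (fun y : R => y ^+ n.+2) (n.+2%:R * x ^+ n.+1).
    apply: DeriveDef; first exact: exprn_derivable.
    by rewrite exp_derive /= [_ *: 1]mulr1.
  apply: near_eq_is_derive dX.
  near=> y; have y0 : 0 < y by near: y; exact: lt_nbhsr.
  by rewrite pos_pow_ge//; exact: ltW.
- have -> : n.+2%:R * pos_pow n.+1 (0 : R) = 0 by rewrite pos_pow_le// mulr0.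
  have cv : (fun h : R => h^-1 *: (pos_pow n.+2 (h *: 1 + 0) - pos_pow n.+2 (0:R)))
      @ 0^' --> (0 : R).
    have c0 : pos_pow n.+1 h @[h --> (0:R)^'] --> (0 : R).
      have h : pos_pow n.+1 h @[h --> (0:R)] --> pos_pow n.+1 (0:R).
        exact: continuous_pos_pow.
      rewrite pos_pow_le// in h.
      exact: cvg_trans (cvg_app _ (@nbhs_dnbhs _ _)) h.
    apply: cvg_trans c0; apply: near_eq_cvg; near=> h.
    have h0 : h != 0 by near: h; exact: nbhs_dnbhs_neq.
    rewrite addr0 [h *: 1]mulr1 [pos_pow _ 0]pos_pow_le// subr0.
    have [hp|hn] := leP 0 h; last by rewrite !pos_pow_le ?ltW// scaler0.
    have e : h^-1 * h ^+ n.+2 = h ^+ n.+1 by rewrite exprS mulrA mulVf ?mul1r.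
    by rewrite !pos_pow_ge//; exact: esym e.
  apply: DeriveDef; first exact: (cvgP _ cv).
  exact: (cvg_lim _ cv).
Unshelve. all: by end_near. Qed.

Lemma Ck_on_pos_pow k n : (k < n)%N -> Ck_on k setT (pos_pow n).
Proof.
elim: k n => [n _ x _|k IH [//|[//|n]] kn]; first exact: continuous_pos_pow.
have d (x : R) : is_derive x (1 : R) (pos_pow n.+2) (n.+2%:R * pos_pow n.+1 x).
  exact: is_derive_pos_pow.
have df (x : R) : differentiable (pos_pow n.+2) x.
  by apply/derivable1_diffP; exact: ex_derive.
split=> [x _|v]; first exact: df.
have -> : (fun x => 'D_v (pos_pow n.+2) x) =
    fun x => cst (v * n.+2%:R) x * pos_pow n.+1 x.
  apply/funext => x; rewrite (deriveE _ (df x)).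
  have h := linearZ_LR ('d (pos_pow n.+2) x) v (1 : R).
  rewrite [v *: 1]mulr1 /= in h; rewrite h -(deriveE _ (df x)) (@derive_val _ _ _ _ _ _ _ (d x)).
  by rewrite /cst -mulrA.
by apply: Ck_onM; [exact: Ck_on_cst|apply: IH].
Qed.

End pos_pow.

(** * Switching the field off in time *)

Section time_cutoff.
Context {R : realType}.

(* A third difference of truncated powers of degree [n]; for [n = 3] it increases from
   [0] on [s <= 0] to [6] on [3 <= s]. *)
Definition pos_pow_diff n (s : R) : R :=
  pos_pow n s - 3 * pos_pow n (s - 1) + 3 * pos_pow n (s - 2) - pos_pow n (s - 3).

(** Equal to 1 for [|t| <= 1/8] and to 0 for [|t| >= 1/2]: the field needs compact support in time,
    yet must generate the unmodified twist at small times. *)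
Definition time_cutoff (t : R) : R :=
  (pos_pow_diff 3 (8 * t + 4) - pos_pow_diff 3 (8 * t - 1)) / 6.

(** The primitive of [time_cutoff] vanishing at 0: 192 = 6 * 4 * 8 accounts for the derivative of
    fourth powers of [8 * t + c], and 5/16 is the value to subtract at 0. *)
Definition time_primitive (t : R) : R :=
  (pos_pow_diff 4 (8 * t + 4) - pos_pow_diff 4 (8 * t - 1)) / 192 - 5 / 16.

Lemma pos_pow_diff_le n (s : R) : s <= 0 -> pos_pow_diff n.+1 s = 0.
Proof.
move=> s0; rewrite /pos_pow_diff !pos_pow_le; lra.
Qed.

Lemma pos_pow_diff_ge n (s : R) : 3 <= s -> pos_pow_diff n s =
  s ^+ n - 3 * (s - 1) ^+ n + 3 * (s - 2) ^+ n - (s - 3) ^+ n.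
Proof. by move=> s3; rewrite /pos_pow_diff !pos_pow_ge//; lra. Qed.

Lemma time_primitiveE t : `|t| <= 8^-1 -> time_primitive t = t.
Proof.
rewrite ler_norml => /andP[t1 t2]; rewrite /time_primitive.
rewrite [pos_pow_diff 4 (_ - 1)]pos_pow_diff_le; last by lra.
rewrite pos_pow_diff_ge; last by lra.
by field.
Qed.

Lemma time_cutoff_supp t : 2^-1 < `|t| -> time_cutoff t = 0.
Proof.
rewrite /time_cutoff => ht; have [t0|t0] := leP 0 t.
  by rewrite ger0_norm// in ht; rewrite !pos_pow_diff_ge; lra.
by rewrite ltr0_norm// in ht; rewrite !pos_pow_diff_le; lra.
Qed.

Lemma is_derive_affine (a b t : R) : is_derive t (1 : R) (fun u : R => a * u + b) a.
Proof. by apply: is_derive_eq; rewrite /GRing.scale/= mulr1 addr0. Qed.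

Lemma is_derive_time_primitive t :
  is_derive t (1 : R) time_primitive (time_cutoff t).
Proof.
have d c : is_derive t (1 : R) (fun u : R => pos_pow 4 (8 * u + c))
    (32 * pos_pow 3 (8 * t + c)).
  have := is_derive1_comp (f := pos_pow 4) (g := fun u : R => 8 * u + c)
    (is_derive_pos_pow 2 (8 * t + c)) (is_derive_affine 8 c t).
  by move=> h; apply: is_derive_eq h _; rewrite mulrAC; congr (_ * _); rewrite -natrM.
pose F c (u : R) := pos_pow 4 (8 * u + c) - 3 * pos_pow 4 (8 * u + (c - 1)) +
  3 * pos_pow 4 (8 * u + (c - 2)) - pos_pow 4 (8 * u + (c - 3)).
have dF c : is_derive t (1 : R) (F c) (32 * pos_pow_diff 3 (8 * t + c)).
  apply: is_derive_eq; rewrite /pos_pow_diff -!addrA.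
  rewrite /GRing.scale/=; ring.
have -> : time_primitive = fun u => (F 4 u - F (- 1) u) * 192^-1 + - (5 / 16).
  by apply/funext => u; rewrite /time_primitive /F /pos_pow_diff !addrA.
apply: is_derive_eq; rewrite /time_cutoff.
by rewrite /GRing.scale/=; field.
Qed.

Lemma Ck_on_affine k (a b : R) : Ck_on k setT (fun u : R => a * u + b).
Proof.
apply: Ck_onD; last exact: Ck_on_cst.
apply: Ck_onM; first exact: Ck_on_cst.
by apply: (@Ck_on_linear _ _ _ _ idfun) => x; exact: cvg_id.
Qed.

Lemma Ck_on_time_cutoff : Ck_on 2 setT time_cutoff.
Proof.
have h c : Ck_on 2 setT (fun u : R => pos_pow 3 (8 * u + c)).
  apply: (@Ck_on_comp _ _ _ (pos_pow 3)); last exact: Ck_on_affine.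
  exact: Ck_on_pos_pow.
pose F c (u : R) := pos_pow 3 (8 * u + c) + (-3) * pos_pow 3 (8 * u + (c - 1)) +
  3 * pos_pow 3 (8 * u + (c - 2)) + (-1) * pos_pow 3 (8 * u + (c - 3)).
have hF c : Ck_on 2 setT (F c).
  have hM b e : Ck_on 2 setT (fun u : R => b * pos_pow 3 (8 * u + e)).
    by apply: Ck_onM => //; exact: Ck_on_cst.
  apply: (@Ck_onD _ _ _ _ (fun u => _ + _ + _)) => //.
  by apply: (@Ck_onD _ _ _ _ (fun u => _ + _)) => //; exact: Ck_onD.
have -> : time_cutoff = fun u => (F 4 u + (-1) * F (- 1) u) * 6^-1.
  by apply/funext => u; rewrite /time_cutoff /F /pos_pow_diff !addrA; field.
apply: Ck_onM; last exact: Ck_on_cst.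
apply: (@Ck_onD _ _ _ _ (F 4) (fun u => -1 * F (- 1) u) (hF 4)).
by apply: (@Ck_onM _ _ _ (cst (- 1)) (F (- 1))); [exact: Ck_on_cst|exact: hF].
Qed.

Lemma Ck_on_cutoff : Ck_on 2 setT (@cutoff R).
Proof.
have h a b : Ck_on 2 setT (fun u : R => pos_pow 3 (a * u + b)).
  apply: (@Ck_on_comp _ _ _ (pos_pow 3)); last exact: Ck_on_affine.
  exact: Ck_on_pos_pow.
have -> : @cutoff R = fun u => 1 + (- 1) * (pos_pow 3 (1 + (-1) * pos_pow 3 (- 1 * u + 2))).
  apply/funext => u; rewrite /cutoff mulN1r; congr (1 - _).
  by rewrite mulN1r /pos_cube /pos_pow mulN1r [2 - u]addrC.
apply: Ck_onD; first exact: Ck_on_cst.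
apply: Ck_onM; first exact: Ck_on_cst.
apply: (@Ck_on_comp _ _ _ (pos_pow 3)); first exact: Ck_on_pos_pow.
apply: Ck_onD; first exact: Ck_on_cst.
by apply: Ck_onM => //; exact: Ck_on_cst.
Qed.

End time_cutoff.

(** * The rotating field and its flow *)

Section field.
Context {R : realType} {N : nat}.
Local Notation V := 'rV[R]_N.

Lemma Ck_on_space_coord k (i : 'I_N) : Ck_on k setT (fun z : V * R => z.1 ord0 i).
Proof.
have lin : linear (fun z : V * R => z.1 ord0 i) by move=> a x y; rewrite !mxE.
pose L : {linear (V * R)%type -> R} := HB.pack (fun z : V * R => z.1 ord0 i)
  (GRing.isLinear.Build _ _ _ _ _ lin).
apply: (@Ck_on_linear _ _ _ k L) => z.
apply: (@continuous_comp _ _ _ fst (fun x : V => x ord0 i)); first exact: cvg_fst.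
exact: coord_continuous.
Qed.

Lemma Ck_on_time k : Ck_on k setT (fun z : V * R => z.2).
Proof.
by apply: (@Ck_on_linear _ _ _ k snd) => z; exact: cvg_snd.
Qed.

Context (i j : 'I_N).

Definition whirl_field (rho : R) (p : V) (z : V * R) : V :=
  (time_cutoff z.2 * angle rho (z.1 - p) * (z.1 ord0 i - p ord0 i)) *: delta_mx ord0 j -
  (time_cutoff z.2 * angle rho (z.1 - p) * (z.1 ord0 j - p ord0 j)) *: delta_mx ord0 i.

Lemma Ck_on_whirl_field rho p : Ck_on 2 setT (whirl_field rho p).
Proof.
have c k : Ck_on 2 setT (fun z : V * R => z.1 ord0 k - p ord0 k).
  by apply: Ck_onD; [exact: Ck_on_space_coord|exact: Ck_on_cst].
have a : Ck_on 2 setT (fun z : V * R => angle rho (z.1 - p)).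
  apply: (@Ck_on_comp _ _ _ (@cutoff R)); first exact: Ck_on_cutoff.
  apply: Ck_onM; last exact: Ck_on_cst.
  apply: Ck_on_sum => k.
  have -> : (fun z : V * R => (z.1 - p) ord0 k ^+ 2) =
    fun z => (z.1 ord0 k - p ord0 k) * (z.1 ord0 k - p ord0 k).
    by apply/funext => z; rewrite !mxE expr2.
  exact: Ck_onM.
have t : Ck_on 2 setT (fun z : V * R => time_cutoff z.2).
  apply: (@Ck_on_comp _ _ _ time_cutoff); first exact: Ck_on_time_cutoff.
  exact: Ck_on_time.
have -> : whirl_field rho p = fun z : V * R =>
  (time_cutoff z.2 * angle rho (z.1 - p) * (z.1 ord0 i - p ord0 i)) *: (delta_mx ord0 j : V) +
  (time_cutoff z.2 * angle rho (z.1 - p) * (z.1 ord0 j - p ord0 j)) *: (- (delta_mx ord0 i : V)).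
  by apply/funext => z; rewrite scalerN.
have f k : Ck_on 2 setT (fun z : V * R =>
    time_cutoff z.2 * angle rho (z.1 - p) * (z.1 ord0 k - p ord0 k)).
  exact: (Ck_onM (Ck_onM t a) (c k)).
exact: (Ck_onD (Ck_onZl _ (f i)) (Ck_onZl _ (f j))).
Qed.

Definition whirl_flow (rho : R) (p : V) (t : R) (x : V) : V :=
  p + whirl i j rho (time_primitive t) (x - p).

Hypothesis ji : j != i.

Lemma is_derive_rV (f : R -> V) (t : R) (d : V) :
  (forall k, is_derive t (1 : R) (fun u => f u ord0 k) (d ord0 k)) ->
  is_derive t (1 : R) f d.
Proof.
move=> h; have df : derivable f t 1.
  by apply/derivable_mxP => k l; rewrite [k]ord1; exact: (@ex_derive _ _ _ _ _ _ _ (h l)).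
apply: DeriveDef => //; rewrite derive_mx//; apply/rowP => l; rewrite mxE.
exact: (@derive_val _ _ _ _ _ _ _ (h l)).
Qed.

(** The angle function is constant along each trajectory, so the equation reduces to a rotation at
    angular speed [time_cutoff] times a constant, which [time_primitive] integrates. *)
Lemma is_flow_whirl rho p : is_flow (whirl_field rho p) (whirl_flow rho p).
Proof.
move=> x; split.
  rewrite /whirl_flow time_primitiveE ?normr0 ?invr_ge0//.
  by rewrite /whirl mul0r plane_rot0 addrC subrK.
move=> t; have ang u : angle rho (whirl_flow rho p u x - p) = angle rho (x - p).
  by rewrite /whirl_flow addrC addKr angle_rot.
set a := angle rho (x - p) in ang.
have dth : is_derive t (1 : R) (fun u => time_primitive u * a) (time_cutoff t * a).
  have := is_derive_time_primitive t => dt.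
  by apply: is_derive_eq; rewrite scaler0 add0r /GRing.scale/= mulrC.
have dc : is_derive t (1 : R) (fun u => cos (time_primitive u * a))
    (- sin (time_primitive t * a) * (time_cutoff t * a)).
  exact: (is_derive1_comp (f := @cos R) (is_derive_cos _) dth).
have ds : is_derive t (1 : R) (fun u => sin (time_primitive u * a))
    (cos (time_primitive t * a) * (time_cutoff t * a)).
  exact: (is_derive1_comp (f := @sin R) (is_derive_sin _) dth).
have ij : (i == j) = false by rewrite eq_sym (negbTE ji).
apply: is_derive_rV => k; rewrite /whirl_field ang !mxE !eqxx (negbTE ji)/= -/a.
set y1 := x ord0 i - p ord0 i; set y2 := x ord0 j - p ord0 j.
have [->|ki] := eqVneq k i.
  have -> : (fun u => whirl_flow rho p u x ord0 i) = fun u : R =>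
      p ord0 i + (cos (time_primitive u * a) * y1 - sin (time_primitive u * a) * y2).
    by apply/funext => u; rewrite !mxE eqxx.
  by apply: is_derive_eq; rewrite ij /GRing.scale/=; ring.
have [->|kj] := eqVneq k j.
  have -> : (fun u => whirl_flow rho p u x ord0 j) = fun u : R =>
      p ord0 j + (sin (time_primitive u * a) * y1 + cos (time_primitive u * a) * y2).
    by apply/funext => u; rewrite !mxE eqxx (negbTE ji).
  by apply: is_derive_eq; rewrite ?eqxx ?(negbTE ji) /GRing.scale/=; ring.
have -> : (fun u => whirl_flow rho p u x ord0 k) = cst (x ord0 k).
  by apply/funext => u; rewrite !mxE (negbTE ki) (negbTE kj) addrC subrK.
by apply: is_derive_eq; rewrite /= !mulr0 subrr.
Qed.

Lemma compact_eball (p : V) (r : R) : compact [set x : V | enorm (x - p) <= r].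
Proof.
apply: bounded_closed_compact.
  exists (`|p| + `|r|); split; first by rewrite num_real.
  move=> M hM x /= xr; apply: le_trans (ltW hM).
  rewrite -[x](subrK p); apply: le_trans (ler_normD _ _) _; rewrite addrC lerD2l.
  rewrite [leLHS]/Num.Def.normr/= mx_normrE; apply: bigmax_le => // -[k l] _ /=.
  by rewrite [k]ord1 (le_trans (coord_enorm _ _))// (le_trans xr)// ler_norm.
have -> : [set x : V | enorm (x - p) <= r] =
    (fun x => enorm (x - p)) @^-1` [set y | y <= r] by [].
apply: closed_comp; last exact: closed_le.
move=> x _; rewrite /enorm; apply: (@continuous_comp _ _ _ (fun x : V => \sum_(k < N) (x - p) ord0 k ^+ 2) Num.sqrt).
  apply: (@Ck_on_continuous _ _ _ 0); apply: Ck_on_sum => k y _.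
  have -> : (fun x : V => (x - p) ord0 k ^+ 2) = (fun y => y ^+ 2) \o (fun x : V => x ord0 k - p ord0 k).
    by apply/funext => z; rewrite !mxE.
  apply: continuous_comp; last exact: exprn_continuous.
  have hc : {for y, continuous (fun x : V => x ord0 k)} by exact: coord_continuous.
  by apply: continuousB; [exact: hc|exact: cst_continuous].
exact: sqrt_continuous.
Qed.

Lemma admissible_whirl_field (U : set V) rho p : 0 < rho ->
  [set x | enorm (x - p) <= 2 * rho] `<=` U ->
  admissible_field U (whirl_field rho p).
Proof.
move=> r0 sU.
pose S : set (V * R) := [set x | enorm (x - p) <= 2 * rho] `*` `[- 2^-1, 2^-1]%classic.
have cS : compact S by apply: compact_setX; [exact: compact_eball|exact: segment_compact].
have clS : closed S by apply: compact_closed => //; exact: norm_hausdorff.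
have fS : fsupport (whirl_field rho p) `<=` S.
  rewrite /fsupport ((closure_id S).1 clS).
  apply: closure_subset => -[x t] /= h; split => /=.
    rewrite leNgt; apply/negP => /(angle_supp r0) a0.
    by move/eqP: h; apply; rewrite /whirl_field a0 !(mulr0, mul0r) !scale0r subrr.
  rewrite in_itv/= -ler_norml leNgt; apply/negP => /time_cutoff_supp t0.
  by move/eqP: h; apply; rewrite /whirl_field t0 !(mulr0, mul0r) !scale0r subrr.
split; first exact: Ck_on_whirl_field.
  by apply: subclosed_compact cS fS; exact: closed_closure.
move=> z /fS[/= z1 z2]; split; first exact: sU.
by move: z2; rewrite /= !in_itv/= => /andP[? ?]; lra.
Qed.

End field.

(** * Stability under rotations *)

HB.instance Definition _ (R : realType) (N : nat) :=
  @isSFinite.Build _ (lebesgue_space R N) R (@lebesgueN R N)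
    (sfinite_measure_sigma_finite (@lebesgueN_sigma_finite R N)).

(** * Integrals over pairs of points *)

Section pair_integral.
Context {R : realType} {N : nat}.
Local Notation V := 'rV[R]_N.
Local Notation L := (lebesgue_space R N).
Local Notation mu := (@lebesgueN R N).
Local Notation mu2 := (@lebesgueN R N \x @lebesgueN R N)%E.
Implicit Types (E F U : set V) (s : R).

Lemma measurable_esq : measurable_fun setT (@esq R N : L -> R).
Proof.
by apply: measurable_sum => k; apply: measurable_funX; exact: measurable_coord.
Qed.

Lemma measurable_angle rho : measurable_fun setT (@angle R N rho : L -> R).
Proof.
have h (f : L -> R) (a : R) : measurable_fun setT f -> measurable_fun setT (fun x => a - f x).
  by move=> mf; apply: measurable_funB => //; exact: measurable_cst.
have m (f : L -> R) : measurable_fun setT f -> measurable_fun setT (fun x => pos_cube (f x)).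
  move=> mf; apply: measurable_funX.
  have -> : (fun x => Num.max 0 (f x)) = cst 0 \max f by [].
  by apply: measurable_maxr => //; exact: measurable_cst.
apply: (h (fun x => _)); apply: (m (fun x => _)); apply: (h (fun x => _)).
apply: (m (fun x => _)); apply: (h (fun x => _)).
by apply: measurable_funM; [exact: measurable_esq|exact: measurable_cst].
Qed.

Lemma measurable_enorm_sub :
  measurable_fun setT (fun z : L * L => enorm ((z.1 : V) - z.2)).
Proof.
have -> : (fun z : L * L => enorm ((z.1 : V) - z.2)) =
    fun z => (\sum_(k < N) ((z.1 : V) ord0 k - (z.2 : V) ord0 k) ^+ 2) `^ 2^-1.
  apply/funext => z; rewrite powR12_sqrt; last by apply: sumr_ge0 => k _; exact: sqr_ge0.
  by rewrite /enorm; congr Num.sqrt; apply: eq_bigr => k _; rewrite !mxE.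
apply: (measurableT_comp (measurable_powR _)).
apply: measurable_sum => k; apply: measurable_funX; apply: measurable_funB.
  by apply: (measurableT_comp (measurable_coord k)); exact: measurable_fst.
by apply: (measurableT_comp (measurable_coord k)); exact: measurable_snd.
Qed.

Lemma measurable_frac_kernel s :
  measurable_fun setT (fun z : L * L => frac_kernel s (z.1 : V) z.2).
Proof.
have -> : (fun z : L * L => frac_kernel s (z.1 : V) z.2) =
    (fun z => enorm ((z.1 : V) - z.2) `^ (- (N%:R + s))).
  by apply/funext => z; rewrite powRN.
by apply: (measurableT_comp (measurable_powR _)); exact: measurable_enorm_sub.
Qed.

Lemma measurable_far_weight rho :
  measurable_fun setT (fun z : L * L => far_weight rho (z.1 : V) z.2).
Proof.
have -> : (fun z : L * L => far_weight rho (z.1 : V) z.2) =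
    cst 1 \min (fun z => rho * enorm ((z.1 : V) - z.2) `^ (- 1)).
  by apply/funext => z; rewrite /= powR_inv1// enorm_ge0.
apply: measurable_minr; first exact: measurable_cst.
apply: measurable_funM; first exact: measurable_cst.
by apply: (measurableT_comp (measurable_powR _)); exact: measurable_enorm_sub.
Qed.

Lemma frac_kernel_ge0 s (x y : V) : 0 <= frac_kernel s x y.
Proof. by rewrite invr_ge0 powR_ge0. Qed.

Lemma measurable_fst_set (A : set V) : measurable (A : set L) ->
  measurable ([set z | A z.1] : set (L * L)).
Proof.
move=> mA; have -> : [set z | A z.1] = (@fst V V) @^-1` A by [].
by rewrite -[X in measurable X]setTI; apply: (@measurable_fst _ _ L L).
Qed.

Lemma measurable_snd_set (A : set V) : measurable (A : set L) ->
  measurable ([set z | A z.2] : set (L * L)).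
Proof.
move=> mA; have -> : [set z | A z.2] = (@snd V V) @^-1` A by [].
by rewrite -[X in measurable X]setTI; apply: (@measurable_snd _ _ L L).
Qed.

(** The disjoint union of the two integration domains of [Per_s], which makes the fractional
    perimeter a single integral. *)
Definition cut_pairs E U : set (V * V) :=
  [set z | [/\ E z.1, ~ E z.2 & U z.1 \/ U z.2]].

Lemma mem_cut_pairs E U (x y : V) : ((x, y) \in cut_pairs E U) =
  [&& x \in E, y \notin E & (x \in U) || (y \in U)].
Proof.
apply/idP/idP => [/set_mem[/= Ex Ey Uxy]|/and3P[/set_mem Ex /negP Ey /orP U']].
  by rewrite (mem_set Ex) (memNset Ey)/=; case: Uxy => /mem_set ->; rewrite ?orbT.
apply/mem_set; split => //=; first by move=> /mem_set.
by case: U' => /set_mem; [left|right].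
Qed.

Lemma measurable_cut_pairs E U : measurable (E : set L) -> measurable (U : set L) ->
  measurable (cut_pairs E U : set (L * L)).
Proof.
move=> mE mU.
have -> : cut_pairs E U = [set z | E z.1] `&` [set z | (~` E) z.2] `&`
    ([set z | U z.1] `|` [set z | U z.2]).
  by apply/seteqP; split => z /=; [case|move=> [[]]].
apply: measurableI; first by apply: measurableI;
  [exact: measurable_fst_set|apply: measurable_snd_set; exact: measurableC].
by apply: measurableU; [exact: measurable_fst_set|exact: measurable_snd_set].
Qed.

Definition pair_kernel s (z : V * V) : R := frac_kernel s z.1 z.2.

(** Domains of integration enter as indicator factors of a real integrand, so that comparing
    energies means comparing real functions pointwise. *)
Definition pint (f : V * V -> R) : \bar R := (\int[mu2]_z (f z)%:E)%E.

Lemma measurable_mul_mem (f : V * V -> R) (A : set (V * V)) :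
  measurable_fun setT (f : L * L -> R) -> measurable (A : set (L * L)) ->
  measurable_fun setT ((fun z => f z * (z \in A)%:R) : L * L -> R).
Proof.
move=> mf mA; apply: measurable_funM => //.
exact: (measurable_indic (T := (L * L)%type)).
Qed.

Lemma pint_setE (f : V * V -> R) (A : set (V * V)) :
  (\int[mu2]_(z in A) (f z)%:E)%E = pint (fun z => f z * (z \in A)%:R).
Proof.
rewrite integral_mkcond; apply: eq_integral => z _; rewrite patchE.
by case: ifP => _; rewrite ?mulr1 ?mulr0.
Qed.

Lemma pint_ge0 (f : V * V -> R) : (forall z, 0 <= f z) -> (0 <= pint f)%E.
Proof. by move=> f0; apply: integral_ge0 => z _; rewrite lee_fin. Qed.

Lemma pintD (f g : V * V -> R) :
  (forall z, 0 <= f z) -> measurable_fun setT (f : L * L -> R) ->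
  (forall z, 0 <= g z) -> measurable_fun setT (g : L * L -> R) ->
  pint (fun z => f z + g z) = (pint f + pint g)%E.
Proof.
move=> f0 mf g0 mg; rewrite /pint -ge0_integralD//.
- by move=> z _; rewrite lee_fin.
- exact/measurable_EFinP.
- by move=> z _; rewrite lee_fin.
- exact/measurable_EFinP.
Qed.

Lemma le_pint (f g : V * V -> R) :
  (forall z, 0 <= f z) -> measurable_fun setT (f : L * L -> R) ->
  measurable_fun setT (g : L * L -> R) -> (forall z, f z <= g z) ->
  (pint f <= pint g)%E.
Proof.
move=> f0 mf mg fg; apply: ge0_le_integral => //.
- by move=> z _; rewrite lee_fin.
- exact/measurable_EFinP.
- exact/measurable_EFinP.
- by move=> z _; rewrite lee_fin.
Qed.

Lemma pintZ (k : R) (f : V * V -> R) : 0 <= k ->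
  (forall z, 0 <= f z) -> measurable_fun setT (f : L * L -> R) ->
  pint (fun z => k * f z) = (k%:E * pint f)%E.
Proof.
move=> k0 f0 mf; rewrite /pint -ge0_integralZl//.
- exact/measurable_EFinP.
- by move=> z _; rewrite lee_fin.
Qed.

Lemma pint_rectangle (A B : set V) : measurable (A : set L) -> measurable (B : set L) ->
  pint (fun z => (z \in A `*` B)%:R) = (lebesgue_outer A * lebesgue_outer B)%E.
Proof.
move=> mA mB; have mAB : measurable (A `*` B : set (L * L)) by exact: measurableX.
rewrite /pint (_ : (fun z => _) = (fun z : L * L => (\1_(A `*` B) z)%:E)) //.
rewrite integral_indic// setIT; exact: product_measure1E.
Qed.

Lemma integral_outer_invariant (f g : V -> V) (h : L -> \bar R) :
  cancel f g -> cancel g f -> outer_invariant f ->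
  measurable_fun setT h -> (forall x, (0 <= h x)%E) ->
  (\int[mu]_x h (f x) = \int[mu]_x h x)%E.
Proof.
move=> fK gK hf mh h0; have mf := measurable_outer_invariant fK gK hf.
have := ge0_integral_pushforward mf mu measurableT mh (fun y _ => h0 y).
rewrite preimage_setT => <-.
by apply: eq_measure_integral => A mA _; rewrite /= /pushforward; exact: hf.
Qed.

(** Tonelli's theorem lets the invariance be applied to one variable at a time. *)
Lemma pint_invariant (f g : V -> V) (F : V * V -> R) :
  cancel f g -> cancel g f -> outer_invariant f ->
  (forall z, 0 <= F z) -> measurable_fun setT (F : L * L -> R) ->
  pint (fun z => F (f z.1, f z.2)) = pint F.
Proof.
move=> fK gK hf F0 mF.
have mf := measurable_outer_invariant fK gK hf.
have inv h := @integral_outer_invariant f g h fK gK hf.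
have mFE : measurable_fun setT (fun z : L * L => (F z)%:E) by exact/measurable_EFinP.
have mff : measurable_fun setT (fun z : L * L => (f z.1, f z.2) : L * L).
  by apply: measurable_fun_pair; exact: measurableT_comp.
rewrite /pint fubini_tonelli1; last 2 first.
- exact: (measurableT_comp mFE mff).
- by move=> z; rewrite lee_fin.
rewrite fubini_tonelli1//.
rewrite -[RHS](inv (fubini_F mu (fun z : L * L => (F z)%:E))).
- apply: eq_integral => x _; rewrite /fubini_F /=.
  apply: (inv (fun y => (F (f x, y))%:E)).
    by apply: (measurableT_comp mFE); exact: measurable_pair1.
  by move=> y; rewrite lee_fin.
- exact: measurable_fun_fubini_tonelli_F.
- by move=> x; apply: integral_ge0 => y _; rewrite lee_fin.
Qed.

Lemma pair_kernel_ge0 s z : 0 <= pair_kernel s z.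
Proof. exact: frac_kernel_ge0. Qed.

Lemma Per_sE s E U : measurable (E : set L) -> measurable (U : set L) ->
  Per_s s E U = pint (fun z => pair_kernel s z * (z \in cut_pairs E U)%:R).
Proof.
move=> mE mU; rewrite -pint_setE.
have -> : cut_pairs E U = (E `&` U) `*` ~` E `|` (E `\` U) `*` (~` E `&` U).
  apply/seteqP; split => -[x y] /=; last by case=> [[[? ?] ?]|[[? ?] [? ?]]]; split => //; [left|right].
  move=> [Ex Ey Uxy]; have [Ux|Ux] := pselect (U x); first by left.
  by right; split=> //; case: Uxy.
have mCE : measurable (~` E : set L) by exact: measurableC.
rewrite ge0_integral_setU//.
- by apply: measurableX => //; exact: measurableI.
- by apply: measurableX; [exact: measurableD|exact: measurableI].
- apply: measurable_funTS; apply/measurable_EFinP; exact: measurable_frac_kernel.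
- by move=> z _; rewrite lee_fin pair_kernel_ge0.
- apply/disj_setPS => z [[[_ Uz] _] [[_ nUz] _]]; exact: nUz.
Qed.

(** A pair with first point in [E] minus [F] and second in [F] minus [E] is cut by [E], but neither
    by the union nor by the intersection. Keeping this gain, usually discarded in submodularity, is
    what later measures the displacement of [E]. *)
Lemma Per_s_submodular s E F U : measurable (E : set L) -> measurable (F : set L) ->
  measurable (U : set L) ->
  (Per_s s (E `|` F) U + Per_s s (E `&` F) U +
   pint (fun z => pair_kernel s z * (z \in ((E `\` F) `&` U) `*` (F `\` E))%:R)%R <=
   Per_s s E U + Per_s s F U)%E.
Proof.
move=> mE mF mU.
have mK := measurable_frac_kernel s.
have nn A z : 0 <= pair_kernel s z * (z \in A)%:R by rewrite mulr_ge0 ?pair_kernel_ge0.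
have mUn : measurable (E `|` F : set L) by exact: measurableU.
have mIn : measurable (E `&` F : set L) by exact: measurableI.
rewrite !Per_sE//.
have m1 := measurable_mul_mem mK (measurable_cut_pairs mUn mU).
have m2 := measurable_mul_mem mK (measurable_cut_pairs mIn mU).
have m3 := measurable_mul_mem mK (measurable_cut_pairs mE mU).
have m4 := measurable_mul_mem mK (measurable_cut_pairs mF mU).
have m5 : measurable_fun setT ((fun z => pair_kernel s z *
    (z \in ((E `\` F) `&` U) `*` (F `\` E))%:R) : L * L -> R).
  apply: measurable_mul_mem => //; apply: measurableX; last exact: measurableD.
  by apply: measurableI => //; exact: measurableD.
rewrite -!pintD//; try by move=> z; rewrite addr_ge0.
- apply: le_pint => [z||z|z].
  + by rewrite !addr_ge0.
  + by apply: measurable_funD => //; exact: measurable_funD.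
  + exact: measurable_funD.
  (* With the kernel factored out there remains an inequality between indicators, checked on the 64
     possible memberships of the two points in [E], [F] and [U]. *)
  rewrite -!mulrDr ler_wpM2l ?pair_kernel_ge0// -!natrD ler_nat.
  case: z => x y; rewrite !mem_cut_pairs in_setX !setDE !in_setU !in_setI !in_setC/=.
  by case: (x \in E); case: (y \in E); case: (x \in F); case: (y \in F);
    case: (x \in U); case: (y \in U).
- exact: measurable_funD.
Qed.

End pair_integral.

Section cube.
Context {R : realType} {N : nat}.
Local Notation V := 'rV[R]_N.
Local Notation L := (lebesgue_space R N).

Definition cube (z : V) (r : R) : set V :=
  [set x | forall k, `|x ord0 k - z ord0 k| < r].

Lemma lebesgue_outer_cube (z : V) (r : R) : 0 <= r ->
  (lebesgue_outer (cube z r) <= ((2 * r) ^+ N)%:E)%E.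
Proof.
move=> r0; pose a : V := \row_k (z ord0 k - r); pose b : V := \row_k (z ord0 k + r).
apply: (@le_trans _ _ (lebesgue_outer (box a b))).
  apply: le_lebesgue_outer => x /= h k; have := h k; rewrite !mxE ltr_norml.
  by move=> /andP[? ?]; lra.
apply: le_trans (lebesgue_outer_box _ _) _; rewrite lee_fin /box_vol.
rewrite (eq_bigr (fun=> 2 * r)); first by rewrite prodr_const card_ord.
move=> k _; rewrite !mxE (_ : _ - _ = 2 * r); last by ring.
by apply/max_idPr; rewrite mulr_ge0.
Qed.

Lemma measurable_cube (z : V) (r : R) : measurable (cube z r : set L).
Proof.
have -> : cube z r = obox (\row_k (z ord0 k - r)) (\row_k (z ord0 k + r)).
  by apply/seteqP; split => x h k; have := h k; rewrite !mxE ltr_norml => /andP[? ?]; lra.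
exact: measurable_obox.
Qed.

Lemma eball_sub_cube (z : V) (r : R) : eball z r `<=` cube z r.
Proof.
move=> x /= xr k; apply: le_lt_trans xr.
by have := coord_enorm (x - z) k; rewrite !mxE.
Qed.

Lemma cube_sub_eball (z : V) (r : R) : (0 < N)%N -> cube z r `<=` eball z (N%:R * r).
Proof. by move=> N0 x xr; apply: enorm_lt_coord => // k; rewrite !mxE; exact: xr. Qed.

Lemma measurable_eball (z : V) (r : R) : measurable (eball z r : set L).
Proof.
have m : measurable_fun setT (fun x : L => enorm ((x : V) - z)).
  by apply: (measurableT_comp (measurable_enorm_sub) (pair2_measurable _)).
have -> : eball z r = (fun x : V => enorm (x - z)) @^-1` `]-oo, r[%classic.
  by apply/seteqP; split => x; rewrite /= in_itv.
by rewrite -[X in measurable X]setTI; apply: m.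
Qed.

Lemma measurable_closed_eball (z : V) (r : R) :
  measurable ([set x : V | enorm (x - z) <= r] : set L).
Proof.
have m : measurable_fun setT (fun x : L => enorm ((x : V) - z)).
  by apply: (measurableT_comp (measurable_enorm_sub) (pair2_measurable _)).
have -> : [set x : V | enorm (x - z) <= r] =
    (fun x : V => enorm (x - z)) @^-1` `]-oo, r]%classic.
  by apply/seteqP; split => x; rewrite /= in_itv.
by rewrite -[X in measurable X]setTI; apply: m.
Qed.

End cube.

Section whirl_map.
Context {R : realType} {N : nat} (i j : 'I_N) (ji : j != i).
Local Notation V := 'rV[R]_N.
Local Notation L := (lebesgue_space R N).
Local Notation mu := (@lebesgue_outer R N).
Implicit Types (E U : set V) (s rho t : R) (p : V).

Definition whirl_map rho p t (x : V) : V := p + whirl i j rho t (x - p).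

Definition rot_about p t (x : V) : V := p + plane_rot i j t (x - p).

Lemma whirl_mapK rho p t : cancel (whirl_map rho p t) (whirl_map rho p (- t)).
Proof.
move=> x; rewrite /whirl_map /whirl [p + _ - p]addrC addKr (angle_rot ji) (plane_rot_add ji).
by rewrite mulNr addNr plane_rot0// addrC subrK.
Qed.

Lemma whirl_mapNK rho p t : cancel (whirl_map rho p (- t)) (whirl_map rho p t).
Proof. by move=> x; rewrite -{1}[t]opprK whirl_mapK. Qed.

Lemma outer_invariant_whirl_map rho p t : outer_invariant (whirl_map rho p t).
Proof.
have -> : whirl_map rho p t = (fun x => x + p) \o
    (twist i j (fun x => t * angle rho x) \o (fun x => x + (- p))).
  by apply/funext => x; rewrite /whirl_map /= addrC.
apply: outer_invariant_comp; first exact: outer_invariant_translation.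
apply: outer_invariant_comp; last exact: outer_invariant_translation.
apply: outer_invariant_twist => //.
- by move=> u x; exact: angle_rot.
- by move=> x; case/andP: (cutoff01 (esq x / rho ^+ 2)).
- exact: measurable_angle.
Qed.

Lemma enorm_plane_rot t (x : V) : enorm (plane_rot i j t x) = enorm x.
Proof. by apply: enorm_esq; exact: esq_rot. Qed.

Lemma enorm_whirl_map rho p t x : enorm (whirl_map rho p t x - p) = enorm (x - p).
Proof. by rewrite /whirl_map [p + _]addrC addrK enorm_plane_rot. Qed.

Lemma whirl_map_rot rho p t x : 0 < rho -> enorm (x - p) <= rho ->
  whirl_map rho p t x = rot_about p t x.
Proof.
move=> r0 xr; rewrite /whirl_map /whirl /angle cutoff1 ?mulr1//.
by rewrite ler_pdivrMr ?exprn_gt0// mul1r -enorm_sqr lerXn2r ?nnegrE ?enorm_ge0// ltW.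
Qed.

Lemma whirl_map_image rho p t E :
  whirl_map rho p t @` E = whirl_map rho p (- t) @^-1` E.
Proof.
apply/seteqP; split => [_ [x Ex <-]|x /= Ex]; first by rewrite /= whirl_mapK.
by exists (whirl_map rho p (- t) x) => //; rewrite whirl_mapNK.
Qed.

Lemma measurable_whirl_map_image rho p t E : measurable (E : set L) ->
  measurable (whirl_map rho p t @` E : set L).
Proof.
move=> mE; rewrite whirl_map_image.
exact: cara_preimage (whirl_mapNK _ _ _) (whirl_mapK _ _ _)
  (outer_invariant_whirl_map _ _ _) mE.
Qed.

Lemma whirl_map_dom rho p t U x : 0 < rho ->
  [set x | enorm (x - p) <= 2 * rho] `<=` U -> U (whirl_map rho p t x) <-> U x.
Proof.
move=> r0 sU; have [xr|xr] := leP (enorm (x - p)) (2 * rho).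
  by split=> _; apply: sU; rewrite /= ?enorm_whirl_map.
have -> // : whirl_map rho p t x = x.
by rewrite /whirl_map /whirl (angle_supp r0 xr) mulr0 plane_rot0// addrC subrK.
Qed.

(** Change of variables: the flow preserves volume and maps [U] to itself, so the kernel can be
    moved instead of the set. *)
Lemma Per_s_whirl_map s rho p t E U : 0 < rho ->
  [set x | enorm (x - p) <= 2 * rho] `<=` U ->
  measurable (E : set L) -> measurable (U : set L) ->
  Per_s s (whirl_map rho p t @` E) U =
  pint (fun z => pair_kernel s (whirl_map rho p t z.1, whirl_map rho p t z.2) *
                 (z \in cut_pairs E U)%:R).
Proof.
move=> r0 sU mE mU; have mEt := measurable_whirl_map_image rho p t mE.
rewrite Per_sE// -(pint_invariant (whirl_mapK rho p t) (whirl_mapNK rho p t)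
  (outer_invariant_whirl_map rho p t)); last 2 first.
- by move=> z; rewrite mulr_ge0 ?pair_kernel_ge0.
- by apply: measurable_mul_mem; [exact: measurable_frac_kernel|exact: measurable_cut_pairs].
congr pint; apply/funext => -[x y] /=; congr (_ * _%:R); congr (nat_of_bool _).
rewrite !mem_cut_pairs.
have h (A B : set V) a b : (A a <-> B b) -> (a \in A) = (b \in B).
  by move=> AB; apply/idP/idP; rewrite !in_setE => /AB.
have hE a : (whirl_map rho p t a \in whirl_map rho p t @` E) = (a \in E).
  by apply: h; rewrite whirl_map_image /= whirl_mapK.
have hU a : (whirl_map rho p t a \in U) = (a \in U) by apply: h; exact: whirl_map_dom.
by rewrite !hE !hU.
Qed.

(** The quantity J of the overview, with the far weight. The closed ball of radius [2 * rho]
    contains every point that the flow moves. *)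
Definition cut_energy s rho p E : \bar R :=
  pint (fun z => pair_kernel s z * far_weight rho z.1 z.2 *
    (z \in cut_pairs E [set x | enorm (x - p) <= 2 * rho])%:R).

(** The pointwise second difference integrated over the pairs cut by [E]: the error of order
    [t ^+ 2] only sees pairs with a point in the moving ball. *)
Lemma second_variation s rho p t E U : 0 < s < 1 -> 0 < rho ->
  `|t| <= @whirl_time R N ->
  [set x | enorm (x - p) <= 2 * rho] `<=` U ->
  measurable (E : set L) -> measurable (U : set L) ->
  (Per_s s (whirl_map rho p t @` E) U + Per_s s (whirl_map rho p (- t) @` E) U <=
   2%:E * Per_s s E U + (@whirl_const R N * t ^+ 2)%:E * cut_energy s rho p E)%E.
Proof.
move=> s01 r0 ht sU mE mU; rewrite !Per_s_whirl_map// Per_sE// /cut_energy.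
have mK := @measurable_frac_kernel R N s.
have mw t' : measurable_fun setT (whirl_map rho p t' : L -> L).
  exact: measurable_outer_invariant (whirl_mapK rho p t') (whirl_mapNK rho p t')
    (outer_invariant_whirl_map rho p t').
have mKt t' : measurable_fun setT
    (fun z : L * L => pair_kernel s (whirl_map rho p t' z.1, whirl_map rho p t' z.2)).
  by apply: (measurableT_comp mK); apply: measurable_fun_pair; exact: measurableT_comp.
have mcp := measurable_cut_pairs mE mU.
have mcB := measurable_cut_pairs mE (measurable_closed_eball p (2 * rho)).
have m1 t' := measurable_mul_mem (mKt t') mcp.
have m2 := measurable_mul_mem mK mcp.
have m3 : measurable_fun setT ((fun z => pair_kernel s z * far_weight rho z.1 z.2 *
    (z \in cut_pairs E [set x | enorm (x - p) <= 2 * rho])%:R) : L * L -> R).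
  apply: measurable_mul_mem => //; apply: measurable_funM => //.
  exact: measurable_far_weight.
have C0 : 0 <= @whirl_const R N by rewrite !mulr_ge0// sqr_ge0.
have Ct0 : 0 <= @whirl_const R N * t ^+ 2 by rewrite mulr_ge0// sqr_ge0.
have w0 (x y : V) : 0 <= far_weight rho x y.
  by rewrite /far_weight le_min ler01 divr_ge0 ?(ltW r0) ?enorm_ge0.
have nn1 t' z : 0 <= pair_kernel s (whirl_map rho p t' z.1, whirl_map rho p t' z.2) *
                 (z \in cut_pairs E U)%:R by rewrite mulr_ge0 ?pair_kernel_ge0.
have nn2 z : 0 <= pair_kernel s z * (z \in cut_pairs E U)%:R by rewrite mulr_ge0 ?pair_kernel_ge0.
have nn3 z : 0 <= pair_kernel s z * far_weight rho z.1 z.2 *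
    (z \in cut_pairs E [set x | enorm (x - p) <= 2 * rho])%:R.
  by rewrite !mulr_ge0 ?pair_kernel_ge0.
have nZ (k : R) (f : V * V -> R) : 0 <= k -> (forall z, 0 <= f z) -> forall z, 0 <= k * f z.
  by move=> k0 f0 z; rewrite mulr_ge0.
have mZ (k : R) (f : V * V -> R) : measurable_fun setT (f : L * L -> R) ->
    measurable_fun setT ((fun z => k * f z) : L * L -> R).
  by move=> mf; apply: measurable_funM => //; exact: measurable_cst.
have c2 : (0 : R) <= 2 by [].
rewrite -(pintZ c2 nn2 m2) -(pintZ Ct0 nn3 m3).
rewrite -(pintD (nn1 t) (m1 t) (nn1 (- t)) (m1 (- t))).
rewrite -(pintD (nZ _ _ c2 nn2) (mZ _ _ m2) (nZ _ _ Ct0 nn3) (mZ _ _ m3)).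
apply: le_pint.
- by move=> z; rewrite addr_ge0.
- exact: (measurable_funD (m1 t) (m1 (- t))).
- exact: (measurable_funD (mZ _ _ m2) (mZ _ _ m3)).
move=> [x y] /=.
have shiftE t' : pair_kernel s (whirl_map rho p t' x, whirl_map rho p t' y) =
    frac_kernel s (whirl i j rho t' (x - p)) (whirl i j rho t' (y - p)).
  by rewrite /pair_kernel /frac_kernel /whirl_map /= opprD addrACA subrr add0r.
have kE : frac_kernel s (x - p) (y - p) = pair_kernel s (x, y).
  by rewrite /pair_kernel /frac_kernel /= opprB addrA subrK.
have wE : far_weight rho (x - p) (y - p) = far_weight rho x y.
  by rewrite /far_weight opprB addrA subrK.
have := whirl_second_difference ji (x - p) (y - p) s01 r0 ht.
rewrite -!shiftE kE wE.
rewrite !mem_cut_pairs.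
have mb a : (a \in [set x0 | enorm (x0 - p) <= 2 * rho]) = (enorm (a - p) <= 2 * rho).
  by apply/idP/idP => [/set_mem//|h]; apply/mem_set.
rewrite !mb.
have Wsub : (enorm (x - p) <= 2 * rho) || (enorm (y - p) <= 2 * rho) ->
    (x \in U) || (y \in U).
  by case/orP => /sU /mem_set ->; rewrite ?orbT.
move: Wsub Ct0; have := w0 x y; have := @pair_kernel_ge0 _ _ s (x, y).
set k := pair_kernel s (x, y); set w := far_weight rho x y.
set k1 := pair_kernel s (whirl_map rho p t x, _).
set k2 := pair_kernel s (whirl_map rho p (- t) x, _).
set c := _ * t ^+ 2; clearbody k w k1 k2 c.
rewrite !andbA; move: ((x \in E) && (y \notin E)) ((x \in U) || (y \in U)) => e u.
case: (_ || _) => k0 ww Wsub c0 h; case: e; rewrite /= ?andbF ?andbT.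
- by move: h; rewrite (Wsub isT) !mulr1; lra.
- by rewrite !mulr0; lra.
- by move: h; case: u Wsub => _ /=; rewrite ?mulr1 !mulr0; lra.
- by rewrite !mulr0; lra.
Qed.

End whirl_map.

(* For one time of the flow, [F] is the perimeter of the deformed set, [x] and [y] are those
   of its union and intersection with the original set, and [I] is the interaction gained
   by submodularity; the primed quantities belong to the opposite time. *)
Lemma stability_cancel (R : realType) (P : \bar R) (e b : R)
    (x y I F x' y' I' F' : \bar R) :
  (0 <= P)%E -> (P < +oo)%E -> (0 <= I)%E -> (0 <= I')%E -> (0 <= F)%E -> (0 <= F')%E ->
  (P - e%:E <= x)%E -> (P - e%:E <= y)%E -> (P - e%:E <= x')%E -> (P - e%:E <= y')%E ->
  (x + y + I <= P + F)%E -> (x' + y' + I' <= P + F')%E ->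
  (F + F' <= 2%:E * P + b%:E)%E -> (I <= (b + 4 * e)%:E)%E.
Proof.
case: P => [P| |]// _ _ I0 I'0 F0 F'0 hx hy hx' hy' h h' hF.
have {}hF : (F + F' <= (2 * P + b)%:E)%E by rewrite EFinD EFinM.
(* The bound on [F + F'] makes both finite, and then submodularity makes the remaining terms finite.
   Adding everything, four copies of [P] cancel and the four uses of stability leave [4 * e]. *)
case: F F0 h hF => [F| |]// _ h; case: F' F'0 h' => [F'| |]// _ h' hF.
move: hx hy I0 h; case: x => [x| |]; case: y => [y| |]; case: I => [I| |] //= hx hy I0 h.
move: hx' hy' I'0 h'; case: x' => [x'| |]; case: y' => [y'| |]; case: I' => [I'| |] //= hx' hy' I'0 h'.
by move: I'0 hx hy hx' hy' h h' hF; rewrite -?EFinB -?EFinD !lee_fin; lra.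
Qed.

Section rot_estimate.
Context {R : realType} {N : nat} (i j : 'I_N) (ji : j != i).
Local Notation V := 'rV[R]_N.
Local Notation L := (lebesgue_space R N).
Local Notation mu := (@lebesgue_outer R N).
Implicit Types (E U : set V) (s rho t : R) (p : V).

(** The symmetric difference of [E] and its preimage under [f]; in this form it is subadditive under
    composition of maps. *)
Definition edif E (f : V -> V) : set V := [set x | (x \in E) != (f x \in E)].

Lemma lebesgue_outer_eball_lty p r : (mu (eball p r) < +oo)%E.
Proof.
have [r0|r0] := leP 0 r.
  apply: le_lt_trans (le_lebesgue_outer (@eball_sub_cube _ _ p r)) _.
  by apply: le_lt_trans (lebesgue_outer_cube _ r0) _; rewrite ltry.
suff -> : eball p r = set0 by rewrite lebesgue_outer0 ltry.
rewrite -subset0 => x /= xr; have := le_lt_trans (enorm_ge0 _) xr.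
by rewrite ltNge (ltW r0).
Qed.

(* [eball p rho] is invariant under the flow, so [E] and its image have the same measure
   in it. *)
Lemma whirl_map_setD_eq rho p t E : 0 < rho -> measurable (E : set L) ->
  let F := whirl_map i j rho p t @` E in
  mu ((E `\` F) `&` eball p rho) = mu ((F `\` E) `&` eball p rho).
Proof.
move=> r0 mE F; set B := eball p rho.
have mF : measurable (F : set L) by exact: measurable_whirl_map_image.
have EF : mu (F `&` B) = mu (E `&` B).
  rewrite -(outer_invariant_whirl_map ji rho p (- t) (E `&` B)); congr mu.
  rewrite /F whirl_map_image//; apply/seteqP; split => x [h1 h2]; split => //=;
  by move: h2; rewrite /B /eball /= enorm_whirl_map.
have cE : mu.-caratheodory E := mE; have cF : mu.-caratheodory F := mF.
have := cE (F `&` B); have := cF (E `&` B); rewrite EF => ->.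
have -> : E `&` B `&` F = F `&` B `&` E.
  by apply/seteqP; split=> x [[? ?] ?].
have -> : E `&` B `&` ~` F = (E `\` F) `&` B.
  by apply/seteqP; split=> x [[? ?] ?].
have -> : F `&` B `&` ~` E = (F `\` E) `&` B.
  by apply/seteqP; split=> x [[? ?] ?].
have fin : (mu (F `&` B `&` E) < +oo)%E.
  by apply: le_lt_trans (lebesgue_outer_eball_lty p rho); apply: le_lebesgue_outer => x [[]].
have fn : mu (F `&` B `&` E) \is a fin_num.
  by rewrite ge0_fin_numE//; exact: lebesgue_outer_ge0.
rewrite addeC [RHS]addeC => e.
by rewrite -(addeK (mu ((E `\` F) `&` B)) fn) e addeK.
Qed.

Lemma rot_estimate s rho p E U M : 0 < s < 1 -> 0 < rho ->
  [set x | enorm (x - p) <= 2 * rho] `<=` U ->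
  measurable (E : set L) -> measurable (U : set L) ->
  stable_rearrangement s E U -> 0 < M -> (cut_energy s rho p E <= M%:E)%E ->
  exists2 t0 : R, 0 < t0 & forall t, `|t| < t0 ->
  (mu (eball p rho `&` edif E (rot_about i j p t)) <=
   (`|t| * (2 * Num.sqrt ((2 * rho) `^ (N%:R + s) * ((@whirl_const R N + 4) * M))))%:E)%E.
Proof.
move=> s01 r0 sU mE mU [Pfin stab] M0 JM.
(* Stability with tolerance [M]: its defect then has the same order as the second variation. A
   smaller tolerance would not improve the estimate beyond the constant. *)
have [te [te0 hte]] := stab _ _ (admissible_whirl_field i j r0 sU)
  (is_flow_whirl ji rho p) M M0.
have wt0 : 0 < @whirl_time R N by rewrite divr_gt0// invr_gt0 mulr_gt0// ltr0n.
have e80 : (0 : R) < 8^-1 by rewrite invr_gt0.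
(* Below 1/8 the flow is the twist by the angle [t]; below [whirl_time] the second variation is
   controlled. *)
exists (Num.min te (Num.min 8^-1 (@whirl_time R N))); first by rewrite !lt_min te0 e80.
suff main t : `|t| < Num.min te (Num.min 8^-1 (@whirl_time R N)) ->
    (mu ((E `\` (whirl_map i j rho p t @` E)) `&` eball p rho) <=
     (`|t| * Num.sqrt ((2 * rho) `^ (N%:R + s) * ((@whirl_const R N + 4) * M)))%:E)%E.
  (* [edif] involves the preimage of [E] by the rotation, which is its image at the opposite
     time. *)
  move=> t ht; have {}main := main (- t); rewrite normrN in main; have {}main := main ht.
  set F := whirl_map i j rho p (- t) @` E in main *.
  have sub : eball p rho `&` edif E (rot_about i j p t) `<=`
      ((E `\` F) `&` eball p rho) `|` ((F `\` E) `&` eball p rho).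
    move=> x [xB]; rewrite /edif /= -(whirl_map_rot i j t r0 (ltW xB)).
    have FE : F x <-> E (whirl_map i j rho p t x) by rewrite /F whirl_map_image ?opprK.
    have [Ex|Ex] := pselect (E x); have [Gx|Gx] := pselect (E (whirl_map i j rho p t x)).
    - by rewrite !mem_set ?eqxx.
    - by left; split => //; split => // /FE.
    - by right; split => //; split => //; apply/FE.
    - by rewrite !memNset ?eqxx.
  apply: le_trans (le_lebesgue_outer sub) _.
  apply: le_trans (outer_measureU2 mu _ _) _.
  have main' := main; rewrite (whirl_map_setD_eq p (- t) r0 mE) -/F in main'.
  set S := Num.sqrt _ in main main' *.
  have -> : `|t| * (2 * S) = `|t| * S + `|t| * S by ring.
  by rewrite EFinD; exact: leeD main main'.
move=> ht.
have htn : `|- t| < Num.min te (Num.min 8^-1 (@whirl_time R N)) by rewrite normrN.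
have flowE t' : `|t'| < Num.min te (Num.min 8^-1 (@whirl_time R N)) ->
    whirl_flow i j rho p t' = whirl_map i j rho p t'.
  rewrite !lt_min => /andP[_ /andP[h _]]; apply/funext => x.
  by rewrite /whirl_flow time_primitiveE// ltW.
have st t' : `|t'| < Num.min te (Num.min 8^-1 (@whirl_time R N)) ->
  (Per_s s E U - (M * t' ^+ 2)%:E <= Per_s s (E `|` whirl_map i j rho p t' @` E) U)%E /\
  (Per_s s E U - (M * t' ^+ 2)%:E <= Per_s s (E `&` whirl_map i j rho p t' @` E) U)%E.
  move=> h; have := hte t'; rewrite flowE// => H.
  have {}H := H _; move: h; rewrite lt_min => /andP[h _].
  rewrite ltr_norml in h; have := H h.
  by rewrite le_min setUC setIC => /andP[].
have [u1 u2] := st t ht; have [v1 v2] := st (- t) htn.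
rewrite sqrrN in v1 v2.
have tw : `|t| <= @whirl_time R N by move: ht; rewrite !lt_min => /and3P[_ _ /ltW].
have mF t' : measurable (whirl_map i j rho p t' @` E : set L).
  exact: measurable_whirl_map_image.
have SV := second_variation ji s01 r0 tw sU mE mU.
have sub1 := Per_s_submodular s mE (mF t) mU.
have sub2 := Per_s_submodular s mE (mF (- t)) mU.
set F := whirl_map i j rho p t @` E in u1 u2 SV sub1 *.
set F' := whirl_map i j rho p (- t) @` E in v1 v2 SV sub2 *.
have P0 A : measurable (A : set L) -> (0 <= Per_s s A U)%E.
  by move=> mA; rewrite Per_sE//; apply: pint_ge0 => z; rewrite mulr_ge0 ?pair_kernel_ge0.
have C0 : 0 <= @whirl_const R N by rewrite !mulr_ge0// sqr_ge0.
have SV' : (Per_s s F U + Per_s s F' U <=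
    2%:E * Per_s s E U + (@whirl_const R N * t ^+ 2 * M)%:E)%E.
  apply: le_trans SV _; rewrite leeD2l// [leRHS]EFinM.
  by apply: lee_wpmul2l => //; rewrite lee_fin mulr_ge0// sqr_ge0.
have I0 (A : set (V * V)) : (0 <= pint (fun z => pair_kernel s z * (z \in A)%:R)%R)%E.
  by apply: pint_ge0 => z; rewrite mulr_ge0 ?pair_kernel_ge0.
have key := stability_cancel (P0 _ mE) Pfin (I0 _) (I0 _) (P0 _ (mF t)) (P0 _ (mF (- t)))
  u1 u2 v1 v2 sub1 sub2 SV'.
pose A := (E `\` F) `&` eball p rho; pose A' := (F `\` E) `&` eball p rho.
have mFt : measurable (F : set L) := mF t.
have mEF : measurable (E `\` F : set L) by exact: measurableD.
have mFE : measurable (F `\` E : set L) by exact: measurableD.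
have mB : measurable (eball p rho : set L) by exact: measurable_eball.
have mA : measurable (A : set L) by exact: measurableI.
have mA' : measurable (A' : set L) by exact: measurableI.
have AA' : mu A' = mu A by rewrite /A /A' whirl_map_setD_eq.
(* A lower bound for the kernel between distinct points of the ball, whose diameter is [2 * rho]. *)
pose c := ((2 * rho) `^ (N%:R + s))^-1.
have d0 : 0 < (2 * rho) `^ (N%:R + s) by apply: powR_gt0; rewrite mulr_gt0.
have c0 : 0 < c by rewrite invr_gt0.
have low : (c%:E * (mu A * mu A) <=
   pint (fun z => pair_kernel s z * (z \in ((E `\` F) `&` U) `*` (F `\` E))%:R)%R)%E.
  rewrite -[X in (_ * (_ * X))%E]AA' -pint_rectangle// -pintZ ?(ltW c0)//; last first.
    exact: (measurable_indic (T := (L * L)%type) (measurableX mA mA')).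
  apply: le_pint.
  - by move=> z; rewrite mulr_ge0// ltW.
  - apply: measurable_funM; first exact: measurable_cst.
    exact: (measurable_indic (T := (L * L)%type) (measurableX mA mA')).
  - apply: measurable_mul_mem; first exact: measurable_frac_kernel.
    by apply: measurableX => //; exact: measurableI.
  move=> [x y]; have [|] := boolP ((x, y) \in A `*` A'); last first.
    by rewrite mulr0 mulr_ge0 ?pair_kernel_ge0.
  move=> /set_mem[/= [Ax Bx] [Ay By]].
  have -> : (x, y) \in ((E `\` F) `&` U) `*` (F `\` E).
    apply/mem_set; split => //; split => //; apply: sU => /=.
    by apply: ltW; apply: lt_le_trans Bx _; rewrite ler_peMl ?(ltW r0)// ler1n.
  have s0 : 0 < s by case/andP: s01.
  rewrite !mulr1 /pair_kernel /frac_kernel /c/=.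
  have [/enorm0_eq/eqP|xy] := eqVneq (enorm (x - y)) 0.
    by rewrite subr_eq0 => /eqP xy; case: Ay => + _; case: Ax => _ ; rewrite xy.
  rewrite lef_pV2 ?posrE//; last by rewrite powR_gt0// lt_neqAle eq_sym xy enorm_ge0.
  apply: ge0_ler_powR; rewrite ?nnegrE ?enorm_ge0 ?addr_ge0 ?mulr_ge0 ?(ltW s0) ?(ltW r0)//.
  have -> : x - y = (x - p) - (y - p) by rewrite opprB addrA subrK.
  apply: le_trans (enorm_triangle _ _) _; rewrite -[- (y - p)]add0r [enorm (0 - _)]enorm_sub subr0.
  by move: Bx By; rewrite /eball /= => *; lra.
have := le_trans low key.
have Afin : (mu A < +oo)%E.
  by apply: le_lt_trans (lebesgue_outer_eball_lty p rho); apply: le_lebesgue_outer => x [].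
have A0 : (0 <= mu A)%E by exact: lebesgue_outer_ge0.
rewrite -/A; move: Afin A0; case: (mu A) => [a| |]// _; rewrite -!EFinM !lee_fin => a0.
rewrite /c mulrC ler_pdivrMr// => h.
have tt : t ^+ 2 = `|t| ^+ 2 by rewrite real_normK ?num_real.
rewrite -(@ler_pXn2r _ 2) ?nnegrE ?mulr_ge0 ?sqrtr_ge0// exprMn sqr_sqrtr; last first.
  by rewrite mulr_ge0 ?mulr_ge0 ?addr_ge0 ?(ltW d0) ?(ltW M0).
by move: h; rewrite -tt -expr2; lra.
Qed.

End rot_estimate.

(** * Directional variation and interaction energy *)

Section tv_bound.
Context {R : realType} {N : nat}.
Local Notation V := 'rV[R]_N.
Local Notation L := (lebesgue_space R N).
Local Notation mu := (@lebesgue_outer R N).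
Implicit Types (E S : set V) (K r t : R) (z v w : V).

Definition translate v (x : V) : V := x + v.

Definition axis (k : 'I_N) t : V := t *: delta_mx ord0 k.

(** The total variation of the indicator of [E] in [S] along each axis is at most [K], in terms of
    small translations. The threshold is merely qualitative and may depend on everything, which lets
    thresholds shrink freely without touching constants. *)
Definition tv_bound S E K := exists2 t0 : R, 0 < t0 & forall k t, 0 < t < t0 ->
  (mu (S `&` edif E (translate (axis k t))) <= (K * t)%:E)%E.

(** If [x] and [f (g x)] disagree about [E], then [g x] disagrees with one of them; the second
    possibility is measured after transport by [g]. *)
Lemma edif_comp E (f g : V -> V) S S' (c d : \bar R) :
  (forall x, S x -> S' (g x)) -> outer_invariant g ->
  (mu (S `&` edif E g) <= c)%E -> (mu (S' `&` edif E f) <= d)%E ->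
  (mu (S `&` edif E (f \o g)) <= c + d)%E.
Proof.
move=> gS hg hc hd.
have sub : S `&` edif E (f \o g) `<=` (S `&` edif E g) `|` g @^-1` (S' `&` edif E f).
  move=> x [Sx]; rewrite /edif /= => h.
  have [e|ne] := boolP ((x \in E) == (g x \in E)); last by left.
  by right; split; [exact: gS|rewrite /= -(eqP e)].
apply: le_trans (le_lebesgue_outer sub) _.
apply: le_trans (outer_measureU2 mu _ _) _.
have hd' : (mu (g @^-1` (S' `&` edif E f)) <= d)%E by rewrite hg.
exact: leeD hc hd'.
Qed.

Lemma edif_inv E (f g : V -> V) S S' (c : \bar R) : cancel f g ->
  (forall x, S x -> S' (f x)) -> outer_invariant f ->
  (mu (S' `&` edif E g) <= c)%E -> (mu (S `&` edif E f) <= c)%E.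
Proof.
move=> fK fS hf hc; apply: le_trans hc; rewrite -[leRHS]hf; apply: le_lebesgue_outer.
move=> x [Sx]; rewrite /edif /= => h; split; first exact: fS.
by rewrite /edif /= fK eq_sym.
Qed.

Lemma edif_id E S : mu (S `&` edif E id) = 0%E.
Proof.
suff -> : S `&` edif E id = set0 by rewrite lebesgue_outer0.
by rewrite -subset0 => x [_]; rewrite /edif /= eqxx.
Qed.

Lemma outer_invariant_translate v : outer_invariant (translate v).
Proof. exact: outer_invariant_translation. Qed.

Lemma translateK v : cancel (translate v) (translate (- v)).
Proof. by move=> x; rewrite /translate addrK. Qed.

Lemma translateD v w : translate (v + w) = translate v \o translate w.
Proof. by apply/funext => x; rewrite /translate /= -addrA [w + v]addrC. Qed.

Lemma translate0 : translate 0 = id.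
Proof. by apply/funext => x; rewrite /translate addr0. Qed.

Lemma cube_translate z r r' v : (forall k, `|v ord0 k| <= r') ->
  forall x, cube z r x -> cube z (r + r') (translate v x).
Proof.
move=> vr x xr k; rewrite !mxE addrAC.
by apply: le_lt_trans (ler_normD _ _) _; apply: ltr_leD; [exact: xr|exact: vr].
Qed.

Lemma sub_cube z r r' : r <= r' -> cube z r `<=` cube z r'.
Proof. by move=> rr x xr k; exact: lt_le_trans (xr k) rr. Qed.

Lemma axis_coord k t l : `|axis k t ord0 l| <= `|t|.
Proof. by rewrite !mxE normrM eqxx ler_piMr//; case: (_ == _); rewrite ?normr1 ?normr0. Qed.

Lemma tv_bound_sub S S' E K K' : S `<=` S' -> K <= K' ->
  tv_bound S' E K -> tv_bound S E K'.
Proof.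
move=> SS KK [t0 t00 h]; exists t0 => // k t /andP[t1 t2].
apply: (@le_trans _ _ (K * t)%:E); last by rewrite lee_fin ler_wpM2r// ltW.
by apply: le_trans (h k t _); rewrite ?t1//; apply: le_lebesgue_outer => x [/SS].
Qed.

(** A long translation is a chain of steps [h] below the threshold, whose costs add up to [K * t];
    the larger cube contains the intermediate points. *)
Lemma tv_axis_pos z r E K r' k t : 0 <= K -> tv_bound (cube z (r + r')) E K ->
  0 <= t <= r' ->
  (mu (cube z r `&` edif E (translate (axis k t))) <= (K * t)%:E)%E.
Proof.
move=> K0 [t0 t00 htv] /andP[]; rewrite le_eqVlt => /orP[/eqP <- _|tp tr].
  by rewrite /axis scale0r translate0 edif_id mulr0.
pose n := (Num.truncn (t / t0)).+1; pose h := t / n%:R.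
have n0 : (0 : R) < n%:R by rewrite ltr0n.
have h0 : 0 < h by rewrite divr_gt0.
have ht0 : h < t0.
  rewrite /h ltr_pdivrMr// mulrC -ltr_pdivrMr//.
  by have /andP[] := truncn_itv (ltW (divr_gt0 tp t00)).
have tE : t = n%:R * h by rewrite /h mulrC divfK// gt_eqF.
suff H m s : s + m%:R * h <= r + r' ->
    (mu (cube z s `&` edif E (translate (axis k (m%:R * h)))) <= (K * (m%:R * h))%:E)%E.
  by rewrite tE; apply: H; rewrite -tE lerD2l.
elim: m s => [s _|m IH s hs].
  by rewrite mul0r /axis scale0r translate0 edif_id mulr0.
have -> : axis k (m.+1%:R * h) = axis k (m%:R * h) + axis k h.
  by rewrite /axis -scalerDl -natr1 mulrDl mul1r.
rewrite translateD -natr1 mulrDl mul1r mulrDr EFinD addeC.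
apply: (@edif_comp _ _ _ _ (cube z (s + h))).
- by apply: cube_translate => l; apply: le_trans (axis_coord _ _ _) _; rewrite gtr0_norm.
- exact: outer_invariant_translate.
- apply: le_trans (htv k h _); last by rewrite h0 ht0.
  apply: le_lebesgue_outer => x [xs xe]; split => //.
  apply: sub_cube xs; apply: le_trans hs; rewrite lerDl.
  by rewrite mulr_ge0// ltW.
- by apply: IH; rewrite -natr1 mulrDl mul1r in hs; lra.
Qed.

Lemma tv_axis z r E K r' k t : 0 <= K -> tv_bound (cube z (r + 2 * r')) E K ->
  `|t| <= r' ->
  (mu (cube z r `&` edif E (translate (axis k t))) <= (K * `|t|)%:E)%E.
Proof.
move=> K0 htv tr; have r0 : 0 <= r' := le_trans (normr_ge0 _) tr.
have htv' : tv_bound (cube z (r + r' + r')) E K.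
  by apply: tv_bound_sub (lexx K) htv; apply: sub_cube; lra.
have [t0|t0] := leP 0 t.
  rewrite ger0_norm// in tr *; apply: (@tv_axis_pos _ _ _ _ r') => //; last by rewrite t0.
  by apply: tv_bound_sub (lexx K) htv; apply: sub_cube; lra.
apply: (@edif_inv _ _ (translate (- axis k t)) _ (cube z (r + r'))).
- exact: translateK.
- by apply: cube_translate => l; apply: le_trans (axis_coord _ _ _) _.
- exact: outer_invariant_translate.
rewrite /axis -scaleNr; rewrite ltr0_norm// in tr *.
by apply: (@tv_axis_pos _ _ _ _ r') => //; rewrite tr andbT; lra.
Qed.

(** The coordinates are moved one after another. The displacement already made costs [r'], and a
    signed move along an axis another [2 * r'], hence the margin [3 * r']. *)
Lemma tv_translate z r E K r' v : 0 <= K -> 0 <= r' -> tv_bound (cube z (r + 3 * r')) E K ->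
  (forall k, `|v ord0 k| <= r') ->
  (mu (cube z r `&` edif E (translate v)) <= (N%:R * (K * r'))%:E)%E.
Proof.
move=> K0 r0 htv vr.
pose w (s : seq 'I_N) : V := \row_l (if l \in s then v ord0 l else 0).
have H s : uniq s -> (mu (cube z r `&` edif E (translate (w s))) <=
    (\sum_(k <- s) K * `|v ord0 k|)%:E)%E.
  elim: s => [_|k s IH /= /andP[ks us]].
    have -> : w [::] = 0 by apply/rowP => l; rewrite !mxE.
    by rewrite translate0 edif_id big_nil.
  have -> : w (k :: s) = axis k (v ord0 k) + w s.
    apply/rowP => l; rewrite !mxE inE eqxx /=.
    case: eqP => [->|_]; first by rewrite (negbTE ks) mulr1 addr0.
    by rewrite mulr0 add0r.
  rewrite translateD big_cons EFinD addeC.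
  apply: (@edif_comp _ _ _ _ (cube z (r + r'))).
  - apply: cube_translate => l; rewrite mxE; case: ifP => _; first exact: vr.
    by rewrite normr0.
  - exact: outer_invariant_translate.
  - exact: IH.
  - apply: (@tv_axis _ _ _ _ r') => //.
    by apply: tv_bound_sub (lexx K) htv; apply: sub_cube; lra.
have -> : v = w (enum 'I_N) by apply/rowP => l; rewrite mxE mem_enum.
apply: le_trans (H _ (enum_uniq _)) _; rewrite lee_fin.
rewrite big_enum /=; apply: le_trans (ler_sum _ (fun k _ => ler_wpM2l K0 (vr k))) _.
by rewrite sumr_const card_ord mulr_natl.
Qed.

End tv_bound.

(** * Close pairs separated by the set *)

Section pair_measure.
Context {R : realType} {N : nat}.
Local Notation V := 'rV[R]_N.
Local Notation L := (lebesgue_space R N).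
Local Notation mu := (@lebesgue_outer R N).
Implicit Types (E S G : set V) (K r : R) (z : V).

(* [L * L] carries the product of two completed sigma-algebras, for which addition need
   not be measurable; a measurable set is only shearable up to a null set. *)
Definition shearable G :=
  measurable (G : set L) /\ measurable ([set w : V * V | G (w.1 + w.2)] : set (L * L)).

Lemma shearable_box (a b : V) : shearable (box a b).
Proof.
split; first exact: measurable_box.
have -> : [set w : V * V | box a b (w.1 + w.2)] = \bigcap_(k in [set: 'I_N])
    ((fun w : V * V => w.1 ord0 k + w.2 ord0 k) @^-1` `[a ord0 k, b ord0 k[%classic).
  apply/seteqP; split => w h k; first by move=> _; have := h k; rewrite /= in_itv/= !mxE.
  by have := h k I; rewrite /= in_itv/= !mxE.
apply: fin_bigcap_measurable => // k _; rewrite -[X in measurable X]setTI.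
have m : measurable_fun setT (fun w : L * L => (w.1 : V) ord0 k + (w.2 : V) ord0 k).
  apply: measurable_funD.
    by apply: (measurableT_comp (measurable_coord k)); exact: measurable_fst.
  by apply: (measurableT_comp (measurable_coord k)); exact: measurable_snd.
exact: m.
Qed.

Lemma shearable_bigcup (D : set nat) (F : nat -> set V) :
  (forall k, shearable (F k)) -> shearable (\bigcup_(k in D) F k).
Proof.
move=> h; split; first by apply: bigcup_measurable => k _; exact: (h k).1.
have -> : [set w : V * V | (\bigcup_(k in D) F k) (w.1 + w.2)] =
  \bigcup_(k in D) [set w | F k (w.1 + w.2)] by [].
by apply: bigcup_measurable => k _; exact: (h k).2.
Qed.

Lemma shearable_bigcap (F : nat -> set V) :
  (forall k, shearable (F k)) -> shearable (\bigcap_k F k).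
Proof.
move=> h; split; first by apply: bigcapT_measurable => k; exact: (h k).1.
have -> : [set w : V * V | (\bigcap_k F k) (w.1 + w.2)] =
  \bigcap_k [set w | F k (w.1 + w.2)] by [].
by apply: bigcapT_measurable => k; exact: (h k).2.
Qed.

(** Intersect covers by boxes whose total volume exceeds the measure of [G] by at most 1/(m+1): the
    result is built from boxes by countable operations and exceeds [G] by a null set. *)
Lemma shearable_hull G : measurable (G : set L) -> (mu G < +oo)%E ->
  exists2 G', shearable G' & G `<=` G' /\ mu (G' `\` G) = 0%E.
Proof.
move=> mG Gfin.
have Gf : mu G \is a fin_num by rewrite ge0_fin_numE// lebesgue_outer_ge0.
pose P m (c : set nat * (nat -> V) * (nat -> V)) :=
  G `<=` \bigcup_(k in c.1.1) box (c.1.2 k) (c.2 k) /\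
  (\esum_(k in c.1.1) (box_vol (c.1.2 k) (c.2 k))%:E <= mu G + (m.+1%:R^-1)%:E)%E.
have /choice[c Pc] : forall m, exists c, P m c.
  move=> m; have m0 : (0 : R) < m.+1%:R^-1 by rewrite invr_gt0 ltr0n.
  have [v [D [a [b [GD ->]]]] lev] := lb_ereal_inf_adherent m0 Gf.
  by exists (D, a, b); split => //; exact/ltW/lev.
pose F m : set V := \bigcup_(k in (c m).1.1) box ((c m).1.2 k) ((c m).2 k).
have sF m : shearable (F m) by apply: shearable_bigcup => k; exact: shearable_box.
pose G' := \bigcap_m F m.
have sG' : shearable G' by exact: shearable_bigcap.
have GG' : G `<=` G' by move=> x Gx m _; exact: (Pc m).1.
exists G' => //; split => //.
have leF m : (mu G' <= mu G + (m.+1%:R^-1)%:E)%E.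
  apply: le_trans (Pc m).2; apply: (@le_trans _ _ (mu (F m))).
    by apply: le_lebesgue_outer => x; exact.
  apply: le_trans (lebesgue_outer_esum _ _) _.
  by apply: le_esum => k _; exact: lebesgue_outer_box.
have le : (mu G' <= mu G)%E.
  apply/lee_addgt0Pr => e e0.
  have ei0 : 0 <= e^-1 by rewrite invr_ge0 ltW.
  have /andP[_ h] := truncn_itv ei0.
  apply: le_trans (leF (Num.truncn e^-1)) _; rewrite leeD2l// lee_fin.
  by rewrite -[leRHS]invrK lef_pV2 ?posrE ?ltr0n ?invr_gt0//; exact: ltW.
have cG : mu.-caratheodory G := mG.
move: le; rewrite (cG G') (_ : G' `&` G = G); last first.
  by apply/seteqP; split => x; [case|move=> Gx; split => //; exact: GG'].
rewrite -setDE; have := lebesgue_outer_ge0 (G' `\` G).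
rewrite -{2}(adde0 (mu G)) leeD2lE// => h1 h2.
by apply/eqP; rewrite eq_le h1 h2.
Qed.

Lemma measurable_near_pairs (r : R) :
  measurable ([set w : V * V | cube w.1 r w.2] : set (L * L)).
Proof.
have -> : [set w : V * V | cube w.1 r w.2] = \bigcap_(k in [set: 'I_N])
    ((fun w : V * V => `|w.2 ord0 k - w.1 ord0 k|) @^-1` `]-oo, r[%classic).
  apply/seteqP; split => w h k; first by move=> _; have := h k; rewrite /= in_itv/=.
  by have := h k I; rewrite /= in_itv/=.
apply: fin_bigcap_measurable => // k _; rewrite -[X in measurable X]setTI.
have m : measurable_fun setT (fun w : L * L => `|(w.2 : V) ord0 k - (w.1 : V) ord0 k|).
  apply: (measurableT_comp (@normr_measurable R setT)); apply: measurable_funB.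
    by apply: (measurableT_comp (measurable_coord k)); exact: measurable_snd.
  by apply: (measurableT_comp (measurable_coord k)); exact: measurable_fst.
exact: m.
Qed.

Definition near_cut_pairs E z r d : set (V * V) :=
  [set w | [/\ cube z r w.1, E w.1, ~ E w.2 & cube w.1 d w.2]].

Lemma measurable_near_cut_pairs E z r d : measurable (E : set L) ->
  measurable (near_cut_pairs E z r d : set (L * L)).
Proof.
move=> mE.
have -> : near_cut_pairs E z r d = [set w | cube z r w.1] `&` [set w | E w.1] `&`
    [set w | (~` E) w.2] `&` [set w | cube w.1 d w.2].
  by apply/seteqP; split => w; [case|case=> [[[? ?] ?] ?]].
apply: measurableI; last exact: measurable_near_pairs.
apply: measurableI; last by apply: measurable_snd_set; exact: measurableC.
apply: measurableI; last exact: measurable_fst_set.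
by apply: measurable_fst_set; exact: measurable_cube.
Qed.

Lemma pint_mem_fubini (Q : set (V * V)) (c : R) (B : set V) :
  measurable (Q : set (L * L)) -> measurable (B : set L) -> 0 <= c ->
  (forall h, B h -> (mu [set x | Q (x, h)] <= c%:E)%E) ->
  (forall x h, Q (x, h) -> B h) ->
  (pint (fun w => (w \in Q)%:R) <= c%:E * mu B)%E.
Proof.
move=> mQ mB c0 hc QB; rewrite /pint.
have mi := measurable_indic (T := (L * L)%type) mQ.
rewrite fubini_tonelli2; last 2 first.
- exact/measurable_EFinP.
- by move=> w; rewrite lee_fin.
rewrite -[X in (_ * X)%E]/(@lebesgueN R N B) -[X in (_ * @lebesgueN R N X)%E]setIT.
rewrite -(@integral_indic _ _ _ (@lebesgueN R N) setT measurableT B mB).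
rewrite -ge0_integralZl//; last first.
  by apply/measurable_EFinP; exact: (measurable_indic (T := L)).
apply: (@ge0_le_integral _ _ _ (@lebesgueN R N) setT measurableT).
- by move=> h _; apply: integral_ge0 => x _; rewrite lee_fin.
- by apply: measurable_fun_fubini_tonelli_G => //; exact/measurable_EFinP.
- apply: measurable_funeM; apply/measurable_EFinP; exact: (measurable_indic (T := L)).
move=> h _; rewrite /fubini_G /=.
have mS : measurable ([set x | Q (x, h)] : set L).
  have := measurable_ysection h mQ; congr (measurable _); apply/seteqP; split => x;
  by rewrite /ysection /= in_setE.
have -> : (\int[@lebesgueN R N]_x ((x, h) \in Q)%:R%:E)%E = mu [set x | Q (x, h)].
  rewrite -[RHS]/(@lebesgueN R N _) -[X in @lebesgueN R N X]setIT.
  rewrite -(@integral_indic _ _ _ (@lebesgueN R N) setT measurableT _ mS).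
  by apply: eq_integral => x _; rewrite indicE.
rewrite indicE; have [/set_mem Bh|/negP Bh] := boolP (h \in B); first by rewrite mule1 hc.
rewrite mule0 (_ : [set x | Q (x, h)] = set0) ?lebesgue_outer0//.
by rewrite -subset0 => x /= /QB hB; apply: Bh; exact/mem_set.
Qed.

(** Writing the second point as [x + h], the slice at fixed [h] consists of points that the
    translation by [h] takes out of [E], of measure at most [N%:R * (K * d)]; the admissible [h]
    fill a cube of side [2 * d]. *)
Lemma pint_near_cut_pairs E K z r d : measurable (E : set L) -> 0 <= K -> 0 < d ->
  0 <= r -> tv_bound (cube z (r + 3 * d)) E K ->
  (pint (fun w => (w \in near_cut_pairs E z r d)%:R) <=
   (N%:R * (K * d) * (2 * d) ^+ N)%:E)%E.
Proof.
move=> mE K0 d0 r0 htv.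
(* Localizing makes the measure finite, as the hull requires; the cube is large enough to contain
   all points involved. *)
pose G := E `&` cube z (r + 3 * d).
have mG : measurable (G : set L) by apply: measurableI => //; exact: measurable_cube.
have Gfin : (mu G < +oo)%E.
  apply: (@le_lt_trans _ _ (mu (cube z (r + 3 * d)))).
    by apply: le_lebesgue_outer => x [].
  by apply: le_lt_trans (lebesgue_outer_cube _ _) (ltry _); lra.
have [G' [mG' sG'] [GG' Z0]] := shearable_hull mG Gfin.
pose Z := G' `\` G.
have mZ : measurable (Z : set L) by exact: measurableD.
pose P' : set (V * V) := [set w | [/\ cube z r w.1, G' w.1, ~ G' w.2 & cube w.1 d w.2]].
have mP' : measurable (P' : set (L * L)).
  have -> : P' = [set w | cube z r w.1] `&` [set w | G' w.1] `&`
      [set w | (~` G') w.2] `&` [set w | cube w.1 d w.2].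
    by apply/seteqP; split => w; [case|case=> [[[? ?] ?] ?]].
  apply: measurableI; last exact: measurable_near_pairs.
  apply: measurableI; last by apply: measurable_snd_set; exact: measurableC.
  apply: measurableI; last exact: measurable_fst_set.
  by apply: measurable_fst_set; exact: measurable_cube.
have inG (x h : V) : cube z r x -> (forall k, `|h ord0 k| <= d) -> cube z (r + 3 * d) (x + h).
  by move=> xr hd; apply: sub_cube (cube_translate hd xr); lra.
have nE : {in E, forall x, cube z r x -> G x}.
  by move=> x /set_mem Ex xr; split => //; apply: sub_cube xr; lra.
have mTZ : measurable (setT `*` Z : set (L * L)) by exact: measurableX.
have mQ0 := measurable_near_cut_pairs z r d mE.
(* Replacing [E] by the hull [G'] loses only pairs whose second point lies in the null set [Z]. *)
have step1 : (pint (fun w => (w \in near_cut_pairs E z r d)%:R) <=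
    pint (fun w => (w \in P')%:R))%E.
  apply: (@le_trans _ _ (pint (fun w => (w \in P')%:R + (w \in setT `*` Z)%:R))).
    apply: le_pint => //.
    - exact: (measurable_indic (T := (L * L)%type) mQ0).
    - apply: measurable_funD; first exact: (measurable_indic (T := (L * L)%type) mP').
      exact: (measurable_indic (T := (L * L)%type) mTZ).
    move=> [x y]; have [|_] := boolP ((x, y) \in near_cut_pairs E z r d); last by rewrite addr_ge0.
    move=> /set_mem[/= xr Ex Ey xy].
    have Gx : G x by apply: nE => //; exact/mem_set.
    have [Zy|Zy] := pselect (Z y); first by rewrite [(x, y) \in setT `*` Z]mem_set// lerDr.
    rewrite [(x, y) \in P']mem_set ?lerDl//; split => //=; first exact: GG'.
    move=> G'y; apply: Zy; split => // -[Ey' _]; exact: Ey.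
  rewrite pintD//.
  - by rewrite pint_rectangle// Z0 mule0 adde0.
  - exact: (measurable_indic (T := (L * L)%type) mP').
  - exact: (measurable_indic (T := (L * L)%type) mTZ).
apply: le_trans step1 _.
pose Q : set (V * V) := [set w | P' (w.1, w.1 + w.2)].
have QE : Q = [set w | cube z r w.1] `&` [set w | G' w.1] `&`
    (~` [set w | G' (w.1 + w.2)]) `&` [set w | cube 0 d w.2].
  apply/seteqP; split => w.
    move=> [/= h1 h2 h3 h4]; split; first by split.
    by move=> k /=; have := h4 k; rewrite !mxE subr0 [w.1 _ _ + _]addrC addrK.
  move=> [[[/= h1 h2] h3] h4]; split => // k /=.
  by have := h4 k; rewrite !mxE subr0 [w.1 _ _ + _]addrC addrK.
have mQ : measurable (Q : set (L * L)).
  rewrite QE; apply: measurableI; last by apply: measurable_snd_set; exact: measurable_cube.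
  apply: measurableI; last exact: measurableC.
  apply: measurableI; last exact: measurable_fst_set.
  by apply: measurable_fst_set; exact: measurable_cube.
have step2 : pint (fun w => (w \in P')%:R) = pint (fun w => (w \in Q)%:R).
  have m1 : measurable_fun setT (fun w : L * L => ((w \in P')%:R : R)%:E).
    by apply/measurable_EFinP; exact: (measurable_indic (T := (L * L)%type) mP').
  have m2 : measurable_fun setT (fun w : L * L => ((w \in Q)%:R : R)%:E).
    by apply/measurable_EFinP; exact: (measurable_indic (T := (L * L)%type) mQ).
  have n1 (w : L * L) : (0 <= ((w \in P')%:R : R)%:E)%E by rewrite lee_fin.
  have n2 (w : L * L) : (0 <= ((w \in Q)%:R : R)%:E)%E by rewrite lee_fin.
  rewrite /pint (fubini_tonelli1 _ m1 n1) (fubini_tonelli1 _ m2 n2).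
  apply: eq_integral => x _; rewrite /fubini_F /=.
  have fK : cancel (fun h : V => h + x) (fun h => h + - x) by move=> h; rewrite addrK.
  have gK : cancel (fun h : V => h + - x) (fun h => h + x) by move=> h; rewrite subrK.
  rewrite -(integral_outer_invariant fK gK (outer_invariant_translation x)).
  - apply: eq_integral => h _; congr (_%:R%:E); congr nat_of_bool.
    by apply/idP/idP => /set_mem; rewrite /Q /= [_ + x]addrC => ?; exact/mem_set.
  - apply/measurable_EFinP.
    apply: (measurableT_comp (measurable_indic (T := (L * L)%type) mP')).
    exact: measurable_pair1.
  - by move=> h; rewrite lee_fin.
rewrite step2.
have c0 : 0 <= N%:R * (K * d) by rewrite !mulr_ge0// ltW.
apply: (@le_trans _ _ ((N%:R * (K * d))%:E * mu (cube 0 d))%E); last first.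
  rewrite [leRHS]EFinM; apply: lee_wpmul2l; first by rewrite lee_fin.
  by apply: lebesgue_outer_cube; exact: ltW.
apply: pint_mem_fubini => //; first exact: measurable_cube.
  move=> h hd.
  have hd' k : `|h ord0 k| <= d by have := hd k; rewrite mxE subr0 => /ltW.
  rewrite -[leRHS]adde0 -[X in (_ + X)%E]Z0.
  apply: le_trans (_ : (mu (cube z r `&` edif E (translate h)) + mu Z <= _)%E); last first.
    by apply: leeD => //; apply: tv_translate => //; exact: ltW.
  apply: le_trans (outer_measureU2 mu _ _); apply: le_lebesgue_outer => x.
  move=> [/= xr G'x G'xh _]; have [Zx|Zx] := pselect (Z x); first by right.
  left; split => //; rewrite /edif /translate /=.
  have Gx : G x by apply: contrapT => nGx; apply: Zx; split.
  rewrite (mem_set Gx.1) memNset//= => Exh; apply: G'xh; apply: GG'; split => //.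
  exact: inG.
by move=> x h; rewrite QE => -[].
Qed.

End pair_measure.

(** * Dyadic bound on the energy *)

Section dyadic.
Context {R : realType} {N : nat}.
Local Notation V := 'rV[R]_N.
Local Notation L := (lebesgue_space R N).
Local Notation mu := (@lebesgue_outer R N).
Implicit Types (E : set V) (K r s rho : R) (p : V).

Lemma dyadic_index (x : R) : 1 <= x -> exists k : nat, 2 ^+ k <= x < 2 ^+ k.+1.
Proof.
move=> x1.
have ex : exists n : nat, x < 2 ^+ n.+1.
  have /andP[_ h] := truncn_itv (le_trans ler01 x1).
  exists (Num.truncn x); apply: lt_le_trans h _.
  by rewrite -natrX ler_nat ltnW// ltn_expl.
case: (ex_minnP ex) => k xk kmin; exists k; rewrite xk andbT leNgt; apply/negP => h.
case: k kmin h xk => [_|k kmin h _]; first by rewrite expr0 ltNge x1.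
by have := kmin _ h; rewrite ltnn.
Qed.

(** No partition into shells is needed: pointwise, [f] is at most one term of the series of
    nonnegative [g k], hence at most its sum. *)
Lemma pint_dyadic_le (f : V * V -> R) (g : nat -> V * V -> R) (c q : R) :
  (forall z, 0 <= f z) -> measurable_fun setT (f : L * L -> R) ->
  (forall k z, 0 <= g k z) -> (forall k, measurable_fun setT (g k : L * L -> R)) ->
  (forall z, exists k, f z <= g k z) ->
  0 <= c -> 0 <= q < 1 -> (forall k, (pint (g k) <= (c * q ^+ k)%:E)%E) ->
  (pint f <= (c / (1 - q))%:E)%E.
Proof.
move=> f0 mf g0 mg fg c0 /andP[q0 q1] gc.
have gE0 k (z : L * L) : (0 <= (g k z)%:E)%E by rewrite lee_fin.
have mgE k : measurable_fun setT (fun z : L * L => (g k z)%:E) by exact/measurable_EFinP.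
apply: (@le_trans _ _ (\int[@lebesgueN R N \x @lebesgueN R N]_z
    \sum_(0 <= k <oo) (g k z)%:E)%E).
  apply: ge0_le_integral => //.
  - by move=> z _; rewrite lee_fin.
  - exact/measurable_EFinP.
  - by apply: ge0_emeasurable_sum.
  move=> z _; have [k hk] := fg z.
  apply: (@le_trans _ _ (\sum_(0 <= i < k.+1) (g i z)%:E)%E); last first.
    by apply: nneseries_lim_ge => i _ _; rewrite lee_fin.
  rewrite big_nat_recr//= -[leLHS]add0e; apply: leeD; last by rewrite lee_fin.
  by apply: sume_ge0 => i _; rewrite lee_fin.
rewrite integral_nneseries//.
apply: lime_le; first by apply: is_cvg_nneseries => k _ _; apply: integral_ge0.
apply: nearW => n; apply: (@le_trans _ _ (\sum_(0 <= k < n) (c * q ^+ k)%:E)%E).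
  by apply: lee_sum => k _; exact: gc.
rewrite sumEFin lee_fin.
have q1' : q != 1 by rewrite lt_eqF.
have -> : \sum_(0 <= k < n) (c * q ^+ k) = c * (1 - q ^+ n) / (1 - q) :=
  congr1 (fun u : R^nat => u n) (geometric_seriesE c q1').
 rewrite ler_pM2r ?invr_gt0 ?subr_gt0// ler_piMr//.
by rewrite gerBl exprn_ge0.
Qed.

Lemma measurable_pairs_mem (P : set (V * V)) : measurable (P : set (L * L)) ->
  measurable_fun setT ((fun w => (w \in P)%:R) : L * L -> R).
Proof. exact: (measurable_indic (T := (L * L)%type)). Qed.

(* The dyadic shells around the diagonal contribute a geometric series of ratio
   [2 `^ sbar / 2]; this is where [sbar < 1] is needed. *)
Definition energy_const (sbar : R) : R :=
  (8 ^+ N * (4 * N%:R) + 2 * 64 ^+ N) / (1 - 2 `^ sbar / 2).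

Lemma two_powR_lt2 (sbar : R) : 0 < sbar < 1 -> 1 <= 2 `^ sbar < 2.
Proof.
have l2 : 0 < ln 2 :> R by rewrite ln_gt0// ltr1n.
move=> /andP[s0 s1]; apply/andP; split.
  by rewrite -[leLHS](powRr0 2) ler_powR ?ler1n// ltW.
rewrite /powR pnatr_eq0/=.
by rewrite -[ltRHS](@lnK R 2) ?posrE// ltr_expR gtr_pMl.
Qed.

Lemma powR_natD_inv (a s : R) : 0 < a ->
  (a `^ (N%:R + s))^-1 = (a ^+ N)^-1 * (a `^ s)^-1.
Proof.
move=> a0; rewrite powRD; last by rewrite (gt_eqF a0) implybT.
by rewrite powR_mulrn ?ltW// invfM.
Qed.

Lemma frac_kernel_le_radius (s a : R) (x y : V) : 0 < s -> 0 < a -> a <= enorm (x - y) ->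
  frac_kernel s x y <= (a ^+ N)^-1 * (a `^ s)^-1.
Proof.
move=> s0 a0 axy; rewrite -powR_natD_inv// /frac_kernel.
have xy0 : 0 < enorm (x - y) by exact: lt_le_trans axy.
rewrite lef_pV2 ?posrE ?powR_gt0//.
by apply: ge0_ler_powR; rewrite ?nnegrE ?addr_ge0 ?(ltW s0) ?(ltW a0) ?(ltW xy0).
Qed.

(** The decay in [k] carried by the exponent [s] is given up on purpose: it would degenerate as s
    tends to 0, and the far weight replaces it. *)
Lemma frac_kernel_far (s rho : R) k (x y : V) : 0 < s -> 0 < rho ->
  2 ^+ k * rho <= enorm (x - y) ->
  frac_kernel s x y <= (rho `^ s)^-1 / (2 ^+ k * rho) ^+ N.
Proof.
move=> s0 r0 h; have k0 : 0 < 2 ^+ k * rho by rewrite mulr_gt0 ?exprn_gt0.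
apply: le_trans (frac_kernel_le_radius s0 k0 h) _.
rewrite mulrC ler_pM2r ?invr_gt0 ?exprn_gt0// lef_pV2 ?posrE ?powR_gt0//.
apply: ge0_ler_powR; rewrite ?nnegrE ?(ltW s0) ?(ltW r0) ?(ltW k0)//.
by rewrite ler_peMl ?(ltW r0)// exprn_ege1// ler1n.
Qed.

(** The growth of the singular part is measured with [sbar] in place of [s], which makes the ratio
    of the series independent of [s]. *)
Lemma frac_kernel_near (s sbar rho : R) k (x y : V) : 0 < s -> s <= sbar -> 0 < rho ->
  rho / 2 ^+ k <= enorm (x - y) ->
  frac_kernel s x y <= (rho `^ s)^-1 * (2 `^ sbar) ^+ k / (rho / 2 ^+ k) ^+ N.
Proof.
move=> s0 ss r0 h; have p0 : (0 : R) < 2 ^+ k by rewrite exprn_gt0.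
have k0 : 0 < rho / 2 ^+ k by rewrite divr_gt0.
apply: le_trans (frac_kernel_le_radius s0 k0 h) _.
rewrite mulrC ler_pM2r ?invr_gt0 ?exprn_gt0//.
have e : rho `^ s = (rho / 2 ^+ k) `^ s * (2 `^ s) ^+ k.
  rewrite -[in RHS]powR_mulrn ?powR_ge0// powRAC powR_mulrn// -powRM ?(ltW k0) ?(ltW p0)//.
  by rewrite divfK ?gt_eqF.
rewrite e invfM -mulrA ler_peMr ?invr_ge0 ?powR_ge0//.
rewrite mulrC ler_pdivlMr ?exprn_gt0 ?powR_gt0// mul1r lerXn2r ?nnegrE ?powR_ge0//.
by apply: ler_powR => //; rewrite ler1n.
Qed.

(** Pairs at distance about rho 2^-k are few by the variation bound, which beats the singularity;
    pairs at distance about rho 2^k are counted by volume alone, and the weight 2^-k makes them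
    summable. *)
Lemma cut_energy_le (s sbar rho K : R) p E : 0 < sbar < 1 -> 0 < s < sbar -> 0 < rho ->
  0 <= K -> measurable (E : set L) -> tv_bound (cube p (10 * rho)) E K ->
  (cut_energy s rho p E <=
   ((rho `^ s)^-1 * (energy_const sbar * (rho ^+ N + rho * K)))%:E)%E.
Proof.
move=> sb01 /andP[s0 ssb] r0 K0 mE htv.
have /andP[W1 W2] := two_powR_lt2 sb01; rewrite /energy_const.
set W := 2 `^ sbar in W1 W2 *; pose q := W / 2.
have q12 : 2^-1 <= q by rewrite /q ler_pdivlMr// mulVf.
have q1 : q < 1 by rewrite /q ltr_pdivrMr// mul1r.
have q0 : 0 <= q by lra.
pose u := (rho `^ s)^-1; have u0 : 0 < u by rewrite invr_gt0 powR_gt0.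
have P2 k : (0 : R) < 2 ^+ k by rewrite exprn_gt0.
(* [cn k] bounds the kernel at distances at least rho/2^(k+1). [cf k] bounds kernel times weight at
   distances at least 2^k rho, its last factor being the weight. *)
pose cn k : R := u * W ^+ k.+1 / (rho / 2 ^+ k.+1) ^+ N.
pose cf k : R := u / (2 ^+ k * rho) ^+ N / 2 ^+ k.
have cn0 k : 0 <= cn k.
  by rewrite divr_ge0 ?mulr_ge0 ?exprn_ge0 ?divr_ge0 ?(ltW u0) ?(ltW r0)// (le_trans ler01).
have cf0 k : 0 <= cf k.
  by rewrite !divr_ge0 ?exprn_ge0 ?mulr_ge0 ?(ltW u0) ?(ltW r0).
pose An k := near_cut_pairs E p (4 * rho) (2 * (rho / 2 ^+ k)).
pose Ff k := cube p (4 * rho) `*` cube p (4 * (2 ^+ k * rho)).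
pose Fs k := cube p (4 * (2 ^+ k * rho)) `*` cube p (4 * rho).
pose g k (w : V * V) := cn k * (w \in An k)%:R + cf k * ((w \in Ff k)%:R + (w \in Fs k)%:R).
have mAn k : measurable (An k : set (L * L)) by exact: measurable_near_cut_pairs.
have mFf k : measurable (Ff k : set (L * L)) by apply: measurableX; exact: measurable_cube.
have mFs k : measurable (Fs k : set (L * L)) by apply: measurableX; exact: measurable_cube.
have mFF k : measurable_fun setT ((fun w => (w \in Ff k)%:R + (w \in Fs k)%:R) : L * L -> R).
  exact: (measurable_funD (measurable_pairs_mem (mFf k)) (measurable_pairs_mem (mFs k))).
have mC (c : R) (h : V * V -> R) : measurable_fun setT (h : L * L -> R) ->
    measurable_fun setT ((fun w => c * h w) : L * L -> R).
  by move=> mh; apply: measurable_funM => //; exact: measurable_cst.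
have mAnC k := mC (cn k) _ (measurable_pairs_mem (mAn k)).
have mFFC k := mC (cf k) _ (mFF k).
have n1 k (w : V * V) : 0 <= cn k * (w \in An k)%:R by rewrite mulr_ge0.
have n2 k (w : V * V) : 0 <= (w \in Ff k)%:R + (w \in Fs k)%:R :> R by rewrite addr_ge0.
have n3 k (w : V * V) : 0 <= cf k * ((w \in Ff k)%:R + (w \in Fs k)%:R).
  by rewrite mulr_ge0.
pose c := u * (8 ^+ N * (4 * N%:R) + 2 * 64 ^+ N) * (rho ^+ N + rho * K).
have rK0 : 0 <= rho * K by rewrite mulr_ge0// ltW.
have rN0 : 0 <= rho ^+ N by rewrite exprn_ge0// ltW.
have c0 : 0 <= c.
  have cc : (0 : R) <= 8 ^+ N * (4 * N%:R) + 2 * 64 ^+ N.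
    by rewrite addr_ge0// ?mulr_ge0 ?exprn_ge0 ?mulr_ge0.
  by apply: mulr_ge0; [apply: mulr_ge0 => //; exact: ltW|exact: addr_ge0].
have -> : u * ((8 ^+ N * (4 * N%:R) + 2 * 64 ^+ N) / (1 - W / 2) * (rho ^+ N + rho * K)) =
    c / (1 - q).
  by rewrite /c /q; field; rewrite gt_eqF//; lra.
have gc k : (pint (g k) <= (c * q ^+ k)%:E)%E.
  rewrite /g (pintD (n1 k) (mAnC k) (n3 k) (mFFC k)).
  rewrite (pintZ (cn0 k) (fun w => ler0n _ _) (measurable_pairs_mem (mAn k))).
  rewrite (pintZ (cf0 k) (n2 k) (mFF k)).
  rewrite (pintD (fun w => ler0n _ _) (measurable_pairs_mem (mFf k))
    (fun w => ler0n _ _) (measurable_pairs_mem (mFs k))).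
  rewrite !pint_rectangle; try exact: measurable_cube.
  have k2 : 0 < rho / 2 ^+ k by rewrite divr_gt0.
  (* The radius [10 * rho] originates here: [4 * rho] for the first point plus three times the
     largest near distance [2 * rho]. *)
  have htvk : tv_bound (cube p (4 * rho + 3 * (2 * (rho / 2 ^+ k)))) E K.
    apply: tv_bound_sub (lexx K) htv; apply: sub_cube.
    have : rho / 2 ^+ k <= rho by rewrite ler_pdivrMr// ler_peMr ?(ltW r0)// exprn_ege1// ler1n.
    by lra.
  have b1 := pint_near_cut_pairs mE K0 (mulr_gt0 (ltr0n R 2) k2) _ htvk.
  have {}b1 := b1 (mulr_ge0 (ler0n R 4) (ltW r0)).
  have kr : 0 < 2 ^+ k * rho by rewrite mulr_gt0.
  have b2 := lebesgue_outer_cube p (mulr_ge0 (ler0n R 4) (ltW r0)).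
  have b3 := lebesgue_outer_cube p (mulr_ge0 (ler0n R 4) (ltW kr)).
  have b23 : (lebesgue_outer (cube p (4 * rho)) * lebesgue_outer (cube p (4 * (2 ^+ k * rho))) <=
      ((2 * (4 * rho)) ^+ N * (2 * (4 * (2 ^+ k * rho))) ^+ N)%:E)%E.
    by rewrite EFinM; apply: lee_pmul => //; exact: lebesgue_outer_ge0.
  apply: (@le_trans _ _ ((cn k * (N%:R * (K * (2 * (rho / 2 ^+ k))) *
      (2 * (2 * (rho / 2 ^+ k))) ^+ N))%:E + (cf k * (2 * ((2 * (4 * rho)) ^+ N *
      (2 * (4 * (2 ^+ k * rho))) ^+ N)))%:E)%E).
    apply: leeD; rewrite [leRHS]EFinM; apply: lee_wpmul2l; rewrite ?lee_fin//.
    set T := (2 * (4 * rho)) ^+ N * _ in b23 *.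
    by rewrite [2 * T](_ : _ = T + T) ?EFinD; [apply: leeD => //; rewrite muleC|ring].
  rewrite -EFinD lee_fin.
  (* In a near shell the N-th powers of the distance cancel; what remains is [W ^+ k] from the
     singularity and 2^-k from the variation bound, together [q ^+ k]. *)
  have e1 : cn k * (N%:R * (K * (2 * (rho / 2 ^+ k))) * (2 * (2 * (rho / 2 ^+ k))) ^+ N) =
      u * (8 ^+ N * (2 * N%:R)) * (rho * K) * W * q ^+ k.
    rewrite /cn; set D := rho / 2 ^+ k.+1.
    have D0 : 0 < D by rewrite divr_gt0.
    have kD : rho / 2 ^+ k = 2 * D by rewrite /D exprS; field; rewrite gt_eqF.
    rewrite [RHS](_ : _ = u * (8 ^+ N * (2 * N%:R)) * K * W ^+ k.+1 * (rho / 2 ^+ k)); last first.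
      by rewrite /q expr_div_n [W ^+ k.+1]exprS; field; rewrite gt_eqF.
    rewrite kD [2 * (2 * (2 * D))](_ : _ = 8 * D); last by ring.
    have DN : D ^+ N != 0 by rewrite gt_eqF// exprn_gt0.
    by clearbody D; rewrite [(8 * D) ^+ N]exprMn; field.
  (* 64 = 8 * 8 comes from cubes of sides [8 * rho] and [8 * (2 ^+ k * rho)], the factor 2 from the
     choice of the point that is near [p]. *)
  have e2 : cf k * (2 * ((2 * (4 * rho)) ^+ N * (2 * (4 * (2 ^+ k * rho))) ^+ N)) =
      u * (2 * 64 ^+ N) * rho ^+ N * (2^-1) ^+ k.
    rewrite /cf exprVn [2 * (4 * rho)](_ : _ = 8 * rho); last by ring.
    set T := 2 ^+ k * rho; rewrite [2 * (4 * T)](_ : _ = 8 * T); last by ring.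
    have TN : T ^+ N != 0 by rewrite gt_eqF// exprn_gt0.
    have k0 : (2 : R) ^+ k != 0 by rewrite gt_eqF.
    rewrite ![(8 * _) ^+ N]exprMn (_ : (64 : R) ^+ N = 8 ^+ N * 8 ^+ N); last first.
      by rewrite -exprMn -natrM.
    by clearbody T; field; rewrite k0 TN.
  rewrite e1 e2 /c.
  (* Since [2^-1 <= q], one ratio serves the near and the far shells. *)
  have H : (2^-1 : R) ^+ k <= q ^+ k by rewrite lerXn2r ?nnegrE.
  have Q0 : 0 <= q ^+ k by rewrite exprn_ge0.
  set a := 8 ^+ N * N%:R * u; set b := 64 ^+ N * u.
  have a0 : 0 <= a by rewrite /a !mulr_ge0 ?exprn_ge0 ?(ltW u0).
  have b0 : 0 <= b by rewrite /b !mulr_ge0 ?exprn_ge0 ?(ltW u0).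
  rewrite [leLHS](_ : _ = 2 * a * (rho * K * q ^+ k) * W + 2 * b * rho ^+ N * 2^-1 ^+ k);
    last by rewrite /a /b; ring.
  rewrite [leRHS](_ : _ = 2 * a * (rho * K * q ^+ k) * 2 + 2 * b * rho ^+ N * q ^+ k +
    (4 * a * rho ^+ N * q ^+ k + 2 * b * (rho * K) * q ^+ k)); last by rewrite /a /b; ring.
  have r0' := ltW r0; clearbody a b; rewrite -[leLHS]addr0; apply: lerD; last by rewrite addr_ge0 ?mulr_ge0.
  by apply: lerD; apply: ler_wpM2l; rewrite ?mulr_ge0// ltW.
have w1 (x y : V) : far_weight rho x y <= 1 by rewrite /far_weight ge_min lexx.
have w0 (x y : V) : 0 <= far_weight rho x y.
  by rewrite /far_weight le_min ler01 divr_ge0 ?(ltW r0) ?enorm_ge0.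
rewrite /cut_energy; set f := (X in pint X).
have f0 z : 0 <= f z by rewrite /f !mulr_ge0 ?pair_kernel_ge0.
have mf : measurable_fun setT (f : L * L -> R).
  apply: measurable_mul_mem.
    by apply: measurable_funM; [exact: measurable_frac_kernel|exact: measurable_far_weight].
  exact: (measurable_cut_pairs mE (measurable_closed_eball p (2 * rho))).
have g0 k z : 0 <= g k z by rewrite addr_ge0.
have mg k : measurable_fun setT (g k : L * L -> R).
  exact: (measurable_funD (mAnC k) (mFFC k)).
have q01 : 0 <= q < 1 by rewrite q0.
suff fg z : exists k, f z <= g k z by exact: (pint_dyadic_le f0 mf g0 mg fg c0 q01 gc).
case: z => x y; rewrite /f; clear gc f0 mf mg q01 q0 q1 q12 W1 W2 rK0 rN0 c0 sb01; have [|_] := boolP (_ \in cut_pairs E _); last first.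
  by exists 0%N; rewrite mulr0.
move=> /set_mem[/= Ex Ey Bxy]; rewrite mulr1.
have xy : x != y by apply/eqP => xy; apply: Ey; rewrite -xy.
set d := enorm (x - y).
have d0 : 0 < d.
  rewrite lt_neqAle enorm_ge0 andbT eq_sym; apply/eqP => /enorm0_eq/eqP.
  by rewrite subr_eq0 (negbTE xy).
have tri : enorm (x - p) <= d + enorm (y - p).
  by have := enorm_triangle (x - y) (y - p); rewrite addrA subrK.
have tri' : enorm (y - p) <= d + enorm (x - p).
  by have := enorm_triangle (y - x) (x - p); rewrite addrA subrK [enorm (y - x)]enorm_sub.
have cubeP (z a : V) (r : R) : enorm (a - z) < r -> cube z r a.
  by move=> h; exact: eball_sub_cube.
have [dr|dr] := ltP d rho.
  have [k /andP[k1 k2]] : exists k : nat, 2 ^+ k <= rho / d < 2 ^+ k.+1.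
    by apply: dyadic_index; rewrite ler_pdivlMr// mul1r ltW.
  exists k; apply: (@le_trans _ _ (cn k)).
    apply: (@le_trans _ _ (pair_kernel s (x, y) * 1)).
      by rewrite ler_wpM2l ?pair_kernel_ge0.
    rewrite mulr1; apply: frac_kernel_near => //; first exact: ltW.
    by rewrite ler_pdivrMr// mulrC -ler_pdivrMr// ltW.
  rewrite /g (_ : (x, y) \in An k) ?mulr1 ?lerDl//.
  apply/mem_set; split => //=.
    by apply: cubeP; case: Bxy => ?; lra.
  apply: cubeP; rewrite enorm_sub -/d.
  have : d <= rho / 2 ^+ k by rewrite ler_pdivlMr// mulrC -ler_pdivlMr.
  have : 0 < rho / 2 ^+ k by rewrite divr_gt0.
  by lra.
have [k /andP[k1 k2]] : exists k : nat, 2 ^+ k <= d / rho < 2 ^+ k.+1.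
  by apply: dyadic_index; rewrite ler_pdivlMr// mul1r.
have kr : 2 ^+ k * rho <= d by rewrite -ler_pdivlMr.
have kr2 : d < 2 * (2 ^+ k * rho) by rewrite mulrA -exprS -ltr_pdivrMr.
have rk : rho <= 2 ^+ k * rho by rewrite ler_peMl ?(ltW r0)// exprn_ege1// ler1n.
have kr0 : 0 < 2 ^+ k * rho by rewrite mulr_gt0.
exists k; apply: (@le_trans _ _ (cf k)).
  rewrite /cf; apply: ler_pM; rewrite ?pair_kernel_ge0//; first exact: frac_kernel_far.
  rewrite /far_weight ge_min; apply/orP; right; rewrite -/d.
  by rewrite ler_pdivrMr// mulrC ler_pdivlMr// mulrC.
rewrite -[leLHS]mulr1 /g -[leLHS]add0r; apply: lerD => //; rewrite ler_wpM2l//.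
case: Bxy => /= Bx.
  rewrite [(x, y) \in Ff k]mem_set ?lerDl//; split => /=; apply: cubeP; first by lra.
  by lra.
rewrite [(x, y) \in Fs k]mem_set ?lerDr//; split => /=; apply: cubeP; last by lra.
by lra.
Qed.

End dyadic.

(** * Improvement of the variation bound *)

(** On [0, 1] the cosine is at least 1/2, so [sin (2 * y)] already reaches [y]. The linear bound on
    [t] turns estimates per angle into estimates per length. *)
Lemma sin_solve (R : realType) (y : R) : 0 <= y <= 2^-1 ->
  exists2 t, 0 <= t <= 2 * y & sin t = y.
Proof.
move=> /andP[y0 y1].
have y2 : 0 <= 2 * y by lra.
have y3 : 2 * y <= 1 by lra.
have sc : {within `[0, 2 * y], continuous (@sin R)}.
  by apply: continuous_subspaceT => x; exact: continuous_sin.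
have [|t] := IVT y2 sc (v := y); last by rewrite in_itv /= => tI e; exists t.
have [c] := @MVT_segment _ sin cos 0 (2 * y) y2
  (fun x _ => is_derive_sin x) sc.
rewrite in_itv /= sin0 subr0 => /andP[c0 c1] e.
have : cos c >= 2^-1.
  have := one_sub_cos_le c; rewrite ler_norml => /andP[h _].
  have : c ^+ 2 <= 1 by rewrite expr_le1//; lra.
  lra.
move=> cc; have : sin (2 * y) >= y by rewrite e; nra.
by move=> sy; rewrite minEle maxEle (le_trans y0 sy) y0 sy.
Qed.

(** * Translations as products of rotations *)

Section rotation_commutator.
Context {R : realType} {N : nat} (i j : 'I_N) (ji : j != i).
Local Notation V := 'rV[R]_N.
Implicit Types (p z x : V).

(** The angles t, -2t, t add up to zero, so the linear parts cancel and a translation is left;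
    centres aligned along axis [j] make it parallel to axis [i]. *)
Lemma rot_about_translate z (c t : R) x :
  let p := z + axis j c in
  rot_about i j p t (rot_about i j z (- (t + t)) (rot_about i j p t x)) =
  translate (axis i (2 * c * sin t)) x.
Proof.
have ij : (i == j) = false by rewrite eq_sym (negbTE ji).
move=> p; apply/rowP => k; have := cos2Dsin2 t.
have [->|ki] := eqVneq k i.
  rewrite !mxE !eqxx ?ij ?(negbTE ji) /= cosN sinN cosD sinD.
  set u := cos t; set s := sin t => us.
  have s2 : s ^+ 2 = 1 - u ^+ 2 by rewrite -us; ring.
  by ring: s2.
have [->|kj] := eqVneq k j.
  rewrite !mxE !eqxx ?ij ?(negbTE ji) /= cosN sinN cosD sinD.
  set u := cos t; set s := sin t => us.
  have s2 : s ^+ 2 = 1 - u ^+ 2 by rewrite -us; ring.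
  by ring: s2.
by move=> _; rewrite !mxE !eqxx (negbTE ki) (negbTE kj) /=; ring.
Qed.

Lemma rot_aboutE p t :
  rot_about i j p t = (fun x => x + p) \o (plane_rot i j t \o (fun x => x + (- p))).
Proof. by apply/funext => x; rewrite /rot_about /= addrC. Qed.

Lemma outer_invariant_rot_about p t : outer_invariant (rot_about i j p t).
Proof.
rewrite rot_aboutE; apply: outer_invariant_comp; first exact: outer_invariant_translation.
apply: outer_invariant_comp; last exact: outer_invariant_translation.
exact: outer_invariant_plane_rot.
Qed.

Lemma enorm_rot_about p t x : enorm (rot_about i j p t x - p) = enorm (x - p).
Proof. by rewrite /rot_about [p + _]addrC addrK enorm_plane_rot. Qed.

Lemma enorm_axis k (c : R) : enorm (axis k c : V) = `|c|.
Proof.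
rewrite /enorm (bigD1 k)//= big1 ?addr0.
  by rewrite !mxE !eqxx mulr1 sqrtr_sqr.
by move=> l /negbTE lk; rewrite !mxE eqxx lk mulr0 expr0n.
Qed.
End rotation_commutator.

Lemma uniform_small (R : realType) (I : finType) (P : I -> R -> Prop) :
  (forall k, exists2 t0 : R, 0 < t0 & forall t, 0 < t < t0 -> P k t) ->
  exists2 t0 : R, 0 < t0 & forall k t, 0 < t < t0 -> P k t.
Proof.
move=> h; have /choice[f hf] : forall k, exists t0 : R, 0 < t0 /\
    forall t, 0 < t < t0 -> P k t by move=> k; have [t0 a b] := h k; exists t0.
exists (\big[Num.min/1]_k f k); first by apply/bigmin_gtP; split => // k _; exact: (hf k).1.
move=> k t /andP[t0 t1]; apply: (hf k).2; rewrite t0 (lt_le_trans t1)//.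
exact: bigmin_le.
Qed.

Section rotation_bound.
Context {R : realType} {N : nat}.
Local Notation V := 'rV[R]_N.
Local Notation L := (lebesgue_space R N).
Local Notation mu := (@lebesgue_outer R N).
Implicit Types (E U : set V) (s rho t M c : R) (p z : V).

(* Balls of radius [rho = (N + 3) * c] about points at distance [c] from [z] are used, and
   [cut_energy_le] looks at cubes of radius [10 * rho]. *)
Definition reach : R := 10 * (N%:R + 3) + 1.

(** A short translation is replaced by three rotations of total angle [4 * u] with [u <= t / c],
    each estimated by [rot_estimate]; a second coordinate direction exists because [2 <= N]. *)
Lemma tv_rotation s c z E U M : (2 <= N)%N -> 0 < s < 1 -> 0 < c ->
  measurable (E : set L) -> measurable (U : set L) -> stable_rearrangement s E U ->
  cube z (reach * c) `<=` U -> 0 < M ->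
  (forall p, (forall k, `|p ord0 k - z ord0 k| <= c) ->
     (cut_energy s ((N%:R + 3) * c) p E <= M%:E)%E) ->
  tv_bound (cube z c) E
    (8 * Num.sqrt ((2 * ((N%:R + 3) * c)) `^ (N%:R + s) * ((@whirl_const R N + 4) * M)) / c).
Proof.
move=> N2 s01 c0 mE mU stab zU M0 hM; apply: uniform_small => i.
have N0 : (0 < N)%N by exact: leq_trans N2.
pose rho := (N%:R + 3) * c; set S := Num.sqrt _.
have rho0 : 0 < rho by rewrite mulr_gt0// ltr_wpDl.
have [j ji] : exists j : 'I_N, j != i.
  have : (0 < #|predC1 i|)%N by rewrite cardC1 card_ord -ltnS prednK.
  by move=> /card_gt0P[j]; exists j.
pose p := z + axis j c.
have pz k : `|p ord0 k - z ord0 k| <= c.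
  rewrite /p [(z + _) _ _]mxE addrAC subrr add0r.
  by apply: le_trans (axis_coord _ _ _) _; rewrite gtr0_norm.
have zz k : `|z ord0 k - z ord0 k| <= c by rewrite subrr normr0 ltW.
have ballU (q : V) : (forall k, `|q ord0 k - z ord0 k| <= c) ->
    [set x | enorm (x - q) <= 2 * rho] `<=` U.
  move=> qz x /= xq; apply: zU => k.
  have -> : x ord0 k - z ord0 k = (x - q) ord0 k + (q ord0 k - z ord0 k).
    by rewrite !mxE; ring.
  apply: le_lt_trans (ler_normD _ _) _.
  have := coord_enorm (x - q) k; have := qz k.
  rewrite /reach mulrDl mul1r -mulrA -/rho; lra.
have [t1 t10 h1] := rot_estimate ji s01 rho0 (ballU p pz) mE mU stab M0 (hM p pz).
have [t2 t20 h2] := rot_estimate ji s01 rho0 (ballU z zz) mE mU stab M0 (hM z zz).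
rewrite -/S in h1 h2.
(* The angle [u] will satisfy [sin u = t / (2 * c)] and [u <= t / c]. The bound [c] lets the sine be
   inverted; the others ensure [u < t1] and [u + u < t2]. *)
exists (Num.min c (c * Num.min t1 (t2 / 2))).
  by rewrite lt_min c0 mulr_gt0// lt_min t10 divr_gt0.
move=> t /andP[t0]; rewrite lt_min => /andP[tc].
rewrite mulrC -ltr_pdivrMr// lt_min => /andP[tt1 tt2].
have [u /andP[u0 u1] su] : exists2 u, 0 <= u <= 2 * (t / (2 * c)) & sin u = t / (2 * c).
  apply: sin_solve; rewrite divr_ge0 ?mulr_ge0 ?(ltW t0) ?(ltW c0)//=.
  by rewrite ler_pdivrMr ?mulr_gt0// mulrA mulVf// mul1r ltW.
have {}u1 : u <= t / c.
  by rewrite (_ : t / c = 2 * (t / (2 * c)))//; field; rewrite gt_eqF.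
have S0 : 0 <= S by exact: sqrtr_ge0.
have e : translate (axis i t) =
    rot_about i j p u \o (rot_about i j z (- (u + u)) \o rot_about i j p u).
  apply/funext => x /=; rewrite /p rot_about_translate// su; congr translate; congr axis.
  by field; rewrite gt_eqF.
have tri (a b d : V) : enorm (a - d) <= enorm (a - b) + enorm (b - d).
  by have := enorm_triangle (a - b) (b - d); rewrite addrA subrK.
have ezp : enorm (z - p) = c by rewrite enorm_sub /p [z + _]addrC addrK enorm_axis gtr0_norm.
have rhoE : rho = N%:R * c + 3 * c by rewrite /rho mulrDl.
rewrite e; apply: (@le_trans _ _ ((u * (2 * S))%:E + ((u + u) * (2 * S))%:E + (u * (2 * S))%:E)%E);
  last first.
  rewrite -!EFinD lee_fin (_ : _ + _ = (8 * S) * u); last by ring.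
  by rewrite -[leRHS]mulrA [_^-1 * t]mulrC ler_wpM2l// mulr_ge0.
pose B1 := eball p rho `&` eball z ((N%:R + 2) * c).
(* A point of the cube is within [N%:R * c] of [z]. Each change of centre adds [c]: to [p] before
   the first rotation, to [z] before the second, to [p] before the third. This is why [rho] is
   [(N%:R + 3) * c]. *)
apply: (@edif_comp _ _ _ _ _ _ (eball p rho)).
- move=> x xz; pose y := rot_about i j p u x.
  have x1 : enorm (x - z) < N%:R * c by exact: cube_sub_eball.
  have := tri x z p; rewrite ezp => x2.
  have y1 : enorm (y - p) = enorm (x - p) by exact: enorm_rot_about.
  have y2 := tri y p z; rewrite [enorm (p - z)]enorm_sub ezp in y2.
  have w1 := enorm_rot_about ji z (- (u + u)) y.
  have := tri (rot_about i j z (- (u + u)) y) z p; rewrite ezp /eball /= -/y w1.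
  by clear - x1 x2 y1 y2 rhoE c0 => *; lra.
- apply: outer_invariant_comp; exact: outer_invariant_rot_about.
- apply: (@edif_comp _ _ _ _ _ _ (eball z rho)).
  + move=> x xz; pose y := rot_about i j p u x.
    have x1 : enorm (x - z) < N%:R * c by exact: cube_sub_eball.
    have := tri x z p; rewrite ezp => x2.
    have y1 : enorm (y - p) = enorm (x - p) by exact: enorm_rot_about.
    have := tri y p z; rewrite [enorm (p - z)]enorm_sub ezp /eball /= -/y; lra.
  + exact: outer_invariant_rot_about.
  + apply: (@le_trans _ _ (mu (eball p rho `&` edif E (rot_about i j p u)))).
      apply: le_lebesgue_outer => x [xz]; split=> //; rewrite /eball /=.
      have x1 : enorm (x - z) < N%:R * c by exact: cube_sub_eball.
      have := tri x z p; rewrite ezp; lra.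
    apply: le_trans (h1 u _) _; rewrite ger0_norm//; exact: le_lt_trans tt1.
  + apply: le_trans (h2 _ _) _; rewrite normrN ger0_norm ?addr_ge0//; lra.
- apply: le_trans (h1 u _) _; rewrite ger0_norm//; exact: le_lt_trans tt1.
Qed.

Lemma cut_energy_le_Per_s s rho p E U : 0 < rho ->
  [set x | enorm (x - p) <= 2 * rho] `<=` U ->
  measurable (E : set L) -> measurable (U : set L) ->
  (cut_energy s rho p E <= Per_s s E U)%E.
Proof.
move=> r0 sU mE mU; rewrite Per_sE// /cut_energy.
have mB := measurable_closed_eball p (2 * rho).
have w0 (x y : V) : 0 <= far_weight rho x y <= 1.
  rewrite /far_weight ge_min lexx le_min ler01 divr_ge0 ?(ltW r0) ?enorm_ge0//.
apply: le_pint.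
- move=> z; case/andP: (w0 z.1 z.2) => a b.
  by rewrite !mulr_ge0// pair_kernel_ge0.
- apply: measurable_mul_mem; last exact: measurable_cut_pairs.
  by apply: measurable_funM; [exact: measurable_frac_kernel|exact: measurable_far_weight].
- by apply: measurable_mul_mem; [exact: measurable_frac_kernel|exact: measurable_cut_pairs].
move=> z; case/andP: (w0 z.1 z.2) => a b; apply: ler_pM => //.
- by rewrite mulr_ge0// pair_kernel_ge0.
- by rewrite ler_piMr// pair_kernel_ge0.
- have [|_] := boolP (z \in cut_pairs E [set x : V | enorm (x - p) <= 2 * rho]); last by rewrite ler0n.
  move=> /set_mem[h1 h2 h3]; rewrite mem_set//; split => //.
  by case: h3 => h; [left|right]; apply: sU.
Qed.
End rotation_bound.

Section tv_improve.
Context {R : realType} {N : nat}.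
Local Notation V := 'rV[R]_N.
Local Notation L := (lebesgue_space R N).
Local Notation reach := (@reach R N).
Implicit Types (E U : set V) (s c K : R) (p z : V).

Lemma near_sub_cube p z c x d : (forall k, `|p ord0 k - z ord0 k| <= c) ->
  cube p d x -> cube z (d + c) x.
Proof.
move=> pz xp k; have -> : x ord0 k - z ord0 k = (x ord0 k - p ord0 k) + (p ord0 k - z ord0 k).
  by ring.
by apply: le_lt_trans (ler_normD _ _) _; apply: ltr_leD.
Qed.

Lemma closed_eball_sub p d : [set x : V | enorm (x - p) <= 2 * d] `<=` cube p (3 * d) \/ d <= 0.
Proof.
have [d0|d0] := leP d 0; [by right|left] => x /= xp k.
by have := coord_enorm (x - p) k; rewrite !mxE; lra.
Qed.

(** A qualitative start for the iteration: [K] depends on the fractional perimeter and on [c], but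
    is the same for all centres. *)
Lemma tv_apriori s c E U : (2 <= N)%N -> 0 < s < 1 -> 0 < c ->
  measurable (E : set L) -> measurable (U : set L) -> stable_rearrangement s E U ->
  exists2 K, 0 <= K & forall z, cube z (reach * c) `<=` U -> tv_bound (cube z c) E K.
Proof.
move=> N2 s01 c0 mE mU stab; pose M := fine (Per_s s E U) + 1.
have P0 : (0 <= Per_s s E U)%E.
  by rewrite Per_sE//; apply: pint_ge0 => w; rewrite mulr_ge0 ?pair_kernel_ge0.
have M0 : 0 < M by rewrite ltr_wpDl// fine_ge0.
eexists; last first.
  move=> z zU; apply: (tv_rotation N2 s01 c0 mE mU stab zU M0) => p pz.
  have r0 : 0 < (N%:R + 3) * c by rewrite mulr_gt0// ltr_wpDl.
  apply: (@le_trans _ _ (Per_s s E U)).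
    apply: cut_energy_le_Per_s => // x xp; apply: zU.
    have [h|] := closed_eball_sub p ((N%:R + 3) * c); last by rewrite leNgt r0.
    apply: (sub_cube _ (near_sub_cube pz (h x xp))).
    set rho := _ * c in r0 *; rewrite [leRHS](_ : _ = 10 * rho + c); first by lra.
    by rewrite /rho /reach; ring.
  have fP : Per_s s E U \is a fin_num by rewrite ge0_fin_numE//; exact: stab.1.
  by rewrite -(fineK fP) lee_fin /M lerDl.
by rewrite !mulr_ge0 ?invr_ge0 ?sqrtr_ge0// ltW.
Qed.

Lemma sqrt_amgm (u v x : R) : 0 <= u -> 0 <= v -> x <= 4 * (u * v) -> Num.sqrt x <= u + v.
Proof.
move=> u0 v0 h; rewrite -[leRHS]ger0_norm ?addr_ge0// -sqrtr_sqr; apply: ler_wsqrtr.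
apply: le_trans h _; rewrite -subr_ge0 (_ : _ - _ = (u - v) ^+ 2); last by ring.
exact: sqr_ge0.
Qed.

(** With [a = rho ^+ N.-1], the energy bound turns the variation estimate into a multiple of the
    square root of [a * (a + K)]; the inequality of the means splits it into [d * (a + K)] and a
    large multiple of [a]. *)
Lemma tv_improve (sbar d : R) : (2 <= N)%N -> 0 < sbar < 1 -> 0 < d ->
  exists2 C, 0 <= C & forall s c z K E U, 0 < s < sbar -> 0 < c -> 0 <= K ->
    measurable (E : set L) -> measurable (U : set L) -> stable_rearrangement s E U ->
    cube z (reach * c) `<=` U -> tv_bound (cube z (reach * c)) E K ->
    tv_bound (cube z c) E (d * K + C * c ^+ N.-1).
Proof.
move=> N2 sb01 d0.
have /andP[W1 W2] := two_powR_lt2 sb01.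
pose e := @energy_const R N sbar.
have e0 : 0 < e.
  rewrite /e /energy_const divr_gt0//; last by lra.
have w0 : 0 <= @whirl_const R N + 4 by rewrite addr_ge0// mulr_ge0// exprn_ge0.
pose m : R := N%:R + 3; have m0 : 0 < m by rewrite ltr_wpDl.
have mdef : m = N%:R + 3 by [].
have eE : e = @energy_const R N sbar by [].
(* [64 * m ^+ 2] undoes the factor [8 / c] when [rho = m * c], and [2 ^+ N.+1] bounds the power of 2
   with exponent N + s left after the powers of [rho] cancel. *)
clearbody m e; pose B := 64 * m ^+ 2 * (2 ^+ N.+1 * ((@whirl_const R N + 4) * e)).
have B0 : 0 <= B.
  rewrite /B; do ![apply: mulr_ge0 => //]; rewrite ?exprn_ge0 ?(ltW m0) ?(ltW e0)//.
have BE : B = 64 * m ^+ 2 * (2 ^+ N.+1 * ((@whirl_const R N + 4) * e)) by [].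
clearbody B; exists ((d + B / (4 * d)) * m ^+ N.-1).
  by rewrite mulr_ge0 ?exprn_ge0 ?addr_ge0 ?divr_ge0 ?mulr_ge0 ?(ltW d0) ?(ltW m0).
move=> s c z K E U /andP[s0 ssb] c0 K0 mE mU stab zU htv.
have s01 : 0 < s < 1 by rewrite s0/=; case/andP: sb01 => _; exact: lt_trans.
pose rho := m * c; have r0 : 0 < rho by rewrite mulr_gt0.
pose a := rho ^+ N.-1; have a0 : 0 < a by rewrite exprn_gt0.
have rhoE : rho = m * c by [].
have aE : a = rho ^+ N.-1 by [].
have aN : rho ^+ N = rho * a by rewrite -exprS prednK// (leq_trans _ N2).
clearbody a rho.
pose M := (rho `^ s)^-1 * (e * (rho ^+ N + rho * K)).
have M0 : 0 < M.
  by rewrite !mulr_gt0 ?invr_gt0 ?powR_gt0// ltr_wpDr ?mulr_ge0 ?exprn_gt0// ltW.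
apply: tv_bound_sub (tv_rotation N2 s01 c0 mE mU stab zU M0 _) => //; last first.
  move=> p pz; rewrite -mdef -rhoE /M eE; apply: cut_energy_le => //; first by rewrite s0.
  apply: tv_bound_sub (lexx K) htv => x xp.
  apply: (sub_cube _ (near_sub_cube pz xp)).
  by rewrite [leRHS](_ : _ = 10 * rho + c)// rhoE mdef /reach; ring.
rewrite -mdef -rhoE.
have -> : d * K + (d + B / (4 * d)) * m ^+ N.-1 * c ^+ N.-1 =
    d * (a + K) + B / (4 * d) * a by rewrite aE rhoE exprMn; ring.
rewrite ler_pdivrMr// mulrC -ler_pdivlMr// [leRHS](_ : _ =
    d * (a + K) * c / 8 + B / (4 * d) * a * c / 8); last by ring.
apply: sqrt_amgm.
- by rewrite !mulr_ge0 ?addr_ge0 ?(ltW d0) ?(ltW a0) ?(ltW c0).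
- by rewrite !mulr_ge0 ?invr_ge0 ?mulr_ge0 ?(ltW d0) ?(ltW a0) ?(ltW c0).
have -> : 4 * (d * (a + K) * c / 8 * (B / (4 * d) * a * c / 8)) =
    (2 ^+ N.+1 * ((@whirl_const R N + 4) * e)) * (rho ^+ 2 * (a * (a + K))).
  by rewrite BE rhoE; field; rewrite gt_eqF.
have -> : (2 * rho) `^ (N%:R + s) * ((@whirl_const R N + 4) * M) =
    ((2 * rho) `^ (N%:R + s) * (rho `^ s)^-1) *
    (((@whirl_const R N + 4) * e) * (rho * (a + K))).
  by rewrite /M aN; ring.
have -> : 2 ^+ N.+1 * ((@whirl_const R N + 4) * e) * (rho ^+ 2 * (a * (a + K))) =
    (2 ^+ N.+1 * rho ^+ N) * (((@whirl_const R N + 4) * e) * (rho * (a + K))).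
  by rewrite aN; ring.
apply: ler_wpM2r.
  exact: (mulr_ge0 (mulr_ge0 w0 (ltW e0)) (mulr_ge0 (ltW r0) (addr_ge0 (ltW a0) K0))).
rewrite ler_pdivrMr ?powR_gt0//.
have r20 : 2 * rho != 0 by rewrite gt_eqF// mulr_gt0.
rewrite powRD ?r20 ?implybT// powR_mulrn ?mulr_ge0 ?(ltW r0)// exprMn exprS.
rewrite powRM ?(ltW r0)// [leRHS](_ : _ = 2 ^+ N * rho ^+ N * (2 * rho `^ s)); last by ring.
apply: ler_wpM2l; first by rewrite mulr_ge0 ?exprn_ge0 ?(ltW r0).
apply: ler_wpM2r; first exact: powR_ge0.
by rewrite -[leRHS]powRr1//; apply: ler_powR; [rewrite ler1n|case/andP: s01 => _ /ltW].
Qed.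

End tv_improve.

(** * Covering a cube by small cubes *)

Section grid.
Context {R : realType} {N : nat}.
Local Notation V := 'rV[R]_N.
Local Notation L := (lebesgue_space R N).
Local Notation mu := (@lebesgue_outer R N).
Implicit Types (E U S : set V) (s c r K : R) (w x z : V) (n : nat).

Lemma tv_bound_cover (I : finType) (F : I -> set V) S E K : 0 <= K ->
  (forall x, S x -> exists k, F k x) ->
  (forall k, (exists2 x, S x & F k x) -> tv_bound (F k) E K) ->
  tv_bound S E (#|I|%:R * K).
Proof.
move=> K0 SF hF.
have [t0 t00 h] : exists2 t0 : R, 0 < t0 & forall k t, 0 < t < t0 ->
    forall l, (mu ((S `&` F k) `&` edif E (translate (axis l t))) <= (K * t)%:E)%E.
  apply: uniform_small => k.
  have [/hF[t0 t00 h]|no] := pselect (exists2 x, S x & F k x).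
    exists t0 => // t t1 l; apply: le_trans (h l t t1).
    by apply: le_lebesgue_outer => x [[_ Fx] xe].
  exists 1 => // t /andP[t1 _] l; rewrite (_ : _ `&` _ = set0).
    by rewrite lebesgue_outer0 lee_fin mulr_ge0// ltW.
  by rewrite -subset0 => x [[Sx Fx] _]; apply: no; exists x.
exists t0 => // l t tt.
pose G k := (S `&` F k) `&` edif E (translate (axis l t)).
apply: le_trans (lebesgue_outer_fin_cover (F := G) _) _.
  by move=> x [Sx xe]; have [k Fx] := SF x Sx; exists k.
apply: (@le_trans _ _ (\sum_(k : I) (K * t)%:E)%E).
  by apply: lee_sum => k _; exact: h.
by rewrite sumEFin sumr_const lee_fin -[leRHS]mulrA [leRHS]mulr_natl.
Qed.

(** Lower corners of the cells of a regular subdivision. A cell lies in the cube whose radius is one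
    full mesh [2 * r / n%:R] about its corner, so the covering cubes overlap. *)
Definition grid_point z r n (f : {ffun 'I_N -> 'I_n}) : V :=
  \row_k (z ord0 k - r + (2 * r / n%:R) * (f k)%:R).

Lemma grid_point_near z r n (f : {ffun 'I_N -> 'I_n}) k : 0 <= r ->
  `|grid_point z r f ord0 k - z ord0 k| <= r.
Proof.
move=> r0; rewrite mxE.
have n0 : (0 : R) < n%:R by rewrite ltr0n; case: n f => // f; case: (f k).
have : 2 * r / n%:R * (f k)%:R <= 2 * r.
  rewrite mulrAC ler_pdivrMr// ler_wpM2l ?mulr_ge0// ler_nat.
  exact/ltnW.
have : 0 <= 2 * r / n%:R * (f k)%:R by rewrite mulr_ge0// divr_ge0 ?mulr_ge0.
by move=> h1 h2; rewrite ler_norml; apply/andP; split; lra.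
Qed.

Lemma grid_cover z r n x : 0 < r -> (0 < n)%N -> cube z r x ->
  exists f : {ffun 'I_N -> 'I_n}, cube (grid_point z r f) (2 * r / n%:R) x.
Proof.
move=> r0 n0 xr.
have n0' : (0 : R) < n%:R by rewrite ltr0n.
pose h := 2 * r / n%:R; have h0 : 0 < h by rewrite divr_gt0// mulr_gt0.
have hn : h * n%:R = 2 * r by rewrite divfK// gt_eqF.
pose u k := (x ord0 k - z ord0 k + r) / h.
have u0 k : 0 <= u k.
  by rewrite divr_ge0 ?(ltW h0)//; have := xr k; rewrite ltr_norml => /andP[]; lra.
have un k : (Num.truncn (u k) < n)%N.
  rewrite truncn_lt_nat// ltr_pdivrMr// mulrC hn.
  by have := xr k; rewrite ltr_norml => /andP[]; lra.
exists [ffun k => Ordinal (un k)] => k; rewrite mxE ffunE /= -/h.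
have /andP[t1 t2] := truncn_itv (u0 k).
rewrite ler_pdivlMr// in t1; rewrite -natr1 ltr_pdivrMr// mulrDl mul1r in t2.
by rewrite ltr_norml; apply/andP; split; lra.
Qed.

Lemma grid_card n : #|{: {ffun 'I_N -> 'I_n}}| = (n ^ N)%N.
Proof. by rewrite card_ffun !card_ord. Qed.

Lemma tv_bound_grid z r n S E K : 0 < r -> (0 < n)%N -> 0 <= K -> S `<=` cube z r ->
  (forall w, (forall k, `|w ord0 k - z ord0 k| <= r) ->
     (exists2 x, S x & cube w (2 * r / n%:R) x) -> tv_bound (cube w (2 * r / n%:R)) E K) ->
  tv_bound S E ((n ^ N)%:R * K).
Proof.
move=> r0 n0 K0 Sz h; rewrite -grid_card.
apply: (@tv_bound_cover _ (fun f => cube (grid_point z r f) (2 * r / n%:R))) => //.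
  by move=> x /Sz; exact: grid_cover.
by move=> f; apply: h => k; apply: grid_point_near; exact: ltW.
Qed.

Lemma cube_sub_eball_near x0 w c d r x : (0 < N)%N -> enorm (x - x0) < r -> cube w c x ->
  cube w d `<=` eball x0 (r + N%:R * (c + d)).
Proof.
move=> N0 xr xw y yw; rewrite /eball /=.
have -> : y - x0 = (x - x0) + (y - x) by rewrite [RHS]addrC addrA subrK.
apply: le_lt_trans (enorm_triangle _ _) _; apply: ltrD => //.
apply: enorm_lt_coord => // k; have := xw k; have := yw k; rewrite !mxE !ltr_norml.
by move=> /andP[? ?] /andP[? ?]; apply/andP; split; lra.
Qed.

End grid.

(** * Iterating the improvement *)

Section tv_uniform.
Context {R : realType} {N : nat}.
Local Notation V := 'rV[R]_N.
Local Notation L := (lebesgue_space R N).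
Local Notation reach := (@reach R N).
Implicit Types (E U S : set V) (s c r K : R) (w x z : V) (n : nat).

(** Requiring the doubled cube to lie in [D] leaves a collar in which much smaller cubes, centred in
    the original one, can be enlarged by [reach] and doubled. *)
Definition interior_tv E (D : set V) r K := forall z c, 0 < c -> c <= r ->
  cube z (2 * c) `<=` D -> tv_bound (cube z c) E K.

(** With [n] at least [4 * reach], the cubes of radius [2 * c / n%:R] satisfy the hypothesis at the
    enlarged scale, and there are [n ^ N] of them. *)
Lemma interior_tv_improve E D r K G d n : 0 < r -> 0 <= K -> 0 <= d -> 0 <= G ->
  4 * reach <= n%:R ->
  (forall z c, 0 < c -> c <= r -> cube z (reach * c) `<=` D ->
     tv_bound (cube z (reach * c)) E K -> tv_bound (cube z c) E (d * K + G)) ->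
  interior_tv E D r K -> interior_tv E D r ((n ^ N)%:R * (d * K + G)).
Proof.
move=> r0 K0 d0 G0 nr step hK z c c0 cr zD.
have reach1 : 1 <= reach by rewrite /reach lerDr.
have n0 : (0 : R) < n%:R by apply: lt_le_trans nr; lra.
have hn : 2 * reach * (2 * c / n%:R) <= c.
  rewrite mulrA ler_pdivrMr// (_ : _ * _ = 4 * reach * c); last by ring.
  by rewrite mulrC ler_wpM2l// ltW.
have h0 : 0 < 2 * c / n%:R by rewrite divr_gt0// mulr_gt0.
apply: (@tv_bound_grid _ _ z c) => //.
- by rewrite -(ltr0n R).
- by rewrite addr_ge0// mulr_ge0.
set h := 2 * c / n%:R in hn h0 *.
have hr : h <= reach * h by rewrite ler_peMl// ltW.
move=> w wz _; apply: step => //.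
- lra.
- move=> x xw; apply: zD; apply: (sub_cube _ (near_sub_cube wz xw)).
  have := ltW h0; lra.
apply: hK; [lra|lra|].
move=> x xw; apply: zD; apply: (sub_cube _ (near_sub_cube wz xw)).
by rewrite mulrA; lra.
Qed.

(** With [q = (n ^ N)%:R] and [d = (2 * q)^-1], one improvement sends a bound K to K/2 + q C a,
    where a = r^(N-1); the fixed point is 2 q C a. As [n] depends on [N] only, [q] is available
    before [d] and [C] are chosen. *)
Lemma tv_uniform (sbar : R) : (2 <= N)%N -> 0 < sbar < 1 ->
  exists2 C, 0 <= C & forall s E x0 r, 0 < s < sbar -> 0 < r ->
    measurable (E : set L) -> stable_rearrangement s E (eball x0 (8 * r)) ->
    tv_bound (eball x0 r) E (C * r ^+ N.-1).
Proof.
move=> N2 sb01; have N0 : (0 < N)%N by exact: leq_trans N2.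
(* This is 4 (N + 1) (reach + 1). It ensures [n1] for the improvement, [n2] so that the cubes of the
   starting bound stay in the ball of radius [8 * r], and [n3] so that the doubled cubes of the last
   covering stay in [D]. *)
pose n := (4 * (N + 1) * (10 * N + 32))%N.
have nE : n%:R = 4 * (N%:R + 1) * (10 * N%:R + 32) :> R.
  rewrite /n; lra.
have reachE : reach = 10 * N%:R + 31 by rewrite /reach; ring.
have NR : (1 : R) <= N%:R by rewrite ler1n.
have n0 : (0 < n)%N by rewrite /n !muln_gt0 !addn_gt0 !orbT.
clearbody n; have n0' : (0 : R) < n%:R by rewrite ltr0n.
have n1 : 4 * reach <= n%:R by rewrite nE reachE; nra.
have n2 : 2 * (N%:R * (reach + 1)) <= n%:R by rewrite nE reachE; nra.
have n3 : (2 : R) * N%:R <= n%:R by rewrite nE; nra.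
pose q : R := (n ^ N)%:R; have q0 : 0 < q by rewrite ltr0n expn_gt0 n0.
have d0 : 0 < (2 * q)^-1 by rewrite invr_gt0 mulr_gt0.
have [C C0 hC] := tv_improve N2 sb01 d0.
exists (q * (2 * (q * C) + 1)).
  by rewrite mulr_ge0 ?addr_ge0 ?mulr_ge0// ltW.
move=> s E x0 r ssb r0 mE stab.
have s01 : 0 < s < 1.
  by case/andP: ssb => s0 s1; case/andP: sb01 => _; rewrite s0; exact: lt_trans.
have mU : measurable (eball x0 (8 * r) : set L) by exact: measurable_eball.
pose D := eball x0 (4 * r).
have DU : D `<=` eball x0 (8 * r).
  by move=> x; rewrite /D /eball /= => h; apply: lt_trans h _; rewrite ltr_pM2r//; lra.
pose a := r ^+ N.-1; have a0 : 0 < a by rewrite exprn_gt0.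
have rp c : 0 < c -> c <= r -> c ^+ N.-1 <= a.
  by move=> c0 cr; rewrite lerXn2r ?nnegrE// ltW.
pose h := 2 * (4 * r) / n%:R.
have h0 : 0 < h by rewrite divr_gt0// !mulr_gt0.
have [K1 K10 hK1] := tv_apriori N2 s01 h0 mE mU stab.
have hn : N%:R * (h + reach * h) <= 4 * r.
  rewrite (_ : _ * _ = N%:R * (reach + 1) * (8 * r) / n%:R); last first.
    by rewrite /h; field; rewrite gt_eqF.
  rewrite ler_pdivrMr//; nra.
(* Every interior cube lies in [D], and [D] is covered once and for all by cubes of radius [h]; the
   bound is crude but common to all interior cubes. *)
have base : interior_tv E D r (q * K1).
  move=> z c c0 cr zD; apply: (@tv_bound_sub _ _ _ D _ (q * K1)) => //.
    by move=> x xz; apply: zD; apply: sub_cube xz; lra.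
  apply: (@tv_bound_grid _ _ x0 (4 * r)) => //; first by rewrite mulr_gt0.
    exact: eball_sub_cube.
  move=> w _ [x xD xw]; apply: hK1 => y yw.
  have := cube_sub_eball_near N0 xD xw yw; rewrite /eball /= => /lt_le_trans; apply.
  by rewrite -/h; lra.
have iter k : interior_tv E D r ((q * K1) / 2 ^+ k + 2 * (q * (C * a))).
  have Ca : 0 <= C * a by rewrite mulr_ge0// ltW.
  elim: k => [|k IH].
    move=> z c c0 cr zD; apply: tv_bound_sub (base z c c0 cr zD) => //.
    by rewrite expr0 divr1 lerDl !mulr_ge0// ltW.
  have K0 : 0 <= (q * K1) / 2 ^+ k + 2 * (q * (C * a)).
    by rewrite addr_ge0 ?divr_ge0 ?exprn_ge0 ?mulr_ge0// ltW.
  have := @interior_tv_improve E D r _ (C * a) _ n r0 K0 (ltW d0) Ca n1 _ IH.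
  have e : q * ((2 * q)^-1 * ((q * K1) / 2 ^+ k + 2 * (q * (C * a))) + C * a) =
      (q * K1) / 2 ^+ k.+1 + 2 * (q * (C * a)).
    by rewrite exprS; field; rewrite !gt_eqF ?exprn_gt0.
  rewrite -/q e.
  apply => z c c0 cr zD htv.
  apply: tv_bound_sub (hC s c z _ E _ ssb c0 K0 mE mU stab _ htv) => //.
    by rewrite lerD2l ler_wpM2l// rp.
  exact: subset_trans zD DU.
(* After enough halvings the starting bound drops below [a], which accounts for the [+ 1] in the
   constant. *)
have [k hk] : exists k, (q * K1) / 2 ^+ k <= a.
  have := @truncn_itv _ ((q * K1) / a); rewrite divr_ge0 ?mulr_ge0 ?(ltW q0) ?(ltW a0)//.
  move=> /(_ isT) /andP[_ h1]; exists (Num.truncn ((q * K1) / a)).+1.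
  rewrite ler_pdivrMr ?exprn_gt0// [a * _]mulrC -ler_pdivrMr//; apply: le_trans (ltW h1) _.
  by rewrite -natrX ler_nat ltnW// ltn_expl.
have -> : q * (2 * (q * C) + 1) * r ^+ N.-1 = q * (2 * (q * (C * a)) + a) by rewrite /a; ring.
have c0 : 0 < 2 * r / n%:R by rewrite divr_gt0// mulr_gt0.
have cn : 2 * r / n%:R <= r.
  by rewrite ler_pdivrMr// mulrC ler_wpM2l ?(ltW r0)//; lra.
apply: (@tv_bound_grid _ _ x0 r) => //.
- by rewrite addr_ge0 ?mulr_ge0// ltW.
- exact: eball_sub_cube.
move=> w _ [x xr xw]; apply: tv_bound_sub (iter k w (2 * r / n%:R) c0 cn _) => //.
  by rewrite addrC lerD2l.
move=> y yw; have := cube_sub_eball_near N0 xr xw yw.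
rewrite /D /eball /= => /lt_le_trans; apply.
have : N%:R * (2 * r / n%:R + 2 * (2 * r / n%:R)) <= 3 * r.
  rewrite (_ : _ * _ = (2 * N%:R) * (3 * r) / n%:R); last by field; rewrite gt_eqF.
  by rewrite ler_pdivrMr// mulrC ler_wpM2l// mulr_ge0// ltW.
lra.
Qed.
End tv_uniform.

(** * The perimeter *)

Section continuous_measurable.
Context {R : realType} {N : nat}.
Local Notation V := 'rV[R]_N.
Local Notation L := (lebesgue_space R N).

Lemma cube_sub_ball (x : V) (e : R) : 0 < e -> cube x e `<=` ball x e.
Proof.
move=> e0 y xy; rewrite -ball_normE /=.
rewrite [X in X < _]/Num.Def.normr/= mx_normrE; apply/bigmax_ltP; split => // -[k l] _ /=.
by rewrite [k]ord1 !mxE distrC; exact: xy.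
Qed.

Lemma measurable_open (O : set V) : open O -> measurable (O : set L).
Proof.
move=> oO.
pose Q (u : {ffun 'I_N -> rat} * rat) := cube (\row_k ratr (u.1 k) : V) (ratr u.2).
pose F u := if `[< Q u `<=` O >] then Q u else set0.
have -> : O = \bigcup_u F u.
  apply/seteqP; split => [x Ox|x [u _]]; last first.
    by rewrite /F; case: asboolP => // h; exact: h.
  have /nbhs_ballP[e /= e0 he] : nbhs x O by exact: open_nbhs_nbhs.
  have [d] : exists d, ratr d \in `]0, (e / 2)[ by apply: rat_in_itvoo; rewrite divr_gt0.
  rewrite in_itv /= => /andP[d0 de].
  have /choice[q hq] : forall k : 'I_N, exists a,
      ratr a \in `](x ord0 k - ratr d), (x ord0 k)[.
    by move=> k; apply: rat_in_itvoo; rewrite ltrBlDr ltrDl.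
  have Qx : Q ([ffun k => q k], d) x.
    move=> k; rewrite /= mxE ffunE; have := hq k; rewrite in_itv /= => /andP[? ?].
    by rewrite ltr_norml; apply/andP; split; lra.
  exists ([ffun k => q k], d) => //; rewrite /F; case: asboolP => // -[].
  move=> y Qy; apply: he; apply: cube_sub_ball => // k; have := Qx k; have := Qy k.
  rewrite /= !mxE !ltr_norml => /andP[? ?] /andP[? ?].
  by apply/andP; split; lra.
apply: countable_bigcupT_measurable; first exact: countableP.
by move=> u; rewrite /F; case: ifP => _ //; exact: measurable_cube.
Qed.

Lemma continuous_measurable (f : V -> R) : continuous f -> measurable_fun setT (f : L -> R).
Proof.
move=> cf; apply: (measurability _ (RGenInftyO.measurableE R)) => _ [_ [c ->] <-].
rewrite setTI; apply: measurable_open; apply: open_comp => [x _|]; first exact: cf.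
exact: interval_open.
Qed.

Lemma is_derive_along (f : V -> R) (x v : V) (t : R) : derivable f (x + t *: v) v ->
  is_derive t (1 : R) (fun u : R => f (x + u *: v)) ('D_v f (x + t *: v)).
Proof.
have e : (fun h : R => h^-1 *: (((fun u : R => f (x + u *: v)) \o shift t) (h *: 1) -
    f (x + t *: v))) =
    (fun h : R => h^-1 *: ((f \o shift (x + t *: v)) (h *: v) - f (x + t *: v))).
  apply/funext => h /=; congr (_ *: (f _ - _)).
  by rewrite scalerDl addrCA addrC addrA /GRing.scale /= mulr1 addrC addrA.
by move=> df; apply: DeriveDef; rewrite /derivable /derive e.
Qed.
End continuous_measurable.

(** * Integrals of difference quotients *)

Section difference_quotient.
Context {R : realType} {N : nat}.
Local Notation V := 'rV[R]_N.
Local Notation L := (lebesgue_space R N).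
Local Notation mu := (@lebesgueN R N).
Implicit Types (E : set V) (K h c r : R) (x p v : V).

Lemma integral_translate (F : L -> \bar R) v : measurable_fun setT F ->
  (\int[mu]_x F ((x : V) + v)%R = \int[mu]_x F x)%E.
Proof.
move=> mF; have hK : cancel (translate v) (translate (- v)) by exact: translateK.
have hK' : cancel (translate (- v)) (translate v).
  by move=> x; rewrite -{1}[v]opprK translateK.
have H := @integral_outer_invariant _ _ _ _ _ hK hK' (@outer_invariant_translate R N v).
rewrite integralE [RHS]integralE; congr (_ - _)%E.
  rewrite -(H (F^\+)%E (measurable_funepos mF)); last by move=> x; exact: funepos_ge0.
  by apply: eq_integral => x _; rewrite !funeposE.
rewrite -(H (F^\-)%E (measurable_funeneg mF)); last by move=> x; exact: funeneg_ge0.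
by apply: eq_integral => x _; rewrite !funenegE.
Qed.

Lemma integrable_ball_indic c p r : mu.-integrable setT (fun x => (c * \1_(eball p r) x)%:E).
Proof.
have mB : measurable (eball p r : set L) by exact: measurable_eball.
suff iB : mu.-integrable setT (fun x => (\1_(eball p r) x)%:E) by exact: (integrableZl measurableT c iB).
apply/integrableP; split.
  by apply/measurable_EFinP; exact: measurable_indic.
rewrite (eq_integral (fun x : L => (\1_(eball p r) x)%:E)); last first.
  by move=> x _; rewrite /= ger0_norm.
by rewrite integral_indic// setIT; exact: lebesgue_outer_eball_lty.
Qed.

Lemma integrable_ball_bounded (f : V -> R) c p r : measurable_fun setT (f : L -> R) ->
  (forall x, `|f x| <= c * \1_(eball p r) x) -> mu.-integrable setT (fun x => (f x)%:E).
Proof.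
move=> mf fb; apply: le_integrable (integrable_ball_indic c p r) => //.
  exact/measurable_EFinP.
by move=> x _; rewrite /= lee_fin; apply: le_trans (fb x) _; exact: ler_norm.
Qed.

Lemma integral_setE_indic E (f : V -> R) :
  (\int[mu]_(x in E) (f x)%:E = \int[mu]_x (f x * \1_E x)%:E)%E.
Proof.
rewrite integral_mkcond; apply: eq_integral => x _; rewrite patchE indicE.
by case: ifP => _; rewrite ?mulr1 ?mulr0.
Qed.

Lemma measurable_edif E (f g : V -> V) : cancel f g -> cancel g f -> outer_invariant f ->
  measurable (E : set L) -> measurable (edif E f : set L).
Proof.
move=> fK gK hf mE; have mf : measurable (f @^-1` E : set L) by exact: cara_preimage fK gK hf mE.
have -> : edif E f = (E `\` f @^-1` E) `|` (f @^-1` E `\` E).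
  apply/seteqP; split=> [x|x []]; rewrite /edif /=.
  - have [/set_mem ?|/negP nE] := boolP (x \in E); have [/set_mem ?|/negP nf] := boolP (f x \in E);
      move=> // _; [left|right]; split=> // h; [apply: nf|apply: nE]; exact: mem_set.
  - by case=> a b; rewrite mem_set//; apply/eqP => /esym/set_mem.
  - by case=> a b; rewrite [f x \in E]mem_set//; apply/eqP => /set_mem.
by apply: measurableU; apply: measurableD.
Qed.

Lemma continuous_sub_comp (g : V -> R) v : continuous g -> continuous (fun x : V => g (x - v)).
Proof.
move=> cg x; apply: (@continuous_comp _ _ _ (fun x : V => x - v) g); last exact: cg.
by apply: (@continuousB _ _ _ id (cst v)); [exact: cvg_id|exact: cst_continuous].
Qed.

(** A discrete integration by parts moves the difference from [g] to the indicator of [E]; as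
    [|g| <= 1] vanishes off the ball, the measure of the displaced part bounds the result. *)
Lemma difference_quotient_le E p r K h (g : V -> R) k : measurable (E : set L) ->
  continuous g -> (forall x, ~ eball p r x -> g x = 0) -> (forall x, `|g x| <= 1) ->
  0 < h -> (mu (eball p r `&` edif E (translate (axis k h))) <= (K * h)%:E)%E ->
  (\int[mu]_(x in E) ((g x - g (x - axis k h)) / h)%:E <= K%:E)%E.
Proof.
move=> mE cg g0 g1 h0 hK; set v := axis k h in hK *.
have hv : cancel (translate v) (translate (- v)) by exact: translateK.
have hv' : cancel (translate (- v)) (translate v).
  by move=> x; rewrite -{1}[v]opprK translateK.
have mEv : measurable (translate v @^-1` E : set L).
  exact: cara_preimage hv hv' (outer_invariant_translate v) mE.
have mS : measurable (eball p r `&` edif E (translate v) : set L).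
  apply: measurableI; first exact: measurable_eball.
  exact: measurable_edif hv hv' (outer_invariant_translate v) mE.
have cgv := continuous_sub_comp (v := v) cg.
have mM (f : V -> R) (A : set V) : continuous f -> measurable (A : set L) ->
    measurable_fun setT ((fun x => f x * \1_A x / h) : L -> R).
  move=> cf mA; apply: measurable_funM; last exact: measurable_cst.
  by apply: measurable_funM; [exact: continuous_measurable|exact: measurable_indic].
have bM (f : V -> R) (A B : set V) : (forall x, ~ B x -> f x = 0) -> (forall x, `|f x| <= 1) ->
    forall x, `|f x * \1_A x / h| <= h^-1 * \1_B x.
  move=> fB f1 x; rewrite normrM [`|h^-1|]gtr0_norm ?invr_gt0// mulrC ler_wpM2l ?invr_ge0 ?(ltW h0)//.
  rewrite !indicE; have [Bx|/negP Bx] := boolP (x \in B); last first.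
    by rewrite fB ?mul0r ?normr0// => /mem_set.
  by rewrite normrM mulr_ile1// normr_nat lern1 leq_b1.
pose a x := g x * \1_E x / h.
pose b x := g (x - v) * \1_E x / h.
pose b' x := g x * \1_(translate v @^-1` E) x / h.
have ia : mu.-integrable setT (fun x => (a x)%:E).
  by apply: (@integrable_ball_bounded _ h^-1 p r); [exact: mM|exact: bM].
have ib' : mu.-integrable setT (fun x => (b' x)%:E).
  by apply: (@integrable_ball_bounded _ h^-1 p r); [exact: mM|exact: bM].
have mb : measurable_fun setT (b : L -> R) by exact: mM.
have ib : mu.-integrable setT (fun x => (b x)%:E).
  apply: (@integrable_ball_bounded _ h^-1 (p + v) r) => //; apply: bM => // x xp.
  by apply: g0 => xb; apply: xp; rewrite /eball /= opprD addrA addrAC.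
(* Translation invariance carries the shift from the function to the set. *)
have bb' : (\int[mu]_x (b x)%:E = \int[mu]_x (b' x)%:E)%E.
  rewrite -(integral_translate v); last exact/measurable_EFinP.
  by apply: eq_integral => x _; rewrite /b /b' addrK !indicE.
rewrite integral_setE_indic.
rewrite (eq_integral (fun x : L => (a x)%:E - (b x)%:E)%E); last first.
  by move=> x _; rewrite -EFinB /a /b; congr (_%:E); ring.
rewrite integralB_EFin// bb' -integralB_EFin//.
have iS : mu.-integrable setT
    (fun x => (h^-1 * \1_(eball p r `&` edif E (translate v)) x)%:E).
  apply: (@integrable_ball_bounded _ h^-1 p r).
    by apply: measurable_funM; [exact: measurable_cst|exact: measurable_indic].
  move=> x; rewrite ger0_norm ?mulr_ge0 ?invr_ge0 ?(ltW h0)// ler_wpM2l ?invr_ge0 ?(ltW h0)//.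
  by rewrite !indicE ler_nat in_setI; case: (x \in eball p r); rewrite ?leq_b1.
apply: (@le_trans _ _ (\int[mu]_x (h^-1 * \1_(eball p r `&` edif E (translate v)) x)%:E)%E).
  apply: le_integral => //; first exact: integrableB.
  move=> x _; rewrite -EFinB lee_fin /a /b' -mulrBl mulrC ler_wpM2l ?invr_ge0 ?(ltW h0)//.
  rewrite -mulrBr !indicE in_setI; have [Bx|/negP Bx] := boolP (x \in eball p r); last first.
    by rewrite g0 ?mul0r// => /mem_set.
  have -> : (x \in edif E (translate v)) = ((x \in E) != (translate v x \in E)).
    by apply/idP/idP => [/set_mem|/mem_set].
  have -> : (x \in translate v @^-1` E) = (translate v x \in E).
    by apply/idP/idP => /set_mem h'; exact: mem_set.
  have := g1 x; rewrite ler_norml => /andP[? ?].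
  by case: (x \in E); case: (_ \in E) => /=; lra.
rewrite (eq_integral (fun x : L =>
  (h^-1)%:E * (\1_(eball p r `&` edif E (translate v)) x)%:E)%E); last first.
  by move=> x _; rewrite EFinM.
rewrite ge0_integralZl//; last 2 first.
- by apply/measurable_EFinP; exact: measurable_indic.
- by rewrite lee_fin invr_ge0 ltW.
rewrite integral_indic// setIT muleC lee_pdivrMr//.
Qed.
End difference_quotient.

Section perimeter.
Context {R : realType} {N : nat}.
Local Notation V := 'rV[R]_N.
Local Notation L := (lebesgue_space R N).
Local Notation mu := (@lebesgueN R N).
Implicit Types (E : set V) (K h c r : R) (x p v : V).

Lemma continuous_bounded_ball (f : V -> R) p r : continuous f ->
  exists2 M, 0 <= M & forall x, enorm (x - p) <= r -> `|f x| <= M.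
Proof.
move=> cf; have /compact_bounded[M [_ hM]] : compact (f @` [set x | enorm (x - p) <= r]).
  apply: continuous_compact (@compact_eball _ _ p r).
  by apply: continuous_subspaceT => x; exact: cf.
have M1 : M < `|M| + 1 by rewrite ltr_pwDr// ler_norm.
by exists (`|M| + 1); [exact: addr_ge0|move=> x xr; apply: (hM _ M1); exists x].
Qed.

Lemma difference_quotient_cvg (g : V -> R) k x (h : nat -> R) :
  derivable g x (delta_mx ord0 k) -> (forall n, 0 < h n) ->
  (forall d, 0 < d -> exists n0, forall n, (n0 <= n)%N -> h n < d) ->
  ((g x - g (x - axis k (h n))) / h n)%:E @[n --> \oo] --> ('D_(delta_mx ord0 k) g x)%:E.
Proof.
move=> dg h0 hd; apply: cvg_EFin; first by near=> n.
apply/cvgrPdist_lt => e e0.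
have /cvgrPdist_lt/(_ e e0) := dg.
rewrite /at_right near_withinE => /nbhs_ballP[d /= d0 H].
have [n0 hn0] := hd d d0.
exists n0 => // n /= n0n.
have := H (- h n); rewrite -ball_normE /= sub0r opprK gtr0_norm// => /(_ (hn0 _ n0n)).
rewrite oppr_eq0 gt_eqF// => /(_ isT).
suff -> : (- h n)^-1 *: (g (- h n *: delta_mx ord0 k + x) - g x) =
  (g x - g (x - axis k (h n))) / h n by [].
rewrite /axis scaleNr [- _ + x]addrC /GRing.scale /= invrN mulNr -mulrN opprB mulrC.
by [].
Unshelve. all: by end_near.
Qed.

(** The bound on difference quotients passes to the limit by dominated convergence. Integrability is
    part of the conclusion because the partial derivatives are summed later. *)
Lemma derivative_integral_le E p r K k (g : V -> R) : measurable (E : set L) ->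
  0 < r -> 0 <= K -> tv_bound (eball p r) E K ->
  continuous g -> (forall x, derivable g x (delta_mx ord0 k)) ->
  continuous (fun x => 'D_(delta_mx ord0 k) g x) ->
  (forall x, ~ eball p r x -> g x = 0) -> (forall x, `|g x| <= 1) ->
  mu.-integrable E (fun x => ('D_(delta_mx ord0 k) g x)%:E) /\
  (\int[mu]_(x in E) ('D_(delta_mx ord0 k) g x)%:E <= K%:E)%E.
Proof.
move=> mE r0 K0 [t0 t00 htv] cg dg cdg g0 g1.
have [M M0 hM] := continuous_bounded_ball p (r + 2) cdg.
(* Steps below [t0] allow the variation bound; steps below 1 keep the quotients supported in the
   ball of radius [r + 1]. *)
pose c := Num.min t0 1 / 2.
have m0 : 0 < Num.min t0 1 by rewrite lt_min t00 ltr01.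
have m1 : Num.min t0 1 <= 1 by rewrite ge_min lexx orbT.
have mt : Num.min t0 1 <= t0 by rewrite ge_min lexx.
have c0 : 0 < c by rewrite divr_gt0.
have ct : c < t0 by rewrite /c; lra.
have c1 : c < 1 by rewrite /c; lra.
pose h n : R := c / n.+1%:R.
have h0 n : 0 < h n by rewrite divr_gt0.
have hc n : h n <= c by rewrite ler_pdivrMr// ler_peMr ?(ltW c0)// ler1n.
have hd d : 0 < d -> exists n0, forall n, (n0 <= n)%N -> h n < d.
  move=> d0; exists (Num.truncn (c / d)) => n hn.
  rewrite ltr_pdivrMr// mulrC -ltr_pdivrMr//.
  apply: lt_le_trans (truncnS_gt _) _; by rewrite ler_nat ltnS.
pose q n x := (g x - g (x - axis k (h n))) / h n.
have ea (t : R) : 0 < t -> enorm (axis k t : V) = t.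
  by move=> tp; rewrite enorm_axis gtr0_norm.
have tri (a b d : V) : enorm (a - d) <= enorm (a - b) + enorm (b - d).
  by have := enorm_triangle (a - b) (b - d); rewrite addrA subrK.
(* Domination by the mean value theorem: the intermediate point is within 1 of [x], hence in the
   ball of radius [r + 2] where [M] bounds the derivative. *)
have qb n x : `|q n x| <= M * \1_(eball p (r + 1)) x.
  rewrite indicE; have hn := hc n; have hn0 := h0 n.
  have [/set_mem xB|/negP xB] := boolP (x \in eball p (r + 1)); last first.
    rewrite /q !g0 ?subrr ?mul0r ?normr0 ?mulr0//.
      move=> xp; apply: xB; apply/mem_set; move: xp; rewrite /eball /= => xp.
      have := tri x (x - axis k (h n)) p.
      have -> : x - (x - axis k (h n)) = axis k (h n) by rewrite opprB addrC subrK.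
      rewrite ea// => h1.
      by apply: le_lt_trans h1 _; lra.
    by move=> xp; apply: xB; apply/mem_set; move: xp; rewrite /eball /= => xp; lra.
  pose y := x - axis k (h n).
  have cy : {within `[0, h n], continuous (fun u : R => g (y + u *: delta_mx ord0 k))}.
    apply: derivable_within_continuous => u _.
    exact: (@ex_derive _ _ _ _ _ _ _ (is_derive_along (dg _))).
  have [u] := MVT_segment (ltW hn0) (fun u _ => is_derive_along (dg (y + u *: delta_mx ord0 k))) cy.
  rewrite in_itv /= => /andP[u0 u1].
  rewrite scale0r addr0 -/(axis k (h n)) /y subrK subr0 => e.
  rewrite /q e mulfK ?gt_eqF// mulr1; apply: hM.
  have := tri (x - axis k (h n) + axis k u) x p.
  have -> : x - axis k (h n) + axis k u - x = axis k (u - h n).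
    by rewrite /axis scalerBl; apply/rowP => l; rewrite !mxE; ring.
  rewrite enorm_axis => h1; apply: le_trans h1 _.
  have : `|u - h n| <= 1 by rewrite ler_norml; apply/andP; split; lra.
  by move: xB; rewrite /eball /=; lra.
have mq n : measurable_fun setT (q n : L -> R).
  apply: measurable_funM; last exact: measurable_cst.
  apply: measurable_funB; first exact: continuous_measurable.
  exact: (continuous_measurable (continuous_sub_comp (v := _) cg)).
have sT : (E : set L) `<=` setT by [].
have mqE n : measurable_fun (E : set L) (fun x : L => (q n x)%:E).
  by apply: (measurable_funS measurableT sT); apply/measurable_EFinP; exact: mq.
have mdE : measurable_fun (E : set L) (fun x : L => ('D_(delta_mx ord0 k) g x)%:E).
  apply: (measurable_funS measurableT sT); apply/measurable_EFinP.
  exact: continuous_measurable.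
have iE : mu.-integrable E (fun x : L => (M * \1_(eball p (r + 1)) x)%:E).
  exact: integrableS (integrable_ball_indic M p (r + 1)).
have [i1 _ i3] := dominated_convergence mE mqE mdE
  (aeW _ (fun (x : L) _ => difference_quotient_cvg (dg x) h0 hd)) iE
  (aeW _ (fun (x : L) n _ => qb n x)).
split; first exact: i1.
rewrite -(cvg_lim _ i3)//; apply: lime_le; first by apply/cvg_ex; eexists; exact: i3.
apply: nearW => n; apply: (difference_quotient_le mE cg g0 g1 (h0 n)).
apply: htv; rewrite h0/=; exact: le_lt_trans (hc n) ct.
Qed.
End perimeter.

Section perimeter_bound.
Context {R : realType} {N : nat}.
Local Notation V := 'rV[R]_N.
Local Notation L := (lebesgue_space R N).
Local Notation mu := (@lebesgueN R N).

(** Each component of a test field is itself a scalar test function bounded by 1, so every term of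
    the divergence contributes at most [K]. *)
Lemma Per_le (E : set V) p r K : measurable (E : set L) -> 0 < r -> 0 <= K ->
  tv_bound (eball p r) E K -> (Per E (eball p r) <= (N%:R * K)%:E)%E.
Proof.
move=> mE r0 K0 htv; apply: ge_ereal_sup => _ [T [[dT cT] _ sT T1 ->]].
have T0 x : ~ eball p r x -> T x = 0.
  move=> xp; apply/eqP/negPn/negP => Tx; apply: xp; apply: sT.
  exact: subset_closure.
have dTv x v : derivable T x v by apply: diff_derivable; exact: dT.
pose g k x := T x ord0 k.
have dg k x v : derivable (g k) x v by move: (dTv x v) => /derivable_mxP; apply.
have Dg k x v : 'D_v (g k) x = ('D_v T x) ord0 k by rewrite derive_mx// mxE.
have cg k : continuous (g k).
  move=> x; apply: (@continuous_comp _ _ _ T (fun y : V => y ord0 k)).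
    by apply: differentiable_continuous; exact: dT.
  exact: coord_continuous.
have cDg k v : continuous (fun x => 'D_v (g k) x).
  have -> : (fun x => 'D_v (g k) x) = (fun y : V => y ord0 k) \o (fun x => 'D_v T x).
    by apply/funext => x; exact: Dg.
  move=> x; apply: continuous_comp; last exact: coord_continuous.
  exact: (cT v x I).
have h k : mu.-integrable E (fun x => ('D_(delta_mx ord0 k) (g k) x)%:E) /\
    (\int[mu]_(x in E) ('D_(delta_mx ord0 k) (g k) x)%:E <= K%:E)%E.
  apply: (@derivative_integral_le _ _ E p r K k (g k) mE r0 K0 htv (cg k)
    (fun x => dg k x _) (cDg k _)) => x; first by move=> xp; rewrite /g T0// mxE.
  exact: le_trans (coord_enorm _ _) (T1 x).
pose S (s : seq 'I_N) x := \sum_(k <- s) 'D_(delta_mx ord0 k) (g k) x.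
have hS s : mu.-integrable E (fun x => (S s x)%:E) /\
    (\int[mu]_(x in E) (S s x)%:E <= ((size s)%:R * K)%:E)%E.
  elim: s => [|k s [IH1 IH2]].
    have e : (fun x : L => (S [::] x)%:E) = cst 0%E.
      by apply/funext => x; rewrite /S big_nil.
    by rewrite e mul0r integral0; split => //; exact: integrable0.
  have [k1 k2] := h k.
  have e : (fun x : L => (S (k :: s) x)%:E) =
      ((EFin \o (fun x => 'D_(delta_mx ord0 k) (g k) x)) \+ (EFin \o S s))%E.
    by apply/funext => x; rewrite /S big_cons EFinD.
  rewrite e; split; first exact: integrableD.
  rewrite integralD_EFin// /= -natr1 mulrDl mul1r addrC EFinD.
  exact: leeD.
have := (hS (enum 'I_N)).2; rewrite size_enum_ord; apply: le_trans.
rewrite le_eqVlt; apply/orP; left; apply/eqP; apply: eq_integral => x _.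
rewrite /S big_enum /divergence; congr (_%:E); apply: eq_bigr => k _.
by rewrite Dg.
Qed.
End perimeter_bound.

Theorem proposition3p4 (R : realType) (N : nat) (hN : (2 <= N)%N)
    (sbar : R) (hsbar : 0 < sbar < 1) :
  exists C : R, 0 < C /\
    forall (s : R) (E : set 'rV[R]_N) (x0 : 'rV[R]_N) (r : R),
      0 < s < sbar -> 0 < r ->
      (@lebesgue_outer R N).-cara.-measurable E ->
      s_minimal s E (eball x0 (8 * r)) ->
      stable_rearrangement s E (eball x0 (8 * r)) ->
      (Per E (eball x0 r) <= (C * r ^+ N.-1)%:E)%E.
Proof.
have [C C0 hC] := @tv_uniform R N sbar hN hsbar.
(* Adding 1 makes the constant positive even if [C] is 0. *)
exists (N%:R * C + 1); split; first by rewrite ltr_wpDl// mulr_ge0.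
move=> s E x0 r ssb r0 mE _ stab.
have rN : 0 <= r ^+ N.-1 by rewrite exprn_ge0// ltW.
apply: le_trans (Per_le mE r0 (mulr_ge0 C0 rN) (hC s E x0 r ssb r0 mE stab)) _.
by rewrite lee_fin mulrDl mul1r mulrA lerDl.
Qed.
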